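(* Let $\varphi\in L^2(\mathbb{R}^2)$. For $\xi\in[0,1]$ define the following. For $j_1,j_2,l_1,l_2\in\mathbb{Z}$, let $$P^\varphi_{j_1,j_2,l_1,l_2}(\xi)=\sum_{m\in\mathbb{Z}}\int_{\mathbb{R}}K_\varphi^{2^{-2j_1}}\big(2^{j_1+j_2}(\xi+m)+l_1,2^{j_1}\eta\big)\,\overline{K_\varphi^{2^{-2j_2}}\big(2^{2j_2}(\xi+m)+l_2,2^{j_2}\eta\big)}\,d\eta .$$ For $j\in\mathbb{Z}\setminus\{0\}$, $l,m\in\mathbb{Z}$ and $y\in\mathbb{R}$, let $$S^{\varphi}_{j,l}(\xi,m,y)=K_{e\left(\left(\frac{2^{-2j}-1}{2}\right)l,\,0\right)\varphi}\left(\frac{2(\xi+m-y)}{1+2^{-2j}}+l,\;\frac{2y}{1-2^{-2j}}\right).$$ For $j\in\mathbb{Z}\setminus\{0\}$ and $l,l_1,l_2\in\mathbb{Z}$, let $$R^\varphi_{j,l}(\xi)=\sum_{m\in\mathbb{Z}}\int_{\mathbb{R}}|S^{\varphi}_{j,l}(\xi,m,y)|^2\,dy,\qquad Q^\varphi_{j,l_1,l_2}(\xi)=\sum_{m\in\mathbb{Z}}\int_{\mathbb{R}}S^{\varphi}_{j,l_1}(\xi,m,y)\,\overline{S^{\varphi}_{j,l_2}(\xi,m,y)}\,dy .$$ Then the twisted wavelet system $\{\mathcal{D}_{2^j}(T^t_{(k,l)})^{2^{-2j}}\varphi:k,l,j\in\mathbb{Z}\}$ is orthonormal in $L^2(\mathbb{R}^2)$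 if and only if the following five conditions hold: (i) $\displaystyle\sum_{m\in\mathbb{Z}}\int_{\mathbb{R}}|K_\varphi(\xi+m,\eta)|^2\,d\eta=1$ for a.e. $\xi\in[0,1]$; (ii) $\displaystyle\sum_{m\in\mathbb{Z}}\int_{\mathbb{R}}K_\varphi(\xi+m,\eta)\,\overline{K_\varphi(\xi+m+l,\eta)}\,d\eta=0$ for a.e. $\xi\in[0,1]$, for all $l\in\mathbb{Z}\setminus\{0\}$; (iii) $P^\varphi_{j_1,j_2,l_1,l_2}(\xi)=0$ for a.e. $\xi\in[0,1]$, for all $j_1,j_2,l_1,l_2\in\mathbb{Z}$ with $j_2>j_1$; (iv) $Q^\varphi_{j,l_1,l_2}(\xi)=0$ for a.e. $\xi\in[0,1]$, for all $j\in\mathbb{Z}\setminus\{0\}$ and all $l_1\neq l_2$ in $\mathbb{Z}$; (v) $R^\varphi_{j,l}(\xi)=\dfrac{|1-2^{-4j}|}{4}$ for a.e. $\xi\in[0,1]$, for all $j\in\mathbb{Z}\setminus\{0\}$ and all $l\in\mathbb{Z}$.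
   Context: For $(k,l)\in\mathbb{Z}^2$, $\lambda\in\mathbb{R}^*=\mathbb{R}\setminus\{0\}$ and $j\in\mathbb{Z}$, the $\lambda$-twisted translation and the dilation on $L^2(\mathbb{R}^2)$ are $$(T^t_{(k,l)})^\lambda\varphi(x,y)=e^{\pi i\lambda(xl-yk)}\varphi(x-k,y-l),\qquad \mathcal{D}_{2^j}\varphi(x,y)=2^j\varphi(2^jx,2^jy).$$ In particular $(T^t_{(k,l)})^{2^{-2j}}$ is the twisted translation with $\lambda=2^{-2j}$. For $(a,b)\in\mathbb{R}^2$, the operator $e(a,b)$ on $L^2(\mathbb{R}^2)$ is $(e(a,b)\varphi)(x,y)=e^{2\pi i(ax+by)}\varphi(x,y)$. For $f\in L^2(\mathbb{R}^2)$ and $\lambda\in\mathbb{R}^*$, $K^\lambda_f\in L^2(\mathbb{R}^2)$ is the function $$K^\lambda_f(\xi,\eta)=\int_{\mathbb{R}}f(x,\eta-\xi)e^{\pi i\lambda x(\xi+\eta)}\,dx,$$ where the integral is extended to $L^2$ functions by density (i.e. as a partial Fourier transform in the $L^2$ sense); $K_f$ denotes $K^1_f$ (the kernel of the Weyl transform of $f$). $L^2(\mathbb{C})$ is identified with $L^2(\mathbb{R}^2)$. *)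

(* Defs.v *)
From HB Require Import structures.
From mathcomp Require Import all_boot all_order all_algebra.
From mathcomp Require Import all_classical all_reals all_analysis.
From mathcomp Require Import complex.

Set Implicit Arguments.
Unset Strict Implicit.
Unset Printing Implicit Defensive.

Import Order.TTheory GRing.Theory Num.Theory.
Import numFieldNormedType.Exports.

Local Open Scope classical_set_scope.
Local Open Scope ring_scope.
Local Open Scope complex_scope.

Section complex_integration.
Context {R : realType}.

Definition expi (t : R) : R[i] := cos t +i* sin t.

Definition sqmod (z : R[i]) : R := ComplexField.Normc.normc z ^+ 2.

Definition Cintegral d (T : measurableType d) (mu : {measure set T -> \bar R})
    (f : T -> R[i]) : R[i] :=
  (\int[mu]_x complex.Re (f x)) +i* (\int[mu]_x complex.Im (f x)).

(* Sum of an absolutely convergent series indexed by Z; [\esum] is meant for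
   nonnegative terms, whence the positive and negative parts. *)
Definition sumZr (f : int -> R) : R :=
  fine (\esum_(m in [set: int]) (Num.max (f m) 0)%:E) -
  fine (\esum_(m in [set: int]) (Num.max (- f m) 0)%:E).

Definition sumZ (f : int -> R[i]) : R[i] :=
  sumZr (fun m => complex.Re (f m)) +i* sumZr (fun m => complex.Im (f m)).

End complex_integration.

Section plane.
Context {R : realType}.

Notation mu := (@lebesgue_measure R).

Definition mu2 := (@lebesgue_measure R \x @lebesgue_measure R)%E.

Implicit Types f g K phi : R * R -> R[i].

Definition Cmeasurable f :=
  measurable_fun [set: R * R] (fun z => complex.Re (f z)) /\
  measurable_fun [set: R * R] (fun z => complex.Im (f z)).

Definition in_L1 f :=
  Cmeasurable f /\
  (\int[mu2]_z (ComplexField.Normc.normc (f z))%:E < +oo)%E.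

Definition in_L2 f :=
  Cmeasurable f /\ (\int[mu2]_z (sqmod (f z))%:E < +oo)%E.

Definition dot f g : R[i] := Cintegral mu2 (fun z => f z * (g z)^*).

Definition orthonormal_family (I : eqType) (e : I -> R * R -> R[i]) :=
  (forall i, in_L2 (e i)) /\ (forall i i', dot (e i) (e i') = (i == i')%:R).

Definition cvg_L2 (g : nat -> R * R -> R[i]) f :=
  (\int[mu2]_z (sqmod (g n z - f z))%:E)%E @[n --> \oo] --> 0%E.

Definition twisted_translation (lam : R) (k l : int) phi (z : R * R) : R[i] :=
  expi (pi * lam * (z.1 * l%:~R - z.2 * k%:~R)) *
  phi (z.1 - k%:~R, z.2 - l%:~R).

Definition dilation (j : int) phi (z : R * R) : R[i] :=
  ((2 : R) ^ j)%:C * phi (2 ^ j * z.1, 2 ^ j * z.2).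

Definition twisted_wavelet phi (i : int * int * int) : R * R -> R[i] :=
  let: (k, l, j) := i in
  dilation j (twisted_translation (2 ^ (- (2 * j))) k l phi).

Definition modulation (a b : R) phi (z : R * R) : R[i] :=
  expi (2 * pi * (a * z.1 + b * z.2)) * phi z.

Definition kernel_integral (lam : R) f (z : R * R) : R[i] :=
  Cintegral mu
    (fun x => f (x, z.2 - z.1) * expi (pi * lam * x * (z.1 + z.2))).

(* [K] represents the value at [f] of the L^2-continuous extension of
   [kernel_integral lam] from the dense subspace L^1 /\ L^2 to L^2. *)
Definition is_weyl_kernel (lam : R) f K :=
  in_L2 K /\
  forall g : nat -> R * R -> R[i],
    (forall n, in_L1 (g n) /\ in_L2 (g n)) ->
    cvg_L2 g f -> cvg_L2 (fun n => kernel_integral lam (g n)) K.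

(* An arbitrary representative of the L^2 class K^lam_f (unique up to a
   Lebesgue-null set); 0 if there is none. *)
Definition weyl_kernel (lam : R) f : R * R -> R[i] :=
  xget (fun=> 0) [set K | is_weyl_kernel lam f K].

Definition P_fun phi (j1 j2 l1 l2 : int) (xi : R) : R[i] :=
  sumZ (fun m => Cintegral mu (fun eta =>
    weyl_kernel (2 ^ (- (2 * j1))) phi
      (2 ^ (j1 + j2) * (xi + m%:~R) + l1%:~R, 2 ^ j1 * eta) *
    (weyl_kernel (2 ^ (- (2 * j2))) phi
      (2 ^ (2 * j2) * (xi + m%:~R) + l2%:~R, 2 ^ j2 * eta))^*)).

Definition S_fun phi (j l : int) (xi : R) (m : int) (y : R) : R[i] :=
  weyl_kernel 1 (modulation ((2 ^ (- (2 * j)) - 1) / 2 * l%:~R) 0 phi)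
    (2 * (xi + m%:~R - y) / (1 + 2 ^ (- (2 * j))) + l%:~R,
     2 * y / (1 - 2 ^ (- (2 * j)))).

Definition R_fun phi (j l : int) (xi : R) : \bar R :=
  (\esum_(m in [set: int]) \int[mu]_y (sqmod (S_fun phi j l xi m y))%:E)%E.

Definition Q_fun phi (j l1 l2 : int) (xi : R) : R[i] :=
  sumZ (fun m => Cintegral mu (fun y =>
    S_fun phi j l1 xi m y * (S_fun phi j l2 xi m y)^*)).

Definition ae01 (p : R -> Prop) :=
  {ae mu, forall xi : R, xi \in `[0, 1] -> p xi}.

End plane.

(* Main.v *)
Require Import Defs.
From HB Require Import structures.
From mathcomp Require Import all_boot all_order all_algebra.
From mathcomp Require Import all_classical all_reals all_analysis.
From mathcomp Require Import measurable_realfun complex.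
From mathcomp Require Import ring lra.

Set Implicit Arguments.
Unset Strict Implicit.
Unset Printing Implicit Defensive.
Import Order.TTheory GRing.Theory Num.Theory.
Import numFieldNormedType.Exports.

Local Open Scope classical_set_scope.
Local Open Scope ring_scope.
Local Open Scope complex_scope.

(** The proof transports the wavelets to their Weyl kernels, where translations
    become frequencies, and reads orthonormality off Fourier coefficients.

    For functions that are bounded with bounded support, [kernel_integral] is a
    one-dimensional Fourier transform in rotated coordinates, so that
    Plancherel's identity makes f |-> K^lam_f an isometry up to the factor
    |lam|^(-1/2) ([nrm_kernel_integral_box]).  By density and completeness of
    L2 it extends to L2 ([weyl_kernel_exists]).  All later identities between
    kernels are explicit substitutions for bounded functions of bounded
    support; the relation [weyl_limit] carries them to the limit.  For lam = 1
    the kernel preserves inner products ([weyl_limit_inner]), so the inner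
    product of two wavelets is that of their kernels.

    Up to a constant phase, the kernel of the wavelet of index (k, l, j) is
    e^(2 pi i k xi / 2^j) K(2^j xi + l, 2^j eta), where K is the kernel of phi
    with parameter 2^(-2j) ([wavelet_limit]): l is a shift, and k only occurs
    as a frequency in the first variable.  After rescaling this variable, each
    inner product is therefore a nonzero constant times
      int int e^(2 pi i n u) H(u, y) dy du
    with n an integer combination of the two values of k and H independent of
    them.  These integrals are the Fourier coefficients of the 1-periodic
    function u |-> sum_m int H(u + m, y) dy, so requiring them to be c for
    n = 0 and 0 for n <> 0 is requiring that function to be c almost
    everywhere on [0, 1] ([periodization_constP], [periodization_normP]).

    There are three kinds of pairs.  Wavelets of scale 1 give the conditions on
    K_phi ([dot_wavelets_unit_scale]); wavelets of different scales give
    [P_fun] ([dot_wavelets_cross]).  For two wavelets of scale 2^j with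
    j <> 0, the unitary dilation is removed and the kernel of parameter 1 is
    applied to the twisted translates with lam = 2^(-2j) <> 1.  The twist no
    longer matches the kernel: the window acquires the modulation that occurs
    in [S_fun] and k multiplies (1 + lam) xi + (1 - lam) eta, a combination
    of both variables.  Taking half of it as the new variable u gives the
    arguments of [S_fun], and the Jacobian determinant of this substitution,
    4 / (1 - lam^2), explains the constant |1 - lam^2| / 4 required of [R_fun]
    ([dot_wavelets_common_scale]).

    Plancherel's identity itself is obtained from Parseval's identity on the
    unit interval by integrating over translates of the frequencies
    ([plancherel_unit]), and Parseval's identity from the fact that an
    integrable function is determined by its Fourier coefficients
    ([fourier_uniqueness]). *)

(** * Complex numbers and phases *)

Section complex_numbers.
Context {R : realType}.
Implicit Types (z w : R[i]) (s t : R).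

Lemma sqmodE z : sqmod z = complex.Re z ^+ 2 + complex.Im z ^+ 2.
Proof. by case: z => a b; rewrite /sqmod /= sqr_sqrtr// addr_ge0 ?sqr_ge0. Qed.

Lemma sqmod_ge0 z : 0 <= sqmod z.
Proof. by rewrite sqmodE addr_ge0 ?sqr_ge0. Qed.

Lemma complexP z w :
  complex.Re z = complex.Re w -> complex.Im z = complex.Im w -> z = w.
Proof. by case: z w => a b [c d] /= -> ->. Qed.

Lemma ReM z w : complex.Re (z * w) =
  complex.Re z * complex.Re w - complex.Im z * complex.Im w.
Proof. by case: z w => a b [c d]. Qed.

Lemma ImM z w : complex.Im (z * w) =
  complex.Re z * complex.Im w + complex.Im z * complex.Re w.
Proof. by case: z w => a b [c d]. Qed.

Lemma ReD z w : complex.Re (z + w) = complex.Re z + complex.Re w.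
Proof. by case: z w => a b [c d]. Qed.

Lemma ImD z w : complex.Im (z + w) = complex.Im z + complex.Im w.
Proof. by case: z w => a b [c d]. Qed.

Lemma ReN z : complex.Re (- z) = - complex.Re z.
Proof. by case: z. Qed.

Lemma ImN z : complex.Im (- z) = - complex.Im z.
Proof. by case: z. Qed.

Lemma ReJ z : complex.Re (z^*)%C = complex.Re z.
Proof. by case: z. Qed.

Lemma ImJ z : complex.Im (z^*)%C = - complex.Im z.
Proof. by case: z. Qed.

Definition ReImE := (ReM, ImM, ReD, ImD, ReN, ImN, ReJ, ImJ).

Lemma sqmodM z w : sqmod (z * w) = sqmod z * sqmod w.
Proof. by rewrite !sqmodE !ReImE; ring. Qed.

Lemma sqmodJ z : sqmod (z^*)%C = sqmod z.
Proof. by rewrite !sqmodE !ReImE sqrrN. Qed.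

Lemma sqmod0 : sqmod (0 : R[i]) = 0.
Proof. by rewrite sqmodE /= expr0n addr0. Qed.

Lemma sqmodN z : sqmod (- z) = sqmod z.
Proof. by rewrite !sqmodE !ReImE !sqrrN. Qed.

Lemma sqmodD_le z w : sqmod (z + w) <= 2 * sqmod z + 2 * sqmod w.
Proof.
rewrite !sqmodE !ReImE.
have := sqr_ge0 (complex.Re z - complex.Re w).
by have := sqr_ge0 (complex.Im z - complex.Im w); nra.
Qed.

Lemma sqmod_eq0 z : (sqmod z == 0) = (z == 0).
Proof.
rewrite sqmodE paddr_eq0 ?sqr_ge0// !sqrf_eq0.
by case: z => a b; rewrite eq_complex.
Qed.

Lemma expiD s t : expi (s + t) = expi s * expi t.
Proof. by apply: complexP; rewrite ReImE /= ?cosD ?sinD // addrC mulrC [in X in _ + X]mulrC. Qed.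

Lemma expi0 : expi 0 = 1 :> R[i].
Proof. by rewrite /expi cos0 sin0. Qed.

Lemma expiN t : expi (- t) = (expi t)^*%C.
Proof. by rewrite /expi cosN sinN. Qed.

Lemma sqmod_expi t : sqmod (expi t) = 1.
Proof. by rewrite sqmodE /= cos2Dsin2. Qed.

Lemma expi_neq0 t : expi t != 0.
Proof. by rewrite -sqmod_eq0 sqmod_expi oner_eq0. Qed.

End complex_numbers.

(** * Square integrable functions on a measure space *)

Section square_integrable.
Context {R : realType} d (T : measurableType d) (mu : {measure set T -> \bar R}).
Implicit Types (f g h : T -> R[i]).

Definition cmeas f :=
  measurable_fun [set: T] (fun x => complex.Re (f x)) /\
  measurable_fun [set: T] (fun x => complex.Im (f x)).

Definition cintegrable f :=
  mu.-integrable [set: T] (fun x => (complex.Re (f x))%:E) /\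
  mu.-integrable [set: T] (fun x => (complex.Im (f x))%:E).

(** The squared L2 norm; keeping the square avoids roots of extended reals. *)
Definition nrm f : \bar R := (\int[mu]_x (sqmod (f x))%:E)%E.

Definition sqint f := cmeas f /\ (nrm f < +oo)%E.

Definition inner f g : R[i] := Cintegral mu (fun x => f x * (g x)^*%C).

Lemma cmeasD f g : cmeas f -> cmeas g -> cmeas (fun x => f x + g x).
Proof.
move=> [f1 f2] [g1 g2]; split.
  by under eq_fun do rewrite ReD; exact: measurable_funD.
by under eq_fun do rewrite ImD; exact: measurable_funD.
Qed.

Lemma cmeasM f g : cmeas f -> cmeas g -> cmeas (fun x => f x * g x).
Proof.
move=> [f1 f2] [g1 g2]; split.
  by under eq_fun do rewrite ReM; apply: measurable_funB; exact: measurable_funM.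
by under eq_fun do rewrite ImM; apply: measurable_funD; exact: measurable_funM.
Qed.

Lemma cmeasN f : cmeas f -> cmeas (fun x => - f x).
Proof.
move=> [f1 f2]; split.
  by under eq_fun do rewrite ReN; exact: measurableT_comp.
by under eq_fun do rewrite ImN; exact: measurableT_comp.
Qed.

Lemma cmeasB f g : cmeas f -> cmeas g -> cmeas (fun x => f x - g x).
Proof. by move=> mf mg; apply: cmeasD => //; exact: cmeasN. Qed.

Lemma cmeasJ f : cmeas f -> cmeas (fun x => (f x)^*%C).
Proof.
move=> [f1 f2]; split; first by under eq_fun do rewrite ReJ.
by under eq_fun do rewrite ImJ; exact: measurableT_comp.
Qed.

Lemma cmeas_cst (c : R[i]) : cmeas (fun=> c).
Proof. by split; exact: measurable_cst. Qed.

Lemma cmeas_expi (t : T -> R) : measurable_fun setT t -> cmeas (fun x => expi (t x)).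
Proof.
move=> mt; split.
  by apply: measurableT_comp mt; apply: continuous_measurable_fun; exact: continuous_cos.
by apply: measurableT_comp mt; apply: continuous_measurable_fun; exact: continuous_sin.
Qed.

Lemma measurable_sqmod f : cmeas f -> measurable_fun setT (fun x => sqmod (f x)).
Proof.
move=> [f1 f2]; under eq_fun do rewrite sqmodE.
by apply: measurable_funD; exact: measurable_funX.
Qed.

Lemma measurable_sqmodE f : cmeas f -> measurable_fun setT (fun x => (sqmod (f x))%:E).
Proof. by move=> mf; apply/measurable_EFinP; exact: measurable_sqmod. Qed.

Lemma nrm_ge0 f : (0 <= nrm f)%E.
Proof. by apply: integral_ge0 => x _; rewrite lee_fin sqmod_ge0. Qed.

Lemma eq_nrm f g : (forall x, sqmod (f x) = sqmod (g x)) -> nrm f = nrm g.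
Proof. by move=> fg; apply: eq_integral => x _; rewrite fg. Qed.

Lemma nrmZ (c : R[i]) f : cmeas f ->
  nrm (fun x => c * f x) = ((sqmod c)%:E * nrm f)%E.
Proof.
move=> mf; rewrite /nrm -ge0_integralZl//.
- by apply: eq_integral => x _; rewrite sqmodM EFinM.
- exact: measurable_sqmodE.
- by move=> x _; rewrite lee_fin sqmod_ge0.
- by rewrite lee_fin sqmod_ge0.
Qed.

Lemma nrmN f : nrm (fun x => - f x) = nrm f.
Proof. by apply: eq_nrm => x; rewrite sqmodN. Qed.

Lemma nrmBC f g : nrm (fun x => f x - g x) = nrm (fun x => g x - f x).
Proof. by apply: eq_nrm => x; rewrite -sqmodN opprB. Qed.

(** The parallelogram bound, enough of a triangle inequality for limits. *)
Lemma nrmD_le f g : cmeas f -> cmeas g ->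
  (nrm (fun x => f x + g x)%R <= 2%:E * nrm f + 2%:E * nrm g)%E.
Proof.
move=> mf mg; rewrite /nrm -!ge0_integralZl//; [|
  exact: measurable_sqmodE | by move=> x _; rewrite lee_fin sqmod_ge0 |
  exact: measurable_sqmodE | by move=> x _; rewrite lee_fin sqmod_ge0 ].
rewrite -ge0_integralD//.
- apply: ge0_le_integral => //.
  + by move=> x _; rewrite lee_fin sqmod_ge0.
  + by apply: measurable_sqmodE; exact: cmeasD.
  + by apply: emeasurable_funD; apply: measurable_funeM; exact: measurable_sqmodE.
  + by move=> x _; rewrite -!EFinM -EFinD lee_fin sqmodD_le.
- by move=> x _; rewrite -EFinM lee_fin mulr_ge0 ?sqmod_ge0.
- by apply: measurable_funeM; exact: measurable_sqmodE.
- by move=> x _; rewrite -EFinM lee_fin mulr_ge0 ?sqmod_ge0.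
- by apply: measurable_funeM; exact: measurable_sqmodE.
Qed.

Lemma nrmB_le f g : cmeas f -> cmeas g ->
  (nrm (fun x => f x - g x)%R <= 2%:E * nrm f + 2%:E * nrm g)%E.
Proof.
move=> mf mg; rewrite -(nrmN g); apply: nrmD_le => //; exact: cmeasN.
Qed.

Lemma nrm_fin f : sqint f -> nrm f \is a fin_num.
Proof. by move=> [_ foo]; rewrite ge0_fin_numE// nrm_ge0. Qed.

Lemma sqintD f g : sqint f -> sqint g -> sqint (fun x => f x + g x).
Proof.
move=> [mf foo] [mg goo]; split; first exact: cmeasD.
apply: le_lt_trans (nrmD_le mf mg) _.
by rewrite lte_add_pinfty// lte_mul_pinfty// nrm_ge0.
Qed.

Lemma sqintZ (c : R[i]) f : sqint f -> sqint (fun x => c * f x).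
Proof.
move=> [mf foo]; split; first exact: cmeasM (cmeas_cst c) mf.
by rewrite nrmZ// lte_mul_pinfty// lee_fin sqmod_ge0.
Qed.

Lemma sqintN f : sqint f -> sqint (fun x => - f x).
Proof. by move=> [mf foo]; split; [exact: cmeasN|rewrite nrmN]. Qed.

Lemma sqintB f g : sqint f -> sqint g -> sqint (fun x => f x - g x).
Proof. by move=> Lf Lg; apply: sqintD => //; exact: sqintN. Qed.

Lemma sqint_sum (I : Type) (s : seq I) (F : I -> T -> R[i]) :
  (forall i, sqint (F i)) -> sqint (fun x => \sum_(i <- s) F i x).
Proof.
move=> LF; elim: s => [|i s IH].
  under eq_fun do rewrite big_nil.
  split; first exact: cmeas_cst.
  by rewrite /nrm; under eq_integral do rewrite sqmod0; rewrite integral0 ltry.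
by under eq_fun do rewrite big_cons; exact: sqintD.
Qed.

Lemma sqint_integrable f : sqint f -> mu.-integrable setT (fun x => (sqmod (f x))%:E).
Proof.
move=> [mf foo]; apply/integrableP; split; first exact: measurable_sqmodE.
apply: le_lt_trans foo; rewrite /nrm le_eqVlt; apply/orP; left; apply/eqP.
by apply: eq_integral => x _; rewrite gee0_abs// lee_fin sqmod_ge0.
Qed.

(** The comparison is stated between squares because [sqmod] is one. *)
Lemma le_cintegrable f (k : T -> R) : cmeas f ->
  mu.-integrable setT (fun x => (k x)%:E) -> (forall x, sqmod (f x) <= k x ^+ 2) ->
  cintegrable f.
Proof.
move=> [m1 m2] ik fk; split; (apply: le_integrable ik => //;
  [exact/measurable_EFinP|move=> x _; rewrite /= lee_fin -ler_sqr ?nnegrE//;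
   rewrite -!normrX !ger0_norm ?sqr_ge0//; apply: le_trans (fk x);
   rewrite sqmodE]).
- by rewrite lerDl sqr_ge0.
- by rewrite lerDr sqr_ge0.
Qed.

(** Holder for two square integrable functions, by the arithmetic-geometric
    mean inequality. *)
Lemma sqint_mulJ f g : sqint f -> sqint g -> cintegrable (fun x => f x * (g x)^*%C).
Proof.
move=> Lf Lg; have [mf _] := Lf; have [mg _] := Lg.
apply: (@le_cintegrable _ (fun x => sqmod (f x) + sqmod (g x))).
- by apply: cmeasM => //; exact: cmeasJ.
- under eq_fun do rewrite EFinD.
  by apply: integrableD => //; exact: sqint_integrable.
- move=> x; rewrite sqmodM sqmodJ.
  by have := sqmod_ge0 (f x); have := sqmod_ge0 (g x); nra.
Qed.

Lemma cintegrableD f g : cintegrable f -> cintegrable g ->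
  cintegrable (fun x => f x + g x).
Proof.
move=> [f1 f2] [g1 g2]; split.
  by under eq_fun do rewrite ReD; exact: (integrableD _ f1 g1).
by under eq_fun do rewrite ImD; exact: (integrableD _ f2 g2).
Qed.

Lemma cintegrableZ (c : R[i]) f : cintegrable f -> cintegrable (fun x => c * f x).
Proof.
move=> [f1 f2]; split.
  under eq_fun do rewrite ReM EFinB !EFinM.
  by apply: integrableB => //; exact: integrableZl.
under eq_fun do rewrite ImM EFinD !EFinM.
by apply: integrableD => //; exact: integrableZl.
Qed.

Lemma CintegralD f g : cintegrable f -> cintegrable g ->
  Cintegral mu (fun x => f x + g x) = Cintegral mu f + Cintegral mu g.
Proof.
move=> [f1 f2] [g1 g2]; apply: complexP; rewrite ReImE /= -RintegralD//.
  by apply: eq_Rintegral => x _; rewrite ReD.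
by apply: eq_Rintegral => x _; rewrite ImD.
Qed.

Lemma CintegralZ (c : R[i]) f : cintegrable f ->
  Cintegral mu (fun x => c * f x) = c * Cintegral mu f.
Proof.
move=> [f1 f2]; apply: complexP; rewrite ReImE /= -!RintegralZl//.
  rewrite -RintegralB//; [|exact: (integrableZl _ _ f1)|exact: (integrableZl _ _ f2)].
  by apply: eq_Rintegral => x _; rewrite ReM.
rewrite -RintegralD//; [|exact: (integrableZl _ _ f2)|exact: (integrableZl _ _ f1)].
by apply: eq_Rintegral => x _; rewrite ImM.
Qed.

Lemma CintegralN f : cintegrable f ->
  Cintegral mu (fun x => - f x) = - Cintegral mu f.
Proof.
by move=> fi; rewrite -mulN1r -CintegralZ//; congr Cintegral; apply/funext => x;
  rewrite mulN1r.
Qed.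

Lemma CintegralB f g : cintegrable f -> cintegrable g ->
  Cintegral mu (fun x => f x - g x) = Cintegral mu f - Cintegral mu g.
Proof.
move=> fi gi; rewrite CintegralD ?CintegralN//.
have := cintegrableZ (-1) gi; congr cintegrable; apply/funext => x.
by rewrite mulN1r.
Qed.

Lemma innerDl f g h : sqint f -> sqint g -> sqint h ->
  inner (fun x => f x + g x) h = inner f h + inner g h.
Proof.
move=> Lf Lg Lh; rewrite /inner -CintegralD; [|exact: sqint_mulJ..].
by congr Cintegral; apply/funext => x; rewrite mulrDl.
Qed.

Lemma innerZl (c : R[i]) f h : sqint f -> sqint h ->
  inner (fun x => c * f x) h = c * inner f h.
Proof.
move=> Lf Lh; rewrite /inner -CintegralZ; [|exact: sqint_mulJ].
by congr Cintegral; apply/funext => x; rewrite mulrA.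
Qed.

Lemma inner_conj f g : sqint f -> sqint g -> inner g f = (inner f g)^*%C.
Proof.
move=> Lf Lg; have [i1 i2] := sqint_mulJ Lf Lg.
apply: complexP; rewrite ?ReJ ?ImJ /=.
  by apply: eq_Rintegral => x _; rewrite !ReImE; ring.
rewrite -mulN1r -RintegralZl//; apply: eq_Rintegral => x _.
by rewrite !ReImE; ring.
Qed.

Lemma innerZr (c : R[i]) f h : sqint f -> sqint h ->
  inner h (fun x => c * f x) = (c^*)%C * inner h f.
Proof.
move=> Lf Lh; rewrite inner_conj//; last exact: sqintZ.
by rewrite innerZl// rmorphM /= [in RHS]inner_conj.
Qed.

Lemma innerBl f g h : sqint f -> sqint g -> sqint h ->
  inner (fun x => f x - g x) h = inner f h - inner g h.
Proof.
move=> Lf Lg Lh; rewrite innerDl//; last exact: sqintN.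
congr (_ + _); rewrite -mulN1r -(innerZl (-1) Lg Lh); congr inner.
by apply/funext => x; rewrite mulN1r.
Qed.

Lemma innerBr f g h : sqint f -> sqint g -> sqint h ->
  inner h (fun x => f x - g x) = inner h f - inner h g.
Proof.
move=> Lf Lg Lh; rewrite inner_conj//; last exact: sqintB.
by rewrite innerBl// rmorphB /= [in RHS]inner_conj// [X in _ = _ - X]inner_conj.
Qed.

Lemma nrmE f : sqint f -> nrm f = (complex.Re (inner f f))%:E.
Proof.
move=> Lf; rewrite /= fineK; first last.
  by apply: integrable_fin_num => //; have [] := sqint_mulJ Lf Lf.
by apply: eq_integral => x _; rewrite sqmodE !ReImE; congr EFin; ring.
Qed.

Lemma inner_self f : sqint f -> inner f f = (fine (nrm f))%:C.
Proof.
move=> Lf; rewrite nrmE//=; apply: complexP => //=.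
rewrite /Rintegral (_ : (fun x => _) = (fun=> 0%E)) ?integral0//.
by apply/funext => x; rewrite !ReImE; congr EFin; ring.
Qed.

(** The integrands agree pointwise; the imaginary part needs the direction i. *)
Lemma polarization f g : sqint f -> sqint g -> inner f g =
  ((fine (nrm (fun x => f x + g x)) - fine (nrm (fun x => f x - g x))) / 4) +i*
  ((fine (nrm (fun x => f x + 'i%C * g x)) -
    fine (nrm (fun x => f x - 'i%C * g x))) / 4).
Proof.
move=> Lf Lg; have Lig := sqintZ 'i%C Lg.
have q h k : sqint h -> sqint k ->
    fine (nrm (fun x => h x + k x)) - fine (nrm (fun x => h x - k x)) =
    \int[mu]_x (sqmod (h x + k x) - sqmod (h x - k x)).
  move=> Lh Lk; rewrite RintegralB//; apply: sqint_integrable.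
    exact: sqintD.
  exact: sqintB.
have q4 h k : sqint h -> sqint k ->
    (fine (nrm (fun x => h x + k x)) - fine (nrm (fun x => h x - k x))) / 4 =
    \int[mu]_x ((sqmod (h x + k x) - sqmod (h x - k x)) / 4).
  move=> Lh Lk; rewrite q// RintegralZr//.
  rewrite [X in integrable _ _ X](_ : _ = (fun x =>
    (sqmod (h x + k x)%R)%:E - (sqmod (h x - k x)%R)%:E)%E)//.
  apply: integrableB => //; apply: sqint_integrable; first exact: sqintD.
  exact: sqintB.
rewrite !q4//; apply: complexP => /=; apply: eq_Rintegral => x _;
  by rewrite !sqmodE !ReImE /=; field.
Qed.

(** Pythagoras.  Positivity of the left-hand side gives the Cauchy-Schwarz bound
    [sqmod_inner_le]; iterating it gives Bessel's equality in [a_sum] below. *)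
Lemma nrm_sub_proj f e : sqint f -> sqint e -> nrm e = 1%E ->
  nrm (fun x => f x - inner f e * e x) = (nrm f - (sqmod (inner f e))%:E)%E.
Proof.
move=> Lf Le e1; set c := inner f e.
rewrite nrmE; last by apply: sqintB => //; exact: sqintZ.
have Lce : sqint (fun x => c * e x) by exact: sqintZ.
have Lr : sqint (fun x => f x - c * e x) by exact: sqintB.
rewrite innerBl// !innerBr// !innerZl// !innerZr// (inner_conj Lf Le) -/c !inner_self// e1 -[nrm f]fineK ?nrm_fin//.
by rewrite -EFinB; congr EFin; rewrite sqmodE !ReImE /=; ring.
Qed.

Lemma sqmod_inner_le f e : sqint f -> sqint e -> nrm e = 1%E ->
  ((sqmod (inner f e))%:E <= nrm f)%E.
Proof.
move=> Lf Le e1; have := nrm_ge0 (fun x => f x - inner f e * e x).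
by rewrite nrm_sub_proj// sube_ge0// nrm_fin.
Qed.

End square_integrable.

(** * Affine substitutions on the line *)

Section affine_substitution.
Context {R : realType}.
Notation mu := (@lebesgue_measure R).
Notation RT := (measurableTypeR R).

Lemma measurable_affine (a b : R) :
  measurable_fun [set: RT] ((fun x => a * x + b) : RT -> RT).
Proof.
apply: measurable_funD; last exact: measurable_cst.
by apply: measurable_funM; [exact: measurable_cst|exact: measurable_id].
Qed.

(** Lebesgue measure is the only measure with the right value on intervals, and
    the rescaled pushforward has these values. *)
Lemma lebesgue_measure_affine (a b : R) (A : set RT) : a != 0 -> measurable A ->
  pushforward mu ((fun x => a * x + b) : RT -> RT) A = (`|a|^-1%:E * mu A)%E.
Proof.
move=> a0 mA.
have na0 : (0 < `|a|) by rewrite normr_gt0.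
suff -> : mu A = (`|a|%:E * pushforward mu ((fun x => a * x + b)%R : RT -> RT) A)%E.
  by rewrite muleA -EFinM mulVf ?gt_eqF// mul1e.
pose k := NngNum (normr_ge0 a).
apply: (@lebesgue_measure_unique _ (mscale k
  (pushforward mu ((fun x => a * x + b)%R : RT -> RT)))) => //; first exact: measurable_affine.
move=> m _ [[x y] _ <-] /=.
rewrite [RHS](_ : _ = (`|a|%:E * mu ((fun z : RT => (a * z + b)%R) @^-1` `]x, y]))%E)//.
have [a_lt0|a_gt0|] := ltgtP a 0; last by move/eqP; rewrite (negbTE a0).
- rewrite (_ : _ @^-1` _ = `[(y - b) / a, (x - b) / a[%classic); last first.
    apply/seteqP; split => z /=; rewrite !in_itv/= => /andP[h1 h2]; apply/andP; split.
    + by rewrite ler_ndivrMr//; lra.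
    + by rewrite ltr_ndivlMr//; lra.
    + by move: h2; rewrite ltr_ndivlMr//; lra.
    + by move: h1; rewrite ler_ndivrMr//; lra.
  rewrite !lebesgue_measure_itv /= !lte_fin ltr_ndivrMr// divfK// ltrD2r.
  case: ifP => _; last by rewrite mule0.
  by rewrite -!EFinD -EFinM ltr0_norm//; congr EFin; field; rewrite lt_eqF.
- rewrite (_ : _ @^-1` _ = `](x - b) / a, (y - b) / a]%classic); last first.
    apply/seteqP; split => z /=; rewrite !in_itv/= => /andP[h1 h2]; apply/andP; split.
    + by rewrite ltr_pdivrMr//; lra.
    + by rewrite ler_pdivlMr//; lra.
    + by move: h1; rewrite ltr_pdivrMr//; lra.
    + by move: h2; rewrite ler_pdivlMr//; lra.
  rewrite !lebesgue_measure_itv /= !lte_fin ltr_pdivrMr// divfK// ltrD2r.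
  case: ifP => _; last by rewrite mule0.
  by rewrite -!EFinD -EFinM gtr0_norm//; congr EFin; field; rewrite gt_eqF.
Qed.

Lemma ge0_integral_affine (a b : R) (f : RT -> \bar R) : a != 0 ->
  measurable_fun setT f -> (forall x, 0 <= f x)%E ->
  (\int[mu]_x f (a * x + b)%R = `|a|^-1%:E * \int[mu]_x f x)%E.
Proof.
move=> a0 mf f0.
have na0 : (0 <= `|a|^-1) by rewrite invr_ge0.
pose k := NngNum na0.
transitivity (\int[mscale k mu]_x f x)%E; last by rewrite ge0_integral_mscale.
rewrite -[LHS](@ge0_integral_pushforward _ _ RT RT R (fun x : RT => a * x + b) (measurable_affine a b) mu setT f)//.
apply: eq_measure_integral => //=; first exact: measurable_affine.
by move=> ? A mA _; rewrite /mscale /=; exact: lebesgue_measure_affine.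
Qed.

End affine_substitution.

(** * Completeness of L2 *)

Section riesz_fischer.
Context {R : realType} d (T : measurableType d) (mu : {measure set T -> \bar R}).

Lemma integral_setC_null (A : set T) (f : T -> \bar R) : measurable A ->
  mu (~` A) = 0%E -> measurable_fun setT f -> (forall x, 0 <= f x)%E ->
  (\int[mu]_x f x = \int[mu]_(x in A) f x)%E.
Proof.
move=> mA A0 mf f0.
rewrite (ge0_negligible_integral (measurableC mA) measurableT)//.
by rewrite setTD setCK.
Qed.

(** Weighting the k-th increment by 4^k turns summability of the squared
    increments into geometric decay of the increments themselves, so that no
    triangle inequality for the L2 norm is needed. *)
Lemma cvg_of_weighted_increments (w : nat -> R) (g : R) :
  (forall k, 4 ^+ k * (w k.+1 - w k) ^+ 2 <= g) -> cvgn w.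
Proof.
move=> wg.
have g0 : 0 <= g by apply: le_trans (wg 0%N); rewrite expr0 mul1r sqr_ge0.
have wd k : `|w k.+1 - w k| <= geometric (g + 1) (2^-1) k.
  rewrite /geometric /= -ler_sqr ?nnegrE ?mulr_ge0 ?exprn_ge0//; last lra.
  rewrite real_normK ?num_real// exprMn -exprM mulnC exprM exprVn.
  have p4 : 0 < (2 ^+ 2 : R) ^+ k by rewrite exprn_gt0// exprn_gt0.
  rewrite exprVn ler_pdivlMr//.
  rewrite mulrC; apply: le_trans (_ : g <= _); last nra.
  by apply: le_trans (wg k); rewrite (_ : 2 ^+ 2 = 4)//; ring.
have cs : cvgn (series (telescope w)).
  apply: normed_cvg; apply: (@series_le_cvg _ _ (geometric (g + 1) 2^-1)) => //.
  - by move=> n /=; exact: normr_ge0.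
  - by move=> n; rewrite /geometric /= mulr_ge0// addr_ge0.
  - by apply: is_cvg_geometric_series; rewrite ger0_norm ?invr_ge0// invf_lt1// ltr1n.
have -> : w = (fun n => w 0%N + series (telescope w) n).
  by apply/funext => n; exact: eq_sum_telescope.
by apply: is_cvgD => //; exact: is_cvg_cst.
Qed.

(** Along a subsequence whose increments are summable with the weights 4^k the
    functions converge almost everywhere; Fatou's lemma turns the Cauchy
    condition into convergence of the whole sequence to this limit. *)
Lemma real_riesz_fischer (u : nat -> T -> R) :
  (forall n, measurable_fun setT (u n)) ->
  (forall e : R, 0 < e -> exists M, forall m n, (M <= m)%N -> (M <= n)%N ->
     (\int[mu]_x ((u m x - u n x) ^+ 2)%:E <= e%:E)%E) ->
  exists v : T -> R, measurable_fun setT v /\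
    (\int[mu]_x ((u n x - v x) ^+ 2)%:E)%E @[n --> \oo] --> 0%E.
Proof.
move=> mu_ cauchy.
have msq (v w : T -> R) : measurable_fun setT v -> measurable_fun setT w ->
    measurable_fun setT (fun x => ((v x - w x) ^+ 2)%:E).
  move=> mv mw; apply/measurable_EFinP.
  by apply: measurable_funX; exact: measurable_funB.
have sq0 (r : R) : (0 <= (r ^+ 2)%:E)%E by rewrite lee_fin sqr_ge0.
have [M MP] : exists M : nat -> nat, forall k m n, (M k <= m)%N -> (M k <= n)%N ->
     (\int[mu]_x ((u m x - u n x) ^+ 2)%:E <= (8^-1 ^+ k)%:E)%E.
  have /choice[M MP] : forall k, exists M, forall m n, (M <= m)%N -> (M <= n)%N ->
     (\int[mu]_x ((u m x - u n x) ^+ 2)%:E <= (8^-1 ^+ k)%:E)%E.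
    by move=> k; apply: cauchy; rewrite exprn_gt0// invr_gt0.
  by exists M.
(* The index s k is at least k, and at least M i for every i <= k. *)
pose s k := (k + \sum_(i < k.+1) M i)%N.
have sM k : (M k <= s k)%N by rewrite /s big_ord_recr /= addnA leq_addl.
have sM1 k : (M k <= s k.+1)%N.
  apply: leq_trans (leq_addl _ _); rewrite 2!big_ord_recr /=.
  by apply: leq_trans (leq_addr _ _); exact: leq_addl.
have sk k : (k <= s k)%N by rewrite leq_addr.
pose G x := (\sum_(0 <= k <oo) (4 ^+ k * (u (s k.+1) x - u (s k) x) ^+ 2)%:E)%E.
have G0 x k : (0 <= (4 ^+ k * (u (s k.+1) x - u (s k) x) ^+ 2)%:E)%E.
  by rewrite lee_fin; apply: mulr_ge0; [exact: exprn_ge0|exact: sqr_ge0].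
have mG k : measurable_fun setT
    (fun x => (4 ^+ k * (u (s k.+1) x - u (s k) x) ^+ 2)%:E).
  apply/measurable_EFinP; apply: measurable_funM; first exact: measurable_cst.
  by apply: measurable_funX; exact: measurable_funB.
have mGG : measurable_fun setT G by apply: ge0_emeasurable_sum.
have GG0 x : (0 <= G x)%E by apply: nneseries_ge0 => *.
have intG : (\int[mu]_x G x < +oo)%E.
  rewrite integral_nneseries//.
  apply: (@le_lt_trans _ _ (\sum_(0 <= k <oo) (1 / (2 ^ (k + 1))%:R * 2 : R)%:E)%E).
    apply: lee_nneseries => [k _ _|k _]; first exact: integral_ge0.
    under eq_integral do rewrite EFinM.
    rewrite ge0_integralZl//; last exact: msq.
    have le8 := MP k _ _ (sM1 k) (sM k).
    apply: le_trans (lee_pmul _ _ (lexx _) le8) _ => //.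
    - exact: integral_ge0.
    rewrite -EFinM lee_fin -exprMn (_ : 4 * 8^-1 = 2^-1 :> R); last by field.
    rewrite exprVn addn1 natrX exprS le_eqVlt; apply/orP; left; apply/eqP.
    by field; rewrite expf_neq0.
  under eq_eseriesr do rewrite mulrC EFinM.
  rewrite nneseriesZl; last by move=> *; rewrite lee_fin divr_ge0.
  by have /cvg_lim := @cvg_geometric_eseries_half R 1 0 => -> //; rewrite -EFinM ltry.
(* Off A the functions are cut to 0, so that the limit exists everywhere. *)
pose A := [set x | G x \is a fin_num].
have mA : measurable A.
  by have := emeasurable_fin_num measurableT mGG; rewrite setTI.
have A0 : mu (~` A) = 0%E.
  have iG : mu.-integrable setT G.
    apply/integrableP; split => //.
    by under eq_integral do rewrite gee0_abs//.
  have [N [mN N0 AN]] := integrable_ae measurableT iG.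
  apply: (subset_measure0 (B := N)) => //; first exact: measurableC.
  by move=> x /= Ax; apply: AN => /= /(_ I).
have cvA x : A x -> cvgn (fun k => u (s k) x).
  move=> Ax; apply: (@cvg_of_weighted_increments _ (fine (G x))) => k.
  rewrite -lee_fin fineK//.
  apply: le_trans (nneseries_lim_ge k.+1 _) => //.
  by rewrite big_nat_recr//= leeDr// sume_ge0.
pose v x := limn (fun k => (u (s k) \_ A) x).
have cw x : (fun k => (u (s k) \_ A) x) @ \oo --> v x.
  suff: cvgn (fun k => (u (s k) \_ A) x) by [].
  rewrite /patch; have [xA|xA] := boolP (x \in A).
    by apply: cvA; rewrite inE in xA.
  exact: is_cvg_cst.
have mv : measurable_fun setT v.
  apply: (@measurable_fun_cvg _ _ _ _ (fun k => u (s k) \_ A)) => // k.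
  by apply/measurable_restrict => //; rewrite ?setTI//; exact: measurable_funTS.
exists v; split => //.
apply/fine_cvgP.
suff h (e : R) : 0 < e -> \forall n \near \oo,
    (\int[mu]_x ((u n x - v x) ^+ 2)%:E <= e%:E)%E.
  split.
    have := h 1 ltr01; apply: filterS => n hn.
    by rewrite ge0_fin_numE ?integral_ge0//; exact: le_lt_trans hn (ltry _).
  apply/cvgrPdist_le => e e0; have := h e e0; apply: filterS => n hn.
  rewrite sub0r normrN ger0_norm ?fine_ge0 ?integral_ge0// -lee_fin fineK//.
  by rewrite ge0_fin_numE ?integral_ge0//; exact: le_lt_trans hn (ltry _).
move=> e0; have [M' M'P] := cauchy e e0.
(* The increments of the subsequence only identify the limit; the rate comes
   from the Cauchy condition, by letting the second index tend to infinity. *)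
exists M' => // n /= Mn.
rewrite (integral_setC_null mA A0)//; last exact: msq.
have lim x : A x -> ((u n x - v x) ^+ 2)%:E =
    limn_einf (fun k => ((u n x - u (s k) x) ^+ 2)%:E).
  move=> Ax; apply/esym; apply: (fst (cvg_limn_einf_sup _)).
  apply: cvg_EFin; first by apply: nearW.
  have cux : (fun k => u (s k) x) @ \oo --> v x.
    by have := cw x; rewrite /patch mem_set.
  by apply: cvgM; apply: cvgB => //; exact: cvg_cst.
rewrite (eq_integral (fun x => limn_einf (fun k => ((u n x - u (s k) x) ^+ 2)%:E)));
  last by move=> x; rewrite inE => Ax; exact: lim.
apply: le_trans (fatou _ mA _ _) _ => //.
- by move=> k; apply: measurable_funTS; exact: msq.
rewrite limn_einf_lim; apply: lime_le; first exact: is_cvg_einfs.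
near=> k.
apply: ge_ereal_inf; exists (\int[mu]_(x in A) ((u n x - u (s (maxn k M')) x) ^+ 2)%:E)%E.
  by exists (maxn k M') => //=; rewrite leq_maxl.
rewrite -(integral_setC_null mA A0)//; last exact: msq.
by apply: M'P => //; apply: leq_trans (sk _); rewrite leq_maxr.
Unshelve. all: by end_near. Qed.

End riesz_fischer.

Section l2_convergence.
Context {R : realType} d (T : measurableType d) (mu : {measure set T -> \bar R}).
Implicit Types (f g h : T -> R[i]).
Notation nrm := (nrm mu).
Notation sqint := (sqint mu).
Notation inner := (inner mu).

Definition cvg2 (u : nat -> T -> R[i]) f :=
  nrm (fun x => u n x - f x) @[n --> \oo] --> 0%E.

Lemma ge0_cvg0P (a : nat -> \bar R) : (forall n, 0 <= a n)%E ->
  a n @[n --> \oo] --> 0%E <->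
  (forall e : R, 0 < e -> \forall n \near \oo, (a n <= e%:E)%E).
Proof.
move=> a0; split.
  move=> /fine_cvgP[fa /cvgrPdist_le ca] e e0.
  near=> n.
  have fan : a n \is a fin_num by near: n.
  have : `|0 - fine (a n)| <= e by near: n; exact: ca.
  by rewrite sub0r normrN ger0_norm ?fine_ge0// -lee_fin fineK.
move=> h; apply/fine_cvgP; split.
  have := h 1 ltr01; apply: filterS => n hn.
  by rewrite ge0_fin_numE//; exact: le_lt_trans hn (ltry _).
apply/cvgrPdist_le => e e0; have := h e e0; apply: filterS => n hn.
rewrite sub0r normrN ger0_norm ?fine_ge0// -lee_fin fineK//.
by rewrite ge0_fin_numE//; exact: le_lt_trans hn (ltry _).
Unshelve. all: by end_near. Qed.

Lemma cvg2P (u : nat -> T -> R[i]) f : cvg2 u f <->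
  (forall e : R, 0 < e -> \forall n \near \oo,
     (nrm (fun x => (u n x - f x)%R) <= e%:E)%E).
Proof. by apply: ge0_cvg0P => n; exact: nrm_ge0. Qed.

Lemma nrm_ReIm f : cmeas f -> nrm f =
  (\int[mu]_x ((complex.Re (f x)) ^+ 2)%:E + \int[mu]_x ((complex.Im (f x)) ^+ 2)%:E)%E.
Proof.
move=> [m1 m2]; rewrite -ge0_integralD//.
- by apply: eq_integral => x _; rewrite sqmodE EFinD.
- by move=> x _; rewrite lee_fin sqr_ge0.
- by apply/measurable_EFinP; exact: measurable_funX.
- by move=> x _; rewrite lee_fin sqr_ge0.
- by apply/measurable_EFinP; exact: measurable_funX.
Qed.

Lemma riesz_fischer (u : nat -> T -> R[i]) : (forall n, sqint (u n)) ->
  (forall e : R, 0 < e -> exists M, forall m n, (M <= m)%N -> (M <= n)%N ->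
     (nrm (fun x => (u m x - u n x)%R) <= e%:E)%E) ->
  exists2 v, sqint v & cvg2 u v.
Proof.
move=> Lu cauchy.
have mu_ n : cmeas (u n) by have [] := Lu n.
have pos (f : T -> R) : (0 <= \int[mu]_x ((f x) ^+ 2)%:E)%E.
  by apply: integral_ge0 => x _; rewrite lee_fin sqr_ge0.
have [|e e0|v1 [mv1 cv1]] := @real_riesz_fischer _ _ _ mu (fun n x => complex.Re (u n x)).
- by move=> n; have [] := mu_ n.
- have [M MP] := cauchy e e0; exists M => m n Mm Mn.
  apply: le_trans (MP m n Mm Mn).
  rewrite nrm_ReIm; last exact: cmeasB.
  by under eq_integral do rewrite -ReN -ReD; rewrite leeDl.
have [|e e0|v2 [mv2 cv2]] := @real_riesz_fischer _ _ _ mu (fun n x => complex.Im (u n x)).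
- by move=> n; have [] := mu_ n.
- have [M MP] := cauchy e e0; exists M => m n Mm Mn.
  apply: le_trans (MP m n Mm Mn).
  rewrite nrm_ReIm; last exact: cmeasB.
  by under eq_integral do rewrite -ImN -ImD; rewrite leeDr.
pose v x := v1 x +i* v2 x.
have mv : cmeas v by [].
have cv : cvg2 u v.
  rewrite /cvg2 -[0%E]adde0; under eq_fun.
    move=> n; rewrite nrm_ReIm; last exact: cmeasB.
    over.
  apply: cvgeD => //.
    rewrite (_ : (fun n => _) = (fun n =>
      \int[mu]_x ((complex.Re (u n x) - v1 x) ^+ 2)%:E)%E)//.
    by apply/funext => n; under eq_integral do rewrite ReD ReN.
  rewrite (_ : (fun n => _) = (fun n =>
      \int[mu]_x ((complex.Im (u n x) - v2 x) ^+ 2)%:E)%E)//.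
  by apply/funext => n; under eq_integral do rewrite ImD ImN.
exists v => //; split => //.
have /cvg2P/(_ 1 ltr01) [n _ /(_ n (leqnn n)) hn] := cv.
have -> : v = (fun x => u n x - (u n x - v x)).
  by apply/funext => x; rewrite subKr.
have Luv : sqint (fun x => u n x - v x).
  by split; [exact: cmeasB|exact: le_lt_trans hn (ltry _)].
by have [] := sqintB (Lu n) Luv.
Qed.

(** A Young-type inequality whose leading constant is as close to 1 as wished. *)
Lemma sqmod_young (e : R) (z w : R[i]) : 0 < e ->
  sqmod z <= (1 + e) * sqmod w + (1 + e^-1) * sqmod (z - w).
Proof.
move=> e0.
have -> : sqmod z = sqmod (w + (z - w)) by rewrite addrC subrK.
move: (z - w) => {}z; rewrite !sqmodE !ReImE.
have key (a b : R) : (a + b) ^+ 2 <= (1 + e) * a ^+ 2 + (1 + e^-1) * b ^+ 2.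
  rewrite -subr_ge0 (_ : _ - _ = e * (a - e^-1 * b) ^+ 2); last first.
    by field; rewrite gt_eqF.
  by rewrite mulr_ge0 ?sqr_ge0// ltW.
by have := key (complex.Re w) (complex.Re z);
   have := key (complex.Im w) (complex.Im z); lra.
Qed.

Lemma nrm_young (e : R) f g : 0 < e -> cmeas f -> cmeas g ->
  (nrm f <= (1 + e)%:E * nrm g + (1 + e^-1)%:E * nrm (fun x => f x - g x)%R)%E.
Proof.
move=> e0 mf mg; have e1 : 0 < e^-1 by rewrite invr_gt0.
have mfg := cmeasB mf mg.
rewrite /nrm -!ge0_integralZl//; try (by rewrite lee_fin; lra);
  try (by move=> x _; rewrite lee_fin sqmod_ge0); try exact: measurable_sqmodE.
rewrite -ge0_integralD//;
  try (by move=> x _; rewrite -EFinM lee_fin mulr_ge0 ?sqmod_ge0//; lra);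
  try (by apply: measurable_funeM; exact: measurable_sqmodE).
apply: ge0_le_integral => //.
- by move=> x _; rewrite lee_fin sqmod_ge0.
- exact: measurable_sqmodE.
- by apply: emeasurable_funD; apply: measurable_funeM; exact: measurable_sqmodE.
- by move=> x _; rewrite -!EFinM -EFinD lee_fin sqmod_young.
Qed.

(** The triangle inequality for L2 norms is replaced by Young's inequality, with
    e small and then u n close to f. *)
Lemma cvg_nrm (u : nat -> T -> R[i]) f : (forall n, sqint (u n)) -> sqint f ->
  cvg2 u f -> fine (nrm (u n)) @[n --> \oo] --> fine (nrm f).
Proof.
move=> Lu Lf /cvg2P cu.
have Luf n : sqint (fun x => u n x - f x) by exact: sqintB.
pose N := fine (nrm f).
have N0 : 0 <= N by rewrite fine_ge0 ?nrm_ge0.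
apply/cvgrPdist_le => e e0.
pose q := Num.min 1 (e / (3 * (N + 1))).
have q0 : 0 < q by rewrite lt_min ltr01 divr_gt0//; lra.
have q1 : q <= 1 by rewrite ge_min lexx.
have qN : q * (N + 1) <= e / 3.
  apply: le_trans (_ : e / (3 * (N + 1)) * (N + 1) <= _).
    by rewrite ler_wpM2r ?ge_min ?lexx ?orbT//; lra.
  by rewrite le_eqVlt; apply/orP; left; apply/eqP; field; lra.
pose d' := Num.min 1 (q * e / 12).
have d0 : 0 < d' by rewrite lt_min ltr01 /= divr_gt0// mulr_gt0.
have d1 : d' <= 1 by rewrite ge_min lexx.
have d2 : d' <= q * e / 12 by rewrite ge_min lexx orbT.
have := cu d' d0; apply: filterS => n hn.
have [mu_ _] := Lu n; have [mf _] := Lf.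
set a := fine (nrm (u n)); set b := fine (nrm (fun x => u n x - f x)).
have b0 : 0 <= b by rewrite fine_ge0 ?nrm_ge0.
have bd : b <= d' by rewrite -lee_fin fineK ?nrm_fin.
have a0 : 0 <= a by rewrite fine_ge0 ?nrm_ge0.
have h1 : a <= (1 + q) * N + (1 + q^-1) * b.
  by rewrite -lee_fin EFinD !EFinM !fineK ?nrm_fin//; exact: nrm_young.
have h2 : N <= (1 + q) * a + (1 + q^-1) * b.
  rewrite -lee_fin EFinD !EFinM !fineK ?nrm_fin// nrmBC; exact: nrm_young.
have qb : (1 + q^-1) * b <= e / 6.
  have : q^-1 * b <= e / 12.
    by rewrite mulrC ler_pdivrMr//; lra.
  have : b <= e / 12 by apply: le_trans bd (le_trans d2 _); nra.
  by lra.
rewrite -/N -/a ler_norml; apply/andP; split; first by nra.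
have : a <= 2 * N + e / 6 by nra.
by nra.
Qed.

Lemma cvg2D (u w : nat -> T -> R[i]) f g :
  (forall n, cmeas (u n)) -> (forall n, cmeas (w n)) -> cmeas f -> cmeas g ->
  cvg2 u f -> cvg2 w g -> cvg2 (fun n x => u n x + w n x) (fun x => f x + g x).
Proof.
move=> mu_ mw mf mg /cvg2P cu /cvg2P cw; apply/cvg2P => e e0.
have e4 : 0 < e / 4 by rewrite divr_gt0.
have := cu _ e4; have := cw _ e4; apply: filterS2 => n hw hu.
rewrite (_ : (fun x => _) = (fun x => (u n x - f x) + (w n x - g x))); last first.
  by apply/funext => x; ring.
apply: le_trans (nrmD_le _ _ _) _; [exact: cmeasB|exact: cmeasB|].
apply: le_trans (leeD (lee_wpmul2l _ hu) (lee_wpmul2l _ hw)) _ => //.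
by rewrite -!EFinM -EFinD lee_fin; lra.
Qed.

Lemma cvg2Z (c : R[i]) (u : nat -> T -> R[i]) f :
  (forall n, cmeas (u n)) -> cmeas f ->
  cvg2 u f -> cvg2 (fun n x => c * u n x) (fun x => c * f x).
Proof.
move=> mu_ mf /cvg2P cu; apply/cvg2P => e e0.
have c0 := sqmod_ge0 c.
have e4 : 0 < e / (sqmod c + 1) by rewrite divr_gt0//; lra.
have := cu _ e4; apply: filterS => n hu.
rewrite (_ : (fun x => _) = (fun x => c * (u n x - f x))); last first.
  by apply/funext => x; rewrite mulrBr.
rewrite nrmZ; last exact: cmeasB.
apply: le_trans (lee_wpmul2l _ hu) _; first by rewrite lee_fin.
rewrite -EFinM lee_fin mulrA ler_pdivrMr; last lra.
by nra.
Qed.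

End l2_convergence.

(** * Uniqueness of Fourier coefficients on the unit interval *)

Section bounded_multiplier.
Context {R : realType} d (T : measurableType d) (mu : {measure set T -> \bar R}).

Lemma integrable_mull (M : R) (w r : T -> R) :
  measurable_fun setT w -> (forall x, `|w x| <= M) ->
  mu.-integrable setT (fun x => (r x)%:E) ->
  mu.-integrable setT (fun x => (w x * r x)%:E).
Proof.
move=> mw wM ir.
have M0 (x : T) : 0 <= M by exact: le_trans (wM x).
apply: (@le_integrable _ _ _ _ _ _ _ (fun x => M%:E * (r x)%:E)%E) => //.
- have /measurable_EFinP mr := measurable_int _ ir.
  by apply/measurable_EFinP; exact: measurable_funM.
- move=> x _; rewrite /= lee_fin normrM normrM.
  by apply: ler_wpM2r => //; rewrite (ger0_norm (M0 x)).
- exact: integrableZl.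
Qed.

Lemma cintegrable_mulexpi (t : T -> R) (h : T -> R[i]) : measurable_fun setT t ->
  cintegrable mu h -> cintegrable mu (fun x => expi (t x) * h x).
Proof.
move=> mt [i1 i2]; have [mc ms] := cmeas_expi mt.
have bc (x : T) : `|complex.Re (expi (t x))| <= 1 by rewrite ler_norml cos_geN1 cos_le1.
have bs (x : T) : `|complex.Im (expi (t x))| <= 1 by rewrite ler_norml sin_geN1 sin_le1.
split.
  by under eq_fun do rewrite ReM EFinB; apply: integrableB => //; exact: integrable_mull.
by under eq_fun do rewrite ImM EFinD; apply: integrableD => //; exact: integrable_mull.
Qed.

End bounded_multiplier.

Section fourier_uniqueness.
Context {R : realType}.
Notation mu := (@lebesgue_measure R).
Notation RT := (measurableTypeR R).

(** Lebesgue measure on the unit interval, kept as a measure on the whole line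
    so that all integrals range over the full type. *)
Definition unit_measure : {measure set RT -> \bar R} :=
  mrestr mu (measurable_itv (`[0, 1] : interval R)).
Notation nu := unit_measure.

Lemma unit_measureE (A : set RT) : nu A = mu (A `&` `[0, 1]).
Proof. by []. Qed.

Lemma unit_measureT : nu setT = 1%E.
Proof.
by rewrite unit_measureE setTI lebesgue_measure_itv /= lte_fin ltr01 oppr0 adde0.
Qed.

Lemma unit_measure_integral (f : RT -> \bar R) :
  measurable_fun setT f -> (forall x, 0 <= f x)%E ->
  (\int[nu]_x f x = \int[mu]_(x in `[0%R, 1%R]) f x)%E.
Proof.
move=> mf f0.
have mI : measurable (`[0, 1] : set RT) by exact: measurable_itv.
rewrite (integral_setC_null mI)//; last by rewrite unit_measureE setICl measure0.
by apply: eq_measure_integral => A mA AI; rewrite unit_measureE setIidl.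
Qed.

Lemma unit_integrable_cst (c : R) : nu.-integrable setT (fun=> c%:E).
Proof.
apply/integrableP; split; first exact: measurable_cst.
by rewrite integral_cst//= unit_measureT mule1 ltry.
Qed.

(** Finitely many points may be ignored, which is how the discontinuities of the
    limit of the switching functions are avoided. *)
Lemma unit_ae_interior (Q : R -> Prop) (s : seq R) :
  (forall x, 0 < x < 1 -> x \notin s -> Q x) -> {ae nu, forall x, Q x}.
Proof.
move=> HQ; rewrite /almost_everywhere.
have : nu.-negligible [set` 0 :: 1 :: s].
  elim: (0 :: 1 :: s) => [|y t IH]; first by rewrite set_nil; exact: negligible_set0.
  have -> : [set` y :: t] = [set y] `|` [set` t].
    apply/seteqP; split => z /=; rewrite in_cons.
      by move=> /orP[/eqP|]; [left|right].
    by move=> [->|->]; rewrite ?eqxx ?orbT.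
  apply: negligibleU => //.
  apply/negligibleP; first exact: measurable_set1.
  apply: (@subset_measure0 _ _ _ mu _ [set y]) => //.
  - by apply: measurableI; [exact: measurable_set1|exact: measurable_itv].
  - exact: lebesgue_measure_set1.
have : nu.-negligible (~` `[0, 1] : set RT).
  apply/negligibleP; first by apply: measurableC; exact: measurable_itv.
  by transitivity (mu (~` `[0, 1] `&` `[0, 1])) => //; rewrite setICl measure0.
move=> /negligibleU/[apply]; apply: negligibleS => x /= nQ.
apply/not_notP => /= /not_orP[/contrapT /= + /negP].
rewrite in_itv/= !in_cons !negb_or => /andP[x0 x1] /and3P[x0' x1' xs].
by apply: nQ; apply: HQ => //; rewrite !lt_neqAle eq_sym x0' x0 x1' x1.
Qed.

(** Polynomials in t that tend boundedly on [0, 1] to the indicator of t < 1/2: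
    t^n is much smaller than 2^(-n) on one side and much larger on the other. *)
Definition switch (n : nat) (t : R) : R := (1 - t ^+ n) ^+ (2 ^ n).

Lemma bernoulli_expr (y : R) m : 0 <= y -> y <= 1 -> 1 - m%:R * y <= (1 - y) ^+ m.
Proof.
move=> y0 y1; elim: m => [|m IH]; first by rewrite mul0r subr0 expr0.
rewrite exprS -natr1; have : 0 <= m%:R :> R by [].
move: IH; set A := (1 - y) ^+ m; set k := m%:R => IH k0.
have : (1 - y) * (1 - k * y) <= (1 - y) * A by rewrite ler_wpM2l// subr_ge0.
by nra.
Qed.

Lemma bernoulli_expr_ge (y : R) m : 0 <= y -> 1 + m%:R * y <= (1 + y) ^+ m.
Proof.
move=> y0; elim: m => [|m IH]; first by rewrite mul0r addr0 expr0.
rewrite exprS -natr1; have : 0 <= m%:R :> R by [].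
move: IH; set A := (1 + y) ^+ m; set k := m%:R => IH k0.
have : (1 + y) * (1 + k * y) <= (1 + y) * A by rewrite ler_wpM2l//; lra.
by nra.
Qed.

Lemma switch_bound n t : 0 <= t <= 1 -> 0 <= switch n t <= 1.
Proof.
move=> /andP[t0 t1].
have t0n : 0 <= t ^+ n by exact: exprn_ge0.
have t1n : t ^+ n <= 1 by exact: exprn_ile1.
by rewrite /switch exprn_ge0 ?exprn_ile1//; lra.
Qed.

Lemma switch_cvg1 t : 0 <= t -> t < 2^-1 -> switch n t @[n --> \oo] --> (1 : R).
Proof.
move=> t0 t1.
have c : (fun n => 1 - (2 * t) ^+ n) @ \oo --> (1 : R).
  rewrite -[X in _ --> X]subr0; apply: cvgB; first exact: cvg_cst.
  by apply: cvg_expr; rewrite ger0_norm; lra.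
apply: (squeeze_cvgr _ c (cvg_cst (1 : R))).
apply: nearW => n; rewrite (andP (switch_bound n _)).2 ?andbT; last lra.
rewrite exprMn -natrX; apply: bernoulli_expr; first exact: exprn_ge0.
by apply: exprn_ile1 => //; lra.
Qed.

Lemma switch_cvg0 t : 2^-1 < t -> t <= 1 -> switch n t @[n --> \oo] --> (0 : R).
Proof.
move=> t0 t1.
have c : (fun n => (2 * t)^-1 ^+ n) @ \oo --> (0 : R).
  apply: cvg_expr; rewrite ger0_norm ?invr_ge0; last lra.
  by rewrite invf_lt1; lra.
apply: (squeeze_cvgr _ (cvg_cst (0 : R)) c).
apply: nearW => n; rewrite (andP (switch_bound n _)).1 /=; last lra.
have tn0 : 0 <= t ^+ n by apply: exprn_ge0; lra.
have tn1 : t ^+ n <= 1 by apply: exprn_ile1 => //; lra.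
have pos : 0 < (2 * t) ^+ n by apply: exprn_gt0; lra.
rewrite exprVn -[leRHS]mul1r ler_pdivlMr//.
apply: (@le_trans _ _ ((1 - t ^+ n) ^+ (2 ^ n) * (1 + t ^+ n) ^+ (2 ^ n))).
  rewrite ler_wpM2l ?exprn_ge0 ?subr_ge0//.
  apply: le_trans (bernoulli_expr_ge _ tn0).
  by rewrite exprMn -natrX lerDr.
rewrite -exprMn; apply: exprn_ile1; nra.
Qed.

(** Less than 1/2 exactly on the arc from a to b of the circle, and an affine
    function of cos(2 pi x + phase). *)
Definition arc (a b x : R) : R := 2^-1 + 2^-1 * (sin (pi * (x - a)) * sin (pi * (x - b))).

Lemma arcE a b x : arc a b x =
  (2^-1 + 4^-1 * cos (pi * (b - a))) - 4^-1 * cos (2 * pi * x - pi * (a + b)).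
Proof.
rewrite /arc.
have -> : pi * (b - a) = pi * (x - a) - pi * (x - b) by ring.
have -> : 2 * pi * x - pi * (a + b) = pi * (x - a) + pi * (x - b) by ring.
by rewrite cosB cosD; field.
Qed.

Lemma sin_abs_le1 (x : R) : -1 <= sin x <= 1.
Proof. by rewrite sin_geN1 sin_le1. Qed.

Lemma arc_bound a b x : 0 <= arc a b x <= 1.
Proof.
rewrite /arc; have /andP[] := sin_abs_le1 (pi * (x - a)).
have /andP[] := sin_abs_le1 (pi * (x - b)).
move: (sin _) (sin _) => u v *; nra.
Qed.

Lemma sin_shift_gt0 (a x : R) : 0 <= a -> x < 1 -> a < x -> 0 < sin (pi * (x - a)).
Proof.
move=> a0 x1 ax; have p0 := pi_gt0 R; apply: sin_gt0_pi.
by apply/andP; split; nra.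
Qed.

Lemma sin_shift_lt0 (a x : R) : a <= 1 -> 0 < x -> x < a -> sin (pi * (x - a)) < 0.
Proof.
move=> a0 x1 ax; rewrite -opprB mulrN sinN oppr_lt0.
by have p0 := pi_gt0 R; apply: sin_gt0_pi; apply/andP; split; nra.
Qed.

Lemma arc_inside a b x : 0 <= a -> b <= 1 -> a < x < b -> arc a b x < 2^-1.
Proof.
move=> a0 b1 /andP[ax xb].
have := @sin_shift_gt0 a x a0 (lt_le_trans xb b1) ax.
have := @sin_shift_lt0 b x b1 (le_lt_trans a0 ax) xb.
by rewrite /arc; move: (sin _) (sin _) => u v *; nra.
Qed.

Lemma arc_outside a b x : 0 <= a -> a <= b -> b <= 1 -> 0 < x < 1 ->
  x < a \/ b < x -> 2^-1 < arc a b x.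
Proof.
move=> a0 ab b1 /andP[x0 x1] [xa|bx]; rewrite /arc.
  have := @sin_shift_lt0 a x (le_trans ab b1) x0 xa.
  have := @sin_shift_lt0 b x b1 x0 (lt_le_trans xa ab).
  by move: (sin _) (sin _) => u v *; nra.
have := @sin_shift_gt0 a x a0 x1 (le_lt_trans ab bx).
have := @sin_shift_gt0 b x (le_trans a0 ab) x1 bx.
by move: (sin _) (sin _) => u v *; nra.
Qed.

Section orthogonal_to_trigonometric_polynomials.
Variable r : RT -> R.
Hypothesis ir : nu.-integrable setT (fun x => (r x)%:E).
Hypothesis r_cos : forall (n : int) (th : R),
  \int[nu]_x (cos (2 * pi * n%:~R * x + th) * r x) = 0.

(** The multipliers w all of whose products with trigonometric polynomials are
    orthogonal to r.  They form a module over the trigonometric polynomials,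
    so products never have to be expanded. *)
Let annihilator (w : RT -> R) :=
  [/\ measurable_fun setT w, exists M, forall x, `|w x| <= M &
   forall (n : int) (th : R),
     \int[nu]_x ((w x * cos (2 * pi * n%:~R * x + th)) * r x) = 0].

Let measurable_cosl (k th : R) : measurable_fun setT ((fun x => cos (k * x + th)) : RT -> R).
Proof.
apply: measurableT_comp; last exact: measurable_affine.
by apply: continuous_measurable_fun; exact: continuous_cos.
Qed.

Let norm_cos_le1 (x : R) : `|cos x| <= 1.
Proof. by rewrite ler_norml cos_geN1 cos_le1. Qed.

Let int_w w (n : int) th : annihilator w ->
  nu.-integrable setT (fun x => ((w x * cos (2 * pi * n%:~R * x + th)) * r x)%:E).
Proof.
move=> [mw [M wM] _]; apply: (@integrable_mull _ _ _ _ M) => //.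
  exact: measurable_funM.
move=> x; rewrite normrM -[leRHS]mulr1.
by apply: ler_pM.
Qed.

Let annihilator_lin (a b : R) w1 w2 : annihilator w1 -> annihilator w2 ->
  annihilator (fun x => a * w1 x + b * w2 x).
Proof.
move=> A1 A2; have [m1 [M1 h1] i1] := A1; have [m2 [M2 h2] i2] := A2; split.
- by apply: measurable_funD; exact: measurable_funM.
- exists (`|a| * M1 + `|b| * M2) => x; rewrite (le_trans (ler_normD _ _))// !normrM.
  by rewrite lerD// ler_wpM2l.
move=> n th.
under eq_Rintegral => x _.
  rewrite (_ : _ * r x =
    a * ((w1 x * cos (2 * pi * n%:~R * x + th)) * r x) +
    b * ((w2 x * cos (2 * pi * n%:~R * x + th)) * r x)); last by ring.
  over.
rewrite RintegralD//; [|exact: (integrableZl _ _ (int_w _ _ _))..].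
rewrite !RintegralZl//; [|exact: int_w..].
by rewrite i1 i2 !mulr0 addr0.
Qed.

Let annihilator1 : annihilator (fun=> 1).
Proof.
split; [exact: measurable_cst|by exists 1 => x; rewrite normr1|].
by move=> n th; rewrite -[RHS](r_cos n th); apply: eq_Rintegral => x _; rewrite mul1r.
Qed.

(** Multiplication by a cosine shifts the frequency of the test function by 1
    in both directions. *)
Let annihilator_cos (ph : R) w : annihilator w ->
  annihilator (fun x => cos (2 * pi * x + ph) * w x).
Proof.
move=> Aw; have [mw [M wM] iw] := Aw; split.
- by apply: measurable_funM.
- exists M => x; rewrite normrM -[leRHS]mul1r.
  by apply: ler_pM.
move=> n th.
under eq_Rintegral => x _.
  rewrite (_ : _ * r x =
    2^-1 * ((w x * cos (2 * pi * (n + 1)%:~R * x + (th + ph))) * r x) +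
    2^-1 * ((w x * cos (2 * pi * (n - 1)%:~R * x + (th - ph))) * r x)); last first.
    have -> : 2 * pi * (n + 1)%:~R * x + (th + ph) =
      (2 * pi * n%:~R * x + th) + (2 * pi * x + ph) by rewrite intrD; ring.
    have -> : 2 * pi * (n - 1)%:~R * x + (th - ph) =
      (2 * pi * n%:~R * x + th) - (2 * pi * x + ph) by rewrite intrD; ring.
    move: (_ + th) (_ + ph) => A B.
    by rewrite cosD cosB; field.
  over.
rewrite RintegralD//; [|exact: (integrableZl _ _ (int_w _ _ _))..].
rewrite !RintegralZl//; [|exact: int_w..].
by rewrite !iw !mulr0 addr0.
Qed.

Let annihilator_eq w w' : annihilator w -> w =1 w' -> annihilator w'.
Proof. by move=> Aw /funext <-. Qed.

Let annihilator_arc a b w : annihilator w -> annihilator (fun x => arc a b x * w x).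
Proof.
move=> Aw.
have := annihilator_lin (2^-1 + 4^-1 * cos (pi * (b - a))) (- 4^-1) Aw
  (annihilator_cos (- (pi * (a + b))) Aw).
by move/annihilator_eq; apply => x; rewrite arcE; ring.
Qed.

Let annihilator_switch a b n : annihilator (fun x => switch n (arc a b x)).
Proof.
rewrite /switch; elim: (2 ^ n)%N => [|m IH].
  by apply: (annihilator_eq annihilator1) => x; rewrite expr0.
have At k : annihilator (fun x => arc a b x ^+ k * (1 - arc a b x ^+ n) ^+ m).
  elim: k => [|k IHk]; first by apply: (annihilator_eq IH) => x; rewrite expr0 mul1r.
  by apply: (annihilator_eq (annihilator_arc a b IHk)) => x; rewrite exprS mulrA.
apply: (annihilator_eq (annihilator_lin 1 (-1) IH (At n))) => x.
by rewrite exprS; ring.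
Qed.

(** The functions switch n (arc a b x) are trigonometric polynomials and converge
    boundedly to the indicator of the interval. *)
Lemma integral_itv_eq0 a b : 0 <= a -> a <= b -> b <= 1 ->
  (\int[nu]_(x in `]a, b]) (r x)%:E = 0)%E.
Proof.
move=> a0 ab b1; have mab : measurable (`]a, b] : set RT) by exact: measurable_itv.
have mr : measurable_fun setT r by have /measurable_EFinP := measurable_int _ ir.
have ann0 n : (\int[nu]_x (switch n (arc a b x) * r x)%:E = 0)%E.
  have An := annihilator_switch a b n.
  have [_ _ /(_ 0 0)] := An; rewrite /Rintegral => h.
  have e x : (switch n (arc a b x) * r x) =
      switch n (arc a b x) * cos (2 * pi * 0%:~R * x + 0) * r x.
    by rewrite mulr0 mul0r addr0 cos0 mulr1.
  under eq_integral do rewrite e.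
  by rewrite -[LHS]fineK ?h//; apply: integrable_fin_num => //; exact: int_w.
have msw n : measurable_fun setT (fun x => (switch n (arc a b x) * r x)%:E).
  have [m _ _] := annihilator_switch a b n.
  by apply/measurable_EFinP; exact: measurable_funM.
have [|||||_ _] := @dominated_convergence _ _ _ nu setT measurableT
  (fun n x => (switch n (arc a b x) * r x)%:E)
  (((fun x => (r x)%:E) \_ `]a, b])) (fun x => `|(r x)%:E|%E).
- exact: msw.
- by apply/measurable_restrict => //; apply: measurable_funTS; exact/measurable_EFinP.
- apply: (@unit_ae_interior _ [:: a; b]) => x x01.
  rewrite !inE negb_or => /andP[xa xb] _.
  have cE (l : R) : switch n (arc a b x) @[n --> \oo] --> l ->
      (switch n (arc a b x) * r x)%:E @[n --> \oo] --> (l * r x)%:E.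
    move=> cl; apply: cvg_EFin; first exact: nearW.
    exact: (cvgM cl (cvg_cst (r x))).
  have /andP[t0 t1] := arc_bound a b x.
  rewrite /patch; case: ifPn => xab.
    rewrite -[r x in X in _ --> X]mul1r; apply: cE; apply: switch_cvg1 => //.
    move: xab; rewrite inE/= in_itv/= => /andP[ax bx].
    by apply: arc_inside => //; rewrite ax lt_neqAle xb bx.
  rewrite -[point]/((0 : R)%:E) -[X in X%:E](mul0r (r x)).
  apply: cE; apply: switch_cvg0 => //; apply: arc_outside => //.
  move: xab; rewrite notin_setE/= in_itv/= => /negP.
  rewrite negb_and -!leNgt => /orP[xa'|].
    by left; rewrite lt_neqAle xa xa'.
  by rewrite -ltNge; right.
- exact: integrable_abse.
- apply: aeW => x n _; rewrite !abse_EFin lee_fin normrM.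
  have /andP[s0 s1] := switch_bound n (arc_bound a b x).
  by rewrite ger0_norm// ler_piMl.
rewrite -integral_mkcond => c.
have /(cvg_lim (@ereal_hausdorff R)) <- := c.
by apply: (cvg_lim (@ereal_hausdorff R)); under eq_fun do rewrite ann0; exact: cvg_cst.
Qed.

(** The integrals over intervals vanish by [integral_itv_eq0]; Dynkin's lemma
    extends this to all measurable sets. *)
Lemma fourier_uniqueness_real : {ae nu, forall x, r x = 0}.
Proof.
have setint A : measurable A -> nu.-integrable A (fun x => (r x)%:E).
  by move=> mA; apply: integrableS ir.
suff H (A : set RT) : measurable A -> (\int[nu]_(x in A) (r x)%:E = 0)%E.
  have : ae_eq nu setT (fun x => (r x)%:E) (cst 0%E).
    apply: integral_ae_eq => // E _ mE.
    by rewrite H// integral0.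
  by apply: filterS => x /(_ I) [].
pose G := [set X : set RT | ocitv X].
have itv0 a b : (\int[nu]_(x in `]a, b]) (r x)%:E = 0)%E.
  have mab : measurable (`]a, b] : set RT) by exact: measurable_itv.
  have mI : measurable (`[0, 1] : set RT) by exact: measurable_itv.
  pose a' := Num.max 0 (Num.min a 1); pose b' := Num.max a' (Num.min b 1).
  have mab' : measurable (`]a', b'] : set RT) by exact: measurable_itv.
  have <- : (\int[nu]_(x in `]a', b']) (r x)%:E = 0)%E.
    apply: integral_itv_eq0.
    - by rewrite le_max lexx.
    - by rewrite le_max lexx.
    - by rewrite ge_max [X in _ && X]ge_min lexx orbT andbT ge_max ler01 ge_min lexx orbT.
  rewrite integral_mkcond [RHS]integral_mkcond.
  have mr : measurable_fun setT r by have /measurable_EFinP := measurable_int _ ir.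
  apply: ae_eq_integral => //.
  - by apply/measurable_restrict => //; apply: measurable_funTS; exact/measurable_EFinP.
  - by apply/measurable_restrict => //; apply: measurable_funTS; exact/measurable_EFinP.
  apply: (@unit_ae_interior _ [::]) => x /andP[x0 x1] _ _.
  rewrite /patch !mem_setE !in_itv/= /a' /b'.
  rewrite gt_max x0 /= gt_min [1 < x]ltNge (ltW x1) orbF -/a'.
  have [ax|//] := ltP a x.
  have : a' < x by rewrite gt_max x0 gt_min ax.
  by rewrite le_max le_min (ltW x1) andbT /= [x <= a']leNgt => ->.
move=> mA; suff : <<s G >> A -> (\int[nu]_(x in A) (r x)%:E = 0)%E by exact.
apply: (@dynkin_induction _ RT G (fun A => (\int[nu]_(x in A) (r x)%:E = 0)%E)) => //.
- exact: ocitvI.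
- rewrite -[LHS]fineK ?integrable_fin_num//; congr EFin.
  rewrite -[RHS](r_cos 0 0); apply: eq_Rintegral => x _.
  by rewrite mulr0 mul0r addr0 cos0 mul1r.
- by move=> _ [[a b] _ <-].
- move=> S mS S0.
  have : (\int[nu]_(x in S `|` ~` S) (r x)%:E = 0)%E.
    rewrite setUv -[LHS]fineK ?integrable_fin_num//; congr EFin.
    rewrite -[RHS](r_cos 0 0); apply: eq_Rintegral => x _.
    by rewrite mulr0 mul0r addr0 cos0 mul1r.
  rewrite integral_setU_EFin//; last 3 first.
  - exact: measurableC.
  - by rewrite setUv; have /measurable_EFinP := measurable_int _ ir.
  - by apply/disj_setPS; rewrite setICr.
  by rewrite S0 add0e.
- move=> F mF tF F0; rewrite integral_bigcup//; last first.
    by apply: setint; exact: bigcup_measurable.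
  by rewrite eseries0.
Qed.

End orthogonal_to_trigonometric_polynomials.
End fourier_uniqueness.

(** * Parseval's identity *)

Section parseval.
Context {R : realType} d (T : measurableType d) (mu : {measure set T -> \bar R}).
Notation nrm := (nrm mu).
Notation sqint := (sqint mu).
Notation inner := (inner mu).
Variable E : nat -> T -> R[i].
Hypothesis E_sqint : forall n, sqint (E n).
Hypothesis E_orthonormal : forall m n, inner (E m) (E n) = (m == n)%:R.
Hypothesis E_total : forall h, sqint h -> (forall n, inner h (E n) = 0) ->
  nrm h = 0%E.

Section remainders.
Variable f : T -> R[i].
Hypothesis Lf : sqint f.

Let r M x := f x - \sum_(n < M) inner f (E n) * E n x.

Let Lr M : sqint (r M).
Proof.
apply: sqintB => //.
have := @sqint_sum _ _ _ mu _ (index_enum 'I_M)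
  (fun n : 'I_M => (fun x => inner f (E n) * E n x)).
by apply => i; exact: sqintZ.
Qed.

Let rS M : r M.+1 = (fun x => r M x - inner f (E M) * E M x).
Proof. by apply/funext => x; rewrite /r big_ord_recr /= opprD addrA. Qed.

Let E1 n : nrm (E n) = 1%E.
Proof. by rewrite nrmE// E_orthonormal eqxx. Qed.

(** Subtracting the projections on E 0, ..., E (M - 1) leaves the others
    untouched. *)
Let inner_r M n : inner (r M) (E n) = if (n < M)%N then 0 else inner f (E n).
Proof.
elim: M => [|M IH].
  rewrite ltn0; congr inner; apply/funext => x.
  by rewrite /r big_ord0 subr0.
rewrite rS innerBl//; last exact: sqintZ.
rewrite innerZl// IH E_orthonormal [in RHS]ltnS [in RHS]leq_eqVlt [M == n]eq_sym.
have [<-|nM] := eqVneq n M; first by rewrite ltnn /= mulr1 subrr.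
by rewrite /= mulr0 subr0.
Qed.

Let a M := fine (nrm (r M)).

Let aS M : a M.+1 = a M - sqmod (inner f (E M)).
Proof.
rewrite /a rS; have := @nrm_sub_proj _ _ _ mu (r M) (E M) (Lr M) (E_sqint M) (E1 M).
rewrite inner_r ltnn => ->.
by rewrite -[X in fine (X - _)](fineK (nrm_fin (Lr M))).
Qed.

Let a_sum M : a M = fine (nrm f) - \sum_(n < M) sqmod (inner f (E n)).
Proof.
elim: M => [|M IH]; last by rewrite aS IH big_ord_recr /= opprD addrA.
rewrite big_ord0 subr0; congr (fine (nrm _)); apply/funext => x.
by rewrite /r big_ord0 subr0.
Qed.

Let nrm_rB m n : (m <= n)%N -> nrm (fun x => r m x - r n x) = (a m - a n)%:E.
Proof.
elim: n => [|n IH].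
  rewrite leqn0 => /eqP ->; rewrite subrr /nrm.
  by under eq_integral do rewrite subrr sqmod0; rewrite integral0.
rewrite leq_eqVlt => /predU1P[->|mn].
  rewrite subrr /nrm.
  by under eq_integral do rewrite subrr sqmod0; rewrite integral0.
have Lmn k : sqint (fun x => r m x - r k x) by exact: sqintB.
have := @nrm_sub_proj _ _ _ mu _ (E n) (Lmn n.+1) (E_sqint n) (E1 n).
rewrite innerBl// !inner_r ltnSn ltnNge -ltnS mn /= subr0.
rewrite (_ : (fun x => _) = (fun x => r m x - r n x)); last first.
  by apply/funext => x; rewrite rS; ring.
rewrite IH// => h.
rewrite -[LHS]fineK ?nrm_fin//; congr EFin; rewrite aS.
rewrite -(fineK (nrm_fin (Lmn n.+1))) -EFinB in h; case: h => h.
by rewrite opprB addrCA h addrC subrK.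
Qed.

(** The remainders r M decrease in norm and differ by orthogonal pieces, hence
    form a Cauchy sequence; its limit is orthogonal to every E n, so it is null
    by totality, and the norms of the remainders tend to 0. *)
Lemma parseval_partial_sums :
  \sum_(n < M) sqmod (inner f (E n)) @[M --> \oo] --> fine (nrm f).
Proof.
have a0 M : 0 <= a M by rewrite fine_ge0 ?nrm_ge0.
have da : {homo a : n m / (n <= m)%N >-> m <= n}.
  by apply/nonincreasing_seqP => n; rewrite aS lerBlDr lerDl sqmod_ge0.
have lba : has_lbound (range a) by exists 0 => _ [n _ <-].
have ca := nonincreasing_is_cvgn da lba.
have [e e0|g Lg cg] := riesz_fischer Lr.
  have /cvgrPdist_le/(_ e e0) [M _ MP] := ca.
  have key m n : (M <= m)%N -> (m <= n)%N -> (nrm (fun x => (r m x - r n x)%R) <= e%:E)%E.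
    move=> Mm mn; rewrite nrm_rB// lee_fin.
    have := MP m Mm; rewrite /= ler_norml => /andP[+ _].
    by have := nonincreasing_cvgn_ge da ca n; lra.
  exists M => m n Mm Mn; have [mn|/ltnW nm] := leqP m n; first exact: key.
  by rewrite nrmBC; exact: key.
have g0 : nrm g = 0%E.
  apply: E_total => // n; apply/eqP; rewrite -sqmod_eq0; apply/eqP/le_anti.
  rewrite sqmod_ge0 andbT; apply/ler_addgt0Pl => e e0; rewrite addr0.
  have /cvg2P/(_ e e0) [M _ MP] := cg.
  have := MP (maxn M n.+1) (leq_maxl _ _).
  set k := maxn _ _ => /=; rewrite -lee_fin; apply: le_trans.
  have <- : inner (fun x => g x - r k x) (E n) = inner g (E n).
    by rewrite innerBl// inner_r /k leq_maxr subr0.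
  rewrite nrmBC; apply: sqmod_inner_le => //; exact: sqintB.
have : a @ \oo --> (0 : R).
  by have := cvg_nrm Lr Lg cg; rewrite g0.
move=> c0; have := cvgB (cvg_cst (fine (nrm f))) c0; rewrite subr0.
have -> : (fun M => \sum_(n < M) sqmod (inner f (E n))) = (fun=> fine (nrm f)) - a.
  by apply/funext => M; rewrite -[RHS]/(fine (nrm f) - a M) a_sum opprB addrCA subrr addr0.
by apply; exact: eventually_filter.
Qed.

End remainders.

Lemma parseval f : sqint f ->
  (\sum_(0 <= n <oo) (sqmod (inner f (E n)))%:E = nrm f)%E.
Proof.
move=> Lf; rewrite -[RHS]fineK ?nrm_fin//.
apply: (cvg_lim (@ereal_hausdorff R)).
have c := parseval_partial_sums Lf.
rewrite (_ : (fun _ => _) = (fun M => (\sum_(n < M) sqmod (inner f (E n)))%:E)).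
  by apply: cvg_EFin; [exact: nearW|exact: c].
by apply/funext => M; rewrite big_mkord sumEFin.
Qed.

End parseval.

Section fourier_series.
Context {R : realType}.
Notation mu := (@lebesgue_measure R).
Notation RT := (measurableTypeR R).
Notation nu := (@unit_measure R).

Lemma expi_int (n : int) : expi (2 * pi * n%:~R : R) = 1.
Proof.
have nat1 (k : nat) : expi (2 * pi * k%:R : R) = 1.
  elim: k => [|k IH]; first by rewrite mulr0 expi0.
  rewrite -[k.+1%:R]natr1 mulrDr mulr1 expiD IH mul1r /expi.
  by rewrite mulr_natl cos2pi sin2pi.
case: n => k; first by rewrite -pmulrn nat1.
by rewrite NegzE mulrNz mulrN expiN -pmulrn nat1 conjc1.
Qed.

(** By the fundamental theorem of calculus: the primitive takes the same value at
    0 and 1. *)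
Lemma unit_integral_cos (n : int) (th : R) : n != 0 ->
  (\int[nu]_x (cos (2 * pi * n%:~R * x + th))%:E = 0)%E.
Proof.
move=> n0; set k := 2 * pi * n%:~R.
have k0 : k != 0.
  by rewrite !mulf_neq0 ?intr_eq0// gt_eqF// pi_gt0.
have mI : measurable (`[0, 1] : set RT) by exact: measurable_itv.
have dF (x : R) : is_derive x 1 (fun y : R => k^-1 * sin (k * y + th)) (cos (k * x + th)).
  have d1 : is_derive x 1 (fun y : R => k * y + th) k.
    by apply: is_derive_eq; rewrite /GRing.scale /= !(mulr1, mulr0, addr0, add0r).
  have d2 : is_derive x 1 (sin \o (fun y : R => k * y + th)) (cos (k * x + th) * k).
    exact: is_derive1_comp (is_derive_sin _) d1.
  have := is_deriveZ k^-1 d2.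
  have -> : k^-1 *: (cos (k * x + th) * k) = cos (k * x + th).
    by rewrite /GRing.scale /= mulrCA mulVf ?mulr1.
  by [].
have cF : continuous (fun y : R => k^-1 * sin (k * y + th)).
  by move=> x; apply: differentiable_continuous; apply/derivable1_diffP.
have cc : continuous (fun y : R => cos (k * y + th)).
  move=> x; apply: continuous_comp; last exact: continuous_cos.
  by apply: cvgD; [apply: cvgM; [exact: cvg_cst|exact: cvg_id]|exact: cvg_cst].
have -> : (\int[nu]_x (cos (k * x + th))%:E =
    \int[mu]_(x in `[0%R, 1%R]) (cos (k * x + th))%:E)%E.
  have : (\int[nu]_x (1 + cos (k * x + th))%:E =
    \int[mu]_(x in `[0%R, 1%R]) (1 + cos (k * x + th))%:E)%E.
    apply: unit_measure_integral.
      apply/measurable_EFinP; apply: measurable_funD; first exact: measurable_cst.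
      exact: continuous_measurable_fun.
    by move=> x; rewrite lee_fin; have := cos_geN1 (k * x + th); lra.
  have bd (x : R) : `|cos (k * x + th)| <= 1 by rewrite ler_norml cos_geN1 cos_le1.
  have i1 : nu.-integrable setT (fun x => (cos (k * x + th))%:E).
    have := @integrable_mull R _ RT nu 1 (fun x => cos (k * x + th)) (fun=> 1).
    under [X in _ -> _ -> _ -> integrable _ _ X]eq_fun do rewrite mulr1.
    apply => //; first exact: continuous_measurable_fun.
    exact: unit_integrable_cst.
  have i2 : mu.-integrable `[0, 1] (fun x => (cos (k * x + th))%:E).
    apply: continuous_compact_integrable; first exact: segment_compact.
    by apply: continuous_subspaceT.
  have i3 : mu.-integrable `[0, 1] (fun x : R => 1%:E).
    apply: continuous_compact_integrable; first exact: segment_compact.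
    by apply: continuous_subspaceT => x; exact: cvg_cst.
  under eq_integral do rewrite EFinD.
  under [in RHS]eq_integral do rewrite EFinD.
  rewrite !integralD//; last exact: unit_integrable_cst.
  have -> : (\int[nu]_x 1%:E = 1)%E by rewrite integral_cst//= unit_measureT mule1.
  have -> : (\int[mu]_(x in `[0%R, 1%R]) 1%:E = 1)%E.
    by rewrite integral_cst//= lebesgue_measure_itv /= lte_fin ltr01 oppr0 adde0 mule1.
  have f1 := integrable_fin_num measurableT i1.
  have f2 := integrable_fin_num mI i2.
  by rewrite -(fineK f1) -(fineK f2) -!EFinD => -[/addrI ->].
rewrite (@continuous_FTC2 _ _ (fun y : R => k^-1 * sin (k * y + th))) ?ltr01//.
- rewrite mulr1 mulr0 add0r sinD.
  have /(congr1 (@complex.Re R)) /= ck := expi_int n.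
  have /(congr1 (@complex.Im R)) /= sk := expi_int n.
  by rewrite /k ck sk mul0r mul1r add0r subee.
- exact: continuous_subspaceT.
- split; first by move=> x _; have dx := dF x; exact: ex_derive.
    by apply: cvg_at_right_filter; exact: cF.
  by apply: cvg_at_left_filter; exact: cF.
- by move=> x _; rewrite derive1E; apply: derive_val.
Qed.

Definition fourier_mode (n : int) (x : R) : R[i] := expi (2 * pi * n%:~R * x).

Lemma fourier_mode_cmeas n : cmeas (fourier_mode n : RT -> R[i]).
Proof.
by apply: cmeas_expi; apply: measurable_funM; [exact: measurable_cst|exact: measurable_id].
Qed.

Lemma fourier_mode_sqint n : sqint nu (fourier_mode n).
Proof.
split; first exact: fourier_mode_cmeas.
rewrite /nrm; under eq_integral do rewrite sqmod_expi.
by rewrite integral_cst//= unit_measureT mule1 ltry.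
Qed.

Lemma fourier_mode_orthonormal m n :
  inner nu (fourier_mode m) (fourier_mode n) = (m == n)%:R.
Proof.
rewrite /inner.
have -> : (fun x : RT => fourier_mode m x * (fourier_mode n x)^*%C) =
    fourier_mode (m - n).
  apply/funext => x; rewrite /fourier_mode -expiN -expiD; congr expi.
  by rewrite intrD mulrNz; ring.
have [->|mn] := eqVneq m n.
  rewrite subrr /fourier_mode /Cintegral; apply: complexP => /=.
    under eq_Rintegral do rewrite mulr0 mul0r cos0.
    by rewrite Rintegral_cst// unit_measureT mulr1.
  under eq_Rintegral do rewrite mulr0 mul0r sin0.
  by rewrite Rintegral_cst// mul0r.
have mn0 : m - n != 0 by rewrite subr_eq0.
apply: complexP => /=; rewrite /Rintegral.
  by rewrite -[RHS]/(fine 0%E) -(unit_integral_cos 0 mn0); congr fine;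
    apply: eq_integral => x _; rewrite addr0.
rewrite -[RHS]/(fine 0%E) -(unit_integral_cos (- (pi / 2)) mn0); congr fine.
apply: eq_integral => x _; congr EFin.
by rewrite cosD cosN sinN cos_pihalf sin_pihalf mulr0 add0r mulrN1 opprK.
Qed.

(** Complex modes span the real cosines of arbitrary phase, and these only see
    the real and imaginary parts of h separately. *)
Lemma fourier_uniqueness (h : RT -> R[i]) : cintegrable nu h ->
  (forall n, Cintegral nu (fun x => fourier_mode n x * h x) = 0) ->
  {ae nu, forall x, h x = 0}.
Proof.
move=> ih h0.
have mi n : cintegrable nu (fun x => fourier_mode n x * h x).
  apply: cintegrable_mulexpi ih.
  by apply: measurable_funM; [exact: measurable_cst|exact: measurable_id].
have cos0 (n : int) th :
    Cintegral nu (fun x => (cos (2 * pi * n%:~R * x + th))%:C * h x) = 0.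
  have -> : (fun x : RT => (cos (2 * pi * n%:~R * x + th))%:C * h x) =
      (fun x => (2^-1 * expi th) * (fourier_mode n x * h x) +
        (2^-1 * expi (- th)) * (fourier_mode (- n) x * h x)).
    apply/funext => x; rewrite /fourier_mode.
    rewrite [LHS](_ : _ = 2^-1 * (expi (2 * pi * n%:~R * x + th) +
        expi (- (2 * pi * n%:~R * x + th))) * h x); last first.
      congr (_ * _); rewrite expiN; apply: complexP; rewrite !ReImE /=.
        by field.
      by field.
    rewrite opprD !expiD mulrNz mulrN mulNr; ring.
  rewrite CintegralD; [|exact: cintegrableZ..].
  by rewrite !CintegralZ// !h0 !mulr0 addr0.
have [i1 i2] := ih.
have re0 : {ae nu, forall x, complex.Re (h x) = 0}.
  apply: fourier_uniqueness_real => // n th.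
  have /(congr1 (@complex.Re R)) /= <- := cos0 n th.
  by apply: eq_Rintegral => x _; rewrite ReM /= mul0r subr0.
have im0 : {ae nu, forall x, complex.Im (h x) = 0}.
  apply: fourier_uniqueness_real => // n th.
  have /(congr1 (@complex.Im R)) /= <- := cos0 n th.
  by apply: eq_Rintegral => x _; rewrite ImM /= mul0r addr0.
by apply: filterS2 re0 im0 => x r0 m0; apply: complexP.
Qed.

(** The enumeration 0, -1, 1, -2, 2, ... of the integers. *)
Definition int_of_nat (n : nat) : int :=
  if odd n then Negz n./2 else Posz n./2.

Lemma int_of_nat_bij : bijective int_of_nat.
Proof.
exists (fun m : int => match m with Posz k => k.*2 | Negz k => k.*2.+1 end).
  move=> n; rewrite /int_of_nat -[RHS](odd_double_half n).
  by case: ifPn => _.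
case=> k; rewrite /int_of_nat /= odd_double /=; first by rewrite doubleK.
by rewrite uphalf_double.
Qed.

Lemma esum_int (a : int -> \bar R) : (forall m, 0 <= a m)%E ->
  (\esum_(m in [set: int]) a m = \sum_(0 <= n <oo) a (int_of_nat n))%E.
Proof.
move=> a0; rewrite nneseries_esumT//; apply: reindex_esum.
by rewrite setTT_bijective; exact: int_of_nat_bij.
Qed.

Lemma parseval_unit (f : RT -> R[i]) : sqint nu f ->
  (\esum_(n in [set: int]) (sqmod (inner nu f (fourier_mode n)))%:E = nrm nu f)%E.
Proof.
move=> Lf; rewrite esum_int; last by move=> m; rewrite lee_fin sqmod_ge0.
apply: (@parseval _ _ _ nu (fun n => fourier_mode (int_of_nat n))) => //.
- by move=> n; exact: fourier_mode_sqint.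
- move=> m n; rewrite fourier_mode_orthonormal.
  by rewrite (bij_eq int_of_nat_bij).
move=> h Lh h0.
have ih : cintegrable nu h.
  have := sqint_mulJ Lh (fourier_mode_sqint 0); congr cintegrable.
  by apply/funext => x; rewrite /fourier_mode mulr0 mul0r expi0 conjc1 mulr1.
have : {ae nu, forall x, h x = 0}.
  apply: fourier_uniqueness => // n.
  have [g _ gK] := int_of_nat_bij.
  rewrite -(h0 (g (- n))) gK /inner; congr Cintegral; apply/funext => x.
  by rewrite /fourier_mode -expiN mulrNz mulrN mulNr opprK mulrC.
move=> h00; rewrite /nrm -[RHS](integral0 nu setT).
have [mh _] := Lh.
apply: ge0_ae_eq_integral => //.
- exact: measurable_sqmodE.
- by move=> x _; rewrite lee_fin sqmod_ge0.
by apply: filterS h00 => x -> _; rewrite sqmod0.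
Qed.

End fourier_series.

(** * Changes of variables with constant Jacobian *)

Section transfer.
Context {R : realType} d1 d2 (X : measurableType d1) (Y : measurableType d2).
Variables (mu : {measure set X -> \bar R}) (mu' : {measure set Y -> \bar R}).

(** Only the integral formula is recorded, so that compositions and Tonelli's
    theorem replace determinants. *)
Definition jacobian (h : X -> Y) (c : R) := [/\ measurable_fun setT h, 0 <= c &
  forall f : Y -> \bar R, measurable_fun setT f -> (forall y, 0 <= f y)%E ->
    (\int[mu]_x f (h x) = c%:E * \int[mu']_y f y)%E].

Variables (h : X -> Y) (c : R).
Hypothesis jh : jacobian h c.

Lemma cmeas_jacobian (f : Y -> R[i]) : cmeas f -> cmeas (fun x => f (h x)).
Proof. by have [mh _ _] := jh; move=> [m1 m2]; split; [exact: (measurableT_comp m1 mh)|exact: (measurableT_comp m2 mh)]. Qed.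

Lemma integrable_jacobian (f : Y -> \bar R) :
  mu'.-integrable setT f -> mu.-integrable setT (fun x => f (h x)).
Proof.
have [mh c0 hc] := jh; move=> /integrableP[mf foo]; apply/integrableP; split.
  exact: measurableT_comp mh.
rewrite (hc (fun y => `|f y|%E))//; last exact: measurableT_comp.
by rewrite lte_mul_pinfty// ?lee_fin// integral_ge0.
Qed.

Lemma integral_jacobian (f : Y -> \bar R) : mu'.-integrable setT f ->
  (\int[mu]_x f (h x) = c%:E * \int[mu']_y f y)%E.
Proof.
have [mh c0 hc] := jh => fi; have mf := measurable_int _ fi.
rewrite integralE [in RHS]integralE muleBr//; last exact: integrable_add_def.
rewrite -(hc _ (measurable_funepos mf))//.
rewrite -(hc _ (measurable_funeneg mf))//.
by congr (_ - _)%E; apply: eq_integral => x _;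
   [rewrite -[RHS](congr1 (fun g => g x) (funepos_comp f h))
   |rewrite -[RHS](congr1 (fun g => g x) (funeneg_comp f h))].
Qed.

Lemma cintegrable_jacobian (f : Y -> R[i]) :
  cintegrable mu' f -> cintegrable mu (fun x => f (h x)).
Proof. by move=> [i1 i2]; split; [exact: (integrable_jacobian i1)|exact: (integrable_jacobian i2)]. Qed.

Lemma Cintegral_jacobian (f : Y -> R[i]) : cintegrable mu' f ->
  Cintegral mu (fun x => f (h x)) = c%:C * Cintegral mu' f.
Proof.
move=> [i1 i2]; apply: complexP; rewrite ReImE /= ?mul0r ?subr0 ?addr0.
  rewrite /Rintegral (integral_jacobian i1) fineM//; exact: integrable_fin_num.
rewrite /Rintegral (integral_jacobian i2) fineM//; exact: integrable_fin_num.
Qed.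

Lemma nrm_jacobian (f : Y -> R[i]) : cmeas f ->
  nrm mu (fun x => f (h x)) = (c%:E * nrm mu' f)%E.
Proof.
have [mh c0 hc] := jh => mf.
rewrite /nrm (hc (fun y => (sqmod (f y))%:E))//; first exact: measurable_sqmodE.
by move=> y; rewrite lee_fin sqmod_ge0.
Qed.

Lemma sqint_jacobian (f : Y -> R[i]) : sqint mu' f -> sqint mu (fun x => f (h x)).
Proof.
have [mh c0 hc] := jh => -[mf foo]; split; first exact: cmeas_jacobian.
by rewrite nrm_jacobian// lte_mul_pinfty ?nrm_ge0 ?lee_fin.
Qed.

Lemma inner_jacobian (f g : Y -> R[i]) : sqint mu' f -> sqint mu' g ->
  inner mu (fun x => f (h x)) (fun x => g (h x)) = c%:C * inner mu' f g.
Proof.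
move=> Lf Lg; exact: (Cintegral_jacobian (sqint_mulJ Lf Lg)).
Qed.

End transfer.

Section parameter_integrals.
Context {R : realType} d1 d2 (X : measurableType d1) (Y : measurableType d2).
Variable m2 : {sigma_finite_measure set Y -> \bar R}.

Lemma measurable_integral_snd (f : X * Y -> \bar R) : measurable_fun setT f ->
  measurable_fun setT (fun x => (\int[m2]_y f (x, y))%E).
Proof.
move=> mf; under eq_fun do rewrite integralE.
have e1 x : (\int[m2]_y (fun z => f (x, z))^\+ y = fubini_F m2 f^\+ x)%E.
  by rewrite (_ : (fun z => f (x, z)) = f \o pair x)// funepos_comp.
have e2 x : (\int[m2]_y (fun z => f (x, z))^\- y = fubini_F m2 f^\- x)%E.
  by rewrite (_ : (fun z => f (x, z)) = f \o pair x)// funeneg_comp.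
under eq_fun do rewrite e1 e2.
apply: emeasurable_funB.
  by apply: measurable_fun_fubini_tonelli_F => //; exact: measurable_funepos.
by apply: measurable_fun_fubini_tonelli_F => //; exact: measurable_funeneg.
Qed.

Lemma cmeas_Cintegral (F : X * Y -> R[i]) : cmeas F ->
  cmeas (fun x => Cintegral m2 (fun y => F (x, y))).
Proof.
move=> [m1 m2']; split => /=; rewrite /Rintegral.
  apply: measurableT_comp; first exact: fine_measurable.
  by apply: (measurable_integral_snd (f := fun z => (complex.Re (F z))%:E)); exact/measurable_EFinP.
apply: measurableT_comp; first exact: fine_measurable.
by apply: (measurable_integral_snd (f := fun z => (complex.Im (F z))%:E)); exact/measurable_EFinP.
Qed.

End parameter_integrals.

(** * Plancherel's identity on the line *)

Section periodization.
Context {R : realType}.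
Notation mu := (@lebesgue_measure R).
Notation RT := (measurableTypeR R).
Notation nu := (@unit_measure R).

Lemma jacobian_affine (a b : R) : a != 0 ->
  jacobian mu mu (fun x : RT => a * x + b : RT) (`|a|^-1).
Proof.
move=> a0; split; [exact: measurable_affine|by rewrite invr_ge0|].
by move=> f mf f0; exact: ge0_integral_affine.
Qed.

Lemma unit_measure_support (f : RT -> \bar R) : measurable_fun setT f ->
  (forall x, ~~ (0 <= x <= 1) -> f x = 0%E) -> (\int[nu]_x f x = \int[mu]_x f x)%E.
Proof.
move=> mf f0.
have ge0 (g : RT -> \bar R) : measurable_fun setT g -> (forall x, 0 <= g x)%E ->
    (forall x, ~~ (0 <= x <= 1) -> g x = 0%E) -> (\int[nu]_x g x = \int[mu]_x g x)%E.
  move=> mg g0 gs; rewrite unit_measure_integral// integral_mkcond.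
  apply: eq_integral => x _; rewrite /patch; case: ifPn => // xI.
  by rewrite gs//; move: xI; rewrite notin_setE /= in_itv /= => /negP.
rewrite integralE [in RHS]integralE; congr (_ - _)%E; apply: ge0 => //.
- exact: measurable_funepos.
- by move=> x xI; rewrite funeposE f0// maxxx.
- exact: measurable_funeneg.
- by move=> x xI; rewrite funenegE f0// oppe0 maxxx.
Qed.

(** The line is the disjoint union of the translates of a unit interval. *)
Lemma integral_translates (F : RT -> \bar R) : measurable_fun setT F ->
  (forall x, 0 <= F x)%E ->
  (\int[mu]_x F x = \int[nu]_u \esum_(m in [set: int]) F (u + m%:~R)%R)%E.
Proof.
move=> mF F0.
pose I n : set RT := `[(int_of_nat n)%:~R, (int_of_nat n + 1)%:~R[%classic.
have mI n : measurable (I n) by exact: measurable_itv.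
have [g _ gK] := int_of_nat_bij.
have UI : \bigcup_n I n = setT.
  apply/seteqP; split => // x _; exists (g (Num.floor x)) => //.
  by rewrite /I /= gK in_itv /= floor_itv.
have tI : trivIset setT I.
  move=> m n _ _ [x [Im In]]; move: Im In; rewrite /I /= !in_itv /= => Im In.
  by apply: (bij_inj int_of_nat_bij); rewrite -(floor_def Im) (floor_def In).
have mFm (m : int) : measurable_fun setT (fun u : RT => F (u + m%:~R)%R).
  apply: (measurableT_comp mF).
  by have := measurable_affine 1 (m%:~R : R); under eq_fun do rewrite mul1r.
transitivity (\int[nu]_u \sum_(0 <= n <oo) F (u + (int_of_nat n)%:~R)%R)%E; last first.
  by apply: eq_integral => u _; rewrite -(esum_int (a := fun m => F (u + m%:~R))).
rewrite integral_nneseries//.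
transitivity (\int[mu]_(x in \bigcup_n I n) F x)%E; first by rewrite UI.
transitivity (\sum_(0 <= n <oo) \int[mu]_(x in I n) F x)%E.
  by apply: (@ge0_integral_bigcup _ RT R mu I F mI) => //; exact: measurable_funTS.
apply: eq_eseriesr => n _.
set m := int_of_nat n.
rewrite unit_measure_integral// -integral_itv_bndo_bndc; last exact: (measurable_funTS (mFm m)).
rewrite integral_mkcond [in RHS]integral_mkcond.
have := @ge0_integral_affine R 1 m%:~R (F \_ (I n)) (oner_neq0 _).
rewrite normr1 invr1 mul1e => <-.
- apply: eq_integral => x _; rewrite mul1r /patch.
  congr (if _ then _ else _).
  rewrite !mem_setE /I !in_itv /= -/m intrD.
  by congr (_ && _); [rewrite lerDr|rewrite addrC ltrD2l].
- by apply/measurable_restrict => //; exact: measurable_funTS.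
- by move=> x; apply: erestrict_ge0.
Qed.

End periodization.

Section plancherel_line.
Context {R : realType}.
Notation mu := (@lebesgue_measure R).
Notation RT := (measurableTypeR R).
Notation nu := (@unit_measure R).

Definition fourier (f : RT -> R[i]) (s : R) : R[i] :=
  Cintegral mu (fun x => f x * expi (2 * pi * s * x)).

Lemma measurable_mulr2 (c : R) : measurable_fun setT (fun z : RT * RT => c * z.1 * z.2).
Proof.
apply: measurable_funM; last exact: measurable_snd.
by apply: measurable_funM; [exact: measurable_cst|exact: measurable_fst].
Qed.

Lemma cmeas_fourier f : cmeas f -> cmeas (fourier f : RT -> R[i]).
Proof.
move=> [m1 m2].
apply: (@cmeas_Cintegral _ _ _ RT RT mu (fun z => f z.2 * expi (2 * pi * z.1 * z.2))).
apply: cmeasM; last by apply: cmeas_expi; exact: measurable_mulr2.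
by split; [apply: (measurableT_comp m1)|apply: (measurableT_comp m2)]; exact: measurable_snd.
Qed.

Lemma cmeas_expi_linear (s : R) : cmeas (fun x : RT => expi (2 * pi * s * x)).
Proof.
apply: cmeas_expi; apply: measurable_funM; first exact: measurable_cst.
exact: measurable_id.
Qed.

(** The samples of the transform of f at t + n are the Fourier coefficients of
    f times a unimodular function; Parseval at every t, integrated over t,
    is the Plancherel identity. *)
Lemma plancherel_unit f : sqint mu f -> (forall x, ~~ (0 <= x <= 1) -> f x = 0) ->
  nrm mu (fourier f) = nrm mu f.
Proof.
move=> [mf foo] f0.
have support (g : RT -> R[i]) : cmeas g -> (forall x, ~~ (0 <= x <= 1) -> g x = 0) ->
    nrm nu g = nrm mu g.
  move=> mg g0; apply: unit_measure_support; first exact: measurable_sqmodE.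
  by move=> x xI; rewrite g0// sqmod0.
have mexp t : cmeas (fun x => f x * expi (2 * pi * t * x)).
  by apply: cmeasM mf (cmeas_expi_linear t).
have Lft (t : R) : sqint nu (fun x => f x * expi (2 * pi * t * x)).
  split => //; rewrite (@eq_nrm _ _ _ nu _ f) ?support//.
  by move=> x; rewrite sqmodM sqmod_expi mulr1.
have coef (t : R) (n : int) : fourier f (t - n%:~R) =
    inner nu (fun x => f x * expi (2 * pi * t * x)) (fourier_mode n).
  rewrite /inner /fourier.
  have eC x : f x * expi (2 * pi * t * x) * (fourier_mode n x)^*%C =
      f x * expi (2 * pi * (t - n%:~R) * x).
    rewrite /fourier_mode -expiN -mulrA -expiD; congr (_ * expi _); ring.
  under [in RHS]eq_fun do rewrite eC.
  have [m1 m2] := mexp (t - n%:~R).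
  apply: complexP => /=; rewrite /Rintegral; congr fine; apply/esym/unit_measure_support.
  - exact/measurable_EFinP.
  - by move=> x xI; rewrite f0// mul0r.
  - exact/measurable_EFinP.
  - by move=> x xI; rewrite f0// mul0r.
have mF : measurable_fun setT (fun s : RT => (sqmod (fourier f s))%:E).
  by apply: measurable_sqmodE; exact: cmeas_fourier.
rewrite {1}/nrm integral_translates//; last by move=> x; rewrite lee_fin sqmod_ge0.
transitivity (\int[nu]_u (nrm mu f))%E; last first.
  by rewrite integral_cst//= unit_measureT mule1.
apply: eq_integral => t _.
have -> : (\esum_(m in [set: int]) (sqmod (fourier f (t + m%:~R)%R))%:E =
    \esum_(m in [set: int]) (sqmod (fourier f (t - m%:~R)%R))%:E)%E.
  rewrite (@reindex_esum R _ _ [set: int] [set: int] (fun m => - m)).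
    by apply: eq_esum => m _; rewrite mulrNz.
  by rewrite setTT_bijective; exists (fun m => - m); exact: opprK.
under eq_esum do rewrite coef.
rewrite parseval_unit// -(support _ mf f0); apply: eq_nrm => x.
by rewrite sqmodM sqmod_expi mulr1.
Qed.

(** A function is its own product with the indicator of its support, and both are
    square integrable. *)
Lemma sqint_bounded_support (A : R) f : sqint mu f ->
  (forall x, A < `|x| -> f x = 0) -> cintegrable mu f.
Proof.
move=> Lf fA.
have mI : measurable (`[- A, A] : set RT) by exact: measurable_itv.
pose I (x : RT) : R[i] := (\1_(`[- A, A] : set RT) x)%:C.
have LI : sqint mu I.
  split; first by split; [exact: measurable_indic|exact: measurable_cst].
  rewrite /nrm.
  have e x : sqmod (I x) = \1_(`[- A, A] : set RT) x.
    by rewrite sqmodE /= expr0n addr0 indicE; case: (_ \in _); rewrite ?expr1n ?expr0n.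
  under eq_integral do rewrite e.
  rewrite integral_indic//= setIT lebesgue_measure_itv /=.
  by case: ifP => _; rewrite ?ltry// -EFinD ltry.
have := sqint_mulJ Lf LI; congr cintegrable; apply/funext => x.
rewrite /I indicE; have [xI|xI] := boolP (x \in _).
  by apply: complexP; rewrite !ReImE /= ?oppr0 ?(mulr1, mulr0, subr0, addr0, add0r).
rewrite fA ?mul0r//; move: xI; rewrite notin_setE /= in_itv /= => /negP.
by rewrite -ler_norml -ltNge.
Qed.

(** An affine substitution moves the support into the unit interval. *)
Lemma plancherel_line (A : R) f : sqint mu f ->
  (forall x, A < `|x| -> f x = 0) -> nrm mu (fourier f) = nrm mu f.
Proof.
move=> Lf fA; pose B := `|A| + 1.
have B0 : 0 < B by rewrite /B ltr_wpDl.
have fB x : B < `|x| -> f x = 0.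
  by move=> Bx; apply: fA; apply: le_lt_trans Bx; rewrite /B (le_trans (ler_norm _))// lerDl.
have B2 : 2 * B != 0 by rewrite mulf_neq0// gt_eqF.
have aB : `|2 * B|^-1 = (2 * B)^-1 by rewrite ger0_norm// mulr_ge0// ltW.
have jB := jacobian_affine (- B) B2; rewrite aB in jB.
pose g (x : RT) := f (2 * B * x - B).
have Lg : sqint mu g by exact: (sqint_jacobian jB Lf).
have g0 x : ~~ (0 <= x <= 1) -> g x = 0.
  rewrite negb_and -!ltNge => /orP[x0|x1]; apply: fB.
    by rewrite ltr0_norm; nra.
  by rewrite gtr0_norm; nra.
have [mf foo] := Lf.
have icf (s : R) : cintegrable mu (fun y : RT => f y * expi (2 * pi * s * y)).
  apply: (@sqint_bounded_support A); last by move=> x Ax; rewrite fA// mul0r.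
  split; first exact: cmeasM mf (cmeas_expi_linear s).
  by rewrite (@eq_nrm _ _ _ mu _ f)// => x; rewrite sqmodM sqmod_expi mulr1.
have fg s : fourier g s =
    (2 * B)^-1%:C * (expi (pi * s) * fourier f ((2 * B)^-1 * s + 0)).
  rewrite /fourier -CintegralZ// -(Cintegral_jacobian jB); last exact: cintegrableZ.
  congr Cintegral; apply/funext => x.
  rewrite mulrCA -expiD /g; congr (_ * expi _); field.
  by rewrite gt_eqF.
have jB' := @jacobian_affine R (2 * B)^-1 0 (invr_neq0 B2).
have := plancherel_unit Lg g0.
have -> : nrm mu (fourier g) = nrm mu (fun s : RT =>
    (2 * B)^-1%:C * (expi (pi * s) * fourier f ((2 * B)^-1 * s + 0))).
  by apply: eq_nrm => s; rewrite fg.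
rewrite nrmZ; last first.
  apply: cmeasM; last exact: (cmeas_jacobian jB' (cmeas_fourier mf)).
  by apply: cmeas_expi; apply: measurable_funM; [exact: measurable_cst|exact: measurable_id].
rewrite (@eq_nrm _ _ _ mu _ (fun s : RT => fourier f ((2 * B)^-1 * s + 0))); last first.
  by move=> s; rewrite sqmodM sqmod_expi mul1r.
rewrite (nrm_jacobian jB') ?(nrm_jacobian jB)//; last exact: cmeas_fourier.
rewrite muleA -EFinM => h.
have e : sqmod ((2 * B)^-1%:C) * `|(2 * B)^-1|^-1 = (2 * B)^-1.
  rewrite sqmodE /= expr0n addr0 ger0_norm ?invr_ge0 ?mulr_ge0 ?ltW// invrK.
  by field; rewrite gt_eqF.
rewrite e in h.
have /(congr1 (fun t => (2 * B)%:E * t)%E) := h.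
by rewrite !muleA -EFinM mulfV// !mul1e.
Qed.

End plancherel_line.

(** * Linear changes of variables in the plane *)

Section plane_jacobians.
Context {R : realType}.
Notation mu := (@lebesgue_measure R).
Notation RT := (measurableTypeR R).
Notation m2 := (mu \x mu)%E.

Lemma jacobian_comp d1 d2 d3 (X : measurableType d1) (Y : measurableType d2)
    (Z : measurableType d3) (m1 : {measure set X -> \bar R})
    (m2 : {measure set Y -> \bar R}) (m3 : {measure set Z -> \bar R})
    (g : X -> Y) (h : Y -> Z) (c d : R) :
  jacobian m1 m2 g c -> jacobian m2 m3 h d -> jacobian m1 m3 (fun x => h (g x)) (c * d).
Proof.
move=> [mg c0 gc] [mh d0 hd]; split.
- exact: measurableT_comp mg.
- exact: mulr_ge0.
- move=> f mf f0; rewrite (gc (fun y => f (h y)))//.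
    by rewrite hd// muleA EFinM.
  exact: measurableT_comp mh.
Qed.

Lemma jacobian_swap : jacobian m2 m2 (fun z : RT * RT => (z.2, z.1)) 1.
Proof.
have ms : measurable_fun setT (fun z : RT * RT => (z.2, z.1)).
  exact: measurable_fun_pair measurable_snd measurable_fst.
split => // f mf f0; rewrite mul1e.
rewrite (fubini_tonelli1 (fun z : RT * RT => f (z.2, z.1)))//; last exact: measurableT_comp ms.
by rewrite fubini_tonelli2.
Qed.

Lemma measurable_triangular (a b e c d : R) : measurable_fun setT
  (fun z : RT * RT => (a * z.1 + b * z.2 + e, c * z.2 + d) : RT * RT).
Proof.
apply: measurable_fun_pair.
  apply: measurable_funD; last exact: measurable_cst.
  apply: measurable_funD; apply: measurable_funM; try exact: measurable_cst.
    exact: measurable_fst.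
  exact: measurable_snd.
apply: measurable_funD; last exact: measurable_cst.
by apply: measurable_funM; [exact: measurable_cst|exact: measurable_snd].
Qed.

(** Tonelli: the substitution is affine in the first variable when the second one
    is fixed. *)
Lemma jacobian_triangular (a b e c d : R) : a != 0 -> c != 0 ->
  jacobian m2 m2 (fun z : RT * RT => (a * z.1 + b * z.2 + e, c * z.2 + d) : RT * RT)
    (`|a|^-1 * `|c|^-1).
Proof.
move=> a0 c0; have mh := measurable_triangular a b e c d.
split => // f mf f0.
rewrite (fubini_tonelli2 (fun z : RT * RT => f (a * z.1 + b * z.2 + e, c * z.2 + d)))//;
  last exact: measurableT_comp mh.
have mG : measurable_fun setT (fubini_G mu f) by exact: measurable_fun_fubini_tonelli_G.
have G0 y : (0 <= fubini_G mu f y)%E by exact: integral_ge0.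
transitivity (\int[mu]_y (`|a|^-1%:E * fubini_G mu f (c * y + d)%R))%E.
  apply: eq_integral => y _; rewrite /fubini_G /=.
  have := @ge0_integral_affine R a (b * y + e) (fun x => f (x, c * y + d)) a0.
  under eq_integral do rewrite addrA.
  by apply => //; exact: measurable_fun_pair1.
rewrite ge0_integralZl//.
- by rewrite ge0_integral_affine// muleA EFinM fubini_tonelli2.
- by apply: (measurableT_comp mG); exact: measurable_affine.
Qed.

(** The composition of a triangular substitution with one that becomes triangular
    after exchanging the variables. *)
Lemma jacobian_weyl :
  jacobian m2 m2 (fun z : RT * RT => (z.2 - z.1, z.1 + z.2) : RT * RT) (2^-1).
Proof.
have n1 : (-1 : R) != 0 by rewrite oppr_eq0 oner_eq0.
have n2 : (2 : R) != 0 by [].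
have j1 := @jacobian_triangular (-1) 1 0 1 0 n1 (oner_neq0 _).
have j2 := @jacobian_triangular 2 (-1) 0 1 0 n2 (oner_neq0 _).
have := jacobian_comp j1 (jacobian_comp jacobian_swap (jacobian_comp j2 jacobian_swap)).
rewrite /= normrN normr1 invr1 !(mul1r, mulr1) ger0_norm//.
by congr jacobian; apply/funext => z; congr pair; ring.
Qed.

End plane_jacobians.

(** * Weyl kernels of bounded functions of bounded support *)

Section weyl_kernels.
Context {R : realType}.
Notation mu := (@lebesgue_measure R).
Notation RT := (measurableTypeR R).
Notation m2 := (mu \x mu)%E.
Implicit Types (f g h K : RT * RT -> R[i]).

(** The offset 0 keeps the frequency in the form a * s + b of the affine
    substitutions. *)
Definition partial_fourier (lam : R) g (z : RT * RT) : R[i] :=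
  fourier (fun x => g (x, z.1)) (lam / 2 * z.2 + 0).

(** In the coordinates y = eta - xi and s = xi + eta the kernel is a Fourier
    transform in the first variable of g, with frequency lam s / 2. *)
Lemma kernel_integralE lam g z :
  kernel_integral lam g z = partial_fourier lam g (z.2 - z.1, z.1 + z.2).
Proof.
rewrite /kernel_integral /partial_fourier /fourier; congr Cintegral.
by apply/funext => x /=; congr (_ * expi _); rewrite addr0; field.
Qed.

Lemma cmeas_swap g : cmeas g -> cmeas (fun z : RT * RT => g (z.2, z.1)).
Proof. exact: (cmeas_jacobian jacobian_swap). Qed.

Lemma cmeas_slice g y : cmeas g -> cmeas (fun x : RT => g (x, y)).
Proof. by move=> [m1 m2']; split; [exact: (measurable_fun_pair1 y m1)|exact: (measurable_fun_pair1 y m2')]. Qed.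

Lemma cmeas_partial_fourier lam g : cmeas g -> cmeas (partial_fourier lam g).
Proof.
move=> [m1 m2'].
pose F (w : (RT * RT) * RT) : R[i] :=
  g (w.2, w.1.1) * expi (2 * pi * (lam / 2 * w.1.2 + 0) * w.2).
suff mF : cmeas F by exact: (cmeas_Cintegral mu mF).
have mx : measurable_fun setT (fun w : (RT * RT) * RT => w.2) by exact: measurable_snd.
have my : measurable_fun setT (fun w : (RT * RT) * RT => w.1.1).
  exact: (measurableT_comp measurable_fst measurable_fst).
have ms : measurable_fun setT (fun w : (RT * RT) * RT => w.1.2).
  exact: (measurableT_comp measurable_snd measurable_fst).
have mxy : measurable_fun setT (fun w : (RT * RT) * RT => (w.2, w.1.1)).
  exact: measurable_fun_pair.
apply: cmeasM.
  by split; [exact: (measurableT_comp m1 mxy)|exact: (measurableT_comp m2' mxy)].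
apply: cmeas_expi; apply: measurable_funM => //.
apply: measurable_funM; first exact: measurable_cst.
apply: measurable_funD; last exact: measurable_cst.
by apply: measurable_funM => //; exact: measurable_cst.
Qed.

Lemma cmeas_kernel_integral lam g : cmeas g ->
  cmeas (kernel_integral lam g : RT * RT -> R[i]).
Proof.
move=> mg; rewrite (_ : kernel_integral lam g =
  (fun z => partial_fourier lam g (z.2 - z.1, z.1 + z.2))).
  exact: (cmeas_jacobian jacobian_weyl (cmeas_partial_fourier lam mg)).
by apply/funext => z; exact: kernel_integralE.
Qed.

Lemma nrm_slices_fst h : cmeas h -> nrm m2 h = (\int[mu]_y nrm mu (fun s => h (y, s)))%E.
Proof.
move=> mh; rewrite /nrm (fubini_tonelli1 (fun z : RT * RT => (sqmod (h z))%:E))//.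
  exact: measurable_sqmodE.
by move=> z; rewrite lee_fin sqmod_ge0.
Qed.

Lemma nrm_slices_snd h : cmeas h -> nrm m2 h = (\int[mu]_y nrm mu (fun x => h (x, y)))%E.
Proof.
move=> mh; rewrite /nrm (fubini_tonelli2 (fun z : RT * RT => (sqmod (h z))%:E))//.
  exact: measurable_sqmodE.
by move=> z; rewrite lee_fin sqmod_ge0.
Qed.

Lemma measurable_nrm_slices h : cmeas h ->
  measurable_fun setT (fun y => nrm mu (fun x => h (x, y))).
Proof.
move=> mh; apply: (measurable_fun_fubini_tonelli_G (fun z : RT * RT => (sqmod (h z))%:E)).
  exact: measurable_sqmodE.
by move=> z; rewrite lee_fin sqmod_ge0.
Qed.

Lemma nrm_fourier_scaled (lam : R) (f : RT -> R[i]) : lam != 0 -> cmeas f ->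
  nrm mu (fun s : RT => fourier f (lam / 2 * s + 0)) =
  ((2 / `|lam|)%:E * nrm mu (fourier f))%E.
Proof.
move=> lam0 mf; have l2 : lam / 2 != 0 by rewrite mulf_neq0// invr_eq0.
rewrite (nrm_jacobian (jacobian_affine 0 l2)); last exact: cmeas_fourier.
suff -> : `|lam / 2|^-1 = 2 / `|lam| by [].
by rewrite normrM invfM normfV invrK (ger0_norm (ler0n _ 2)) mulrC.
Qed.

(** Bounded functions supported in a box: every integral converges for them. *)
Definition box_function g := cmeas g /\ exists A : R,
  (forall z, sqmod (g z) <= A ^+ 2) /\
  (forall z, A < `|z.1| \/ A < `|z.2| -> g z = 0).

Lemma box_functionP g : box_function g -> cmeas g /\ exists A : R,
  [/\ 0 <= A, forall z, sqmod (g z) <= A ^+ 2 &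
  forall z, A < `|z.1| \/ A < `|z.2| -> g z = 0].
Proof.
move=> [mg [A [gA g0]]]; split => //; exists `|A|; split => //.
  by move=> z; rewrite real_normK ?num_real.
by move=> z [zA|zA]; apply: g0; [left|right]; apply: le_lt_trans (ler_norm _) zA.
Qed.

Definition box (A : R) : set (RT * RT) := `[- A, A] `*` `[- A, A].

Lemma measurable_box A : measurable (box A).
Proof. by apply: measurableX; exact: measurable_itv. Qed.

Lemma boxE A (z : RT * RT) : (z \in box A) = (`|z.1| <= A) && (`|z.2| <= A).
Proof. by rewrite /box in_setX !mem_setE !in_itv /= -!ler_norml. Qed.

Lemma finite_segment (A : R) : (mu (`[(- A)%R, A] : set RT) < +oo)%E.
Proof.
by rewrite lebesgue_measure_itv /=; case: ifP => _; rewrite ?ltry// -EFinD ltry.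
Qed.

Lemma finite_box A : (m2 (box A) < +oo)%E.
Proof.
rewrite product_measure1E; [|exact: measurable_itv..].
apply: lte_mul_pinfty; [exact: measure_ge0| |exact: finite_segment].
by rewrite ge0_fin_numE ?measure_ge0//; exact: finite_segment.
Qed.

Lemma integrable_box (c A : R) : m2.-integrable setT (fun z => (c * \1_(box A) z)%:E).
Proof.
under eq_fun do rewrite EFinM.
apply: integrableZl => //.
apply/integrableP; split.
  by apply/measurable_EFinP; exact: measurable_indic (measurable_box A).
under eq_integral do rewrite /= ger0_norm//.
by rewrite integral_indic ?setIT ?finite_box//; exact: measurable_box.
Qed.

Lemma box_function_sqint g : box_function g -> sqint m2 g.
Proof.
move=> /box_functionP[mg [A [A0 gA g0]]]; split => //.
apply: (@le_lt_trans _ _ (\int[m2]_z (A ^+ 2 * \1_(box A) z)%:E)%E); last first.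
  exact: integrable_lty (integrable_box _ _).
apply: ge0_le_integral => //.
- by move=> z _; rewrite lee_fin sqmod_ge0.
- exact: measurable_sqmodE.
- by have := measurable_int _ (integrable_box (A ^+ 2) A).
move=> z _; rewrite lee_fin indicE boxE.
have [z1|z1] := leP `|z.1| A; have [z2|z2] := leP `|z.2| A; rewrite /= ?mulr1//.
- by rewrite g0 ?sqmod0 ?mulr0//; right.
- by rewrite g0 ?sqmod0 ?mulr0//; left.
- by rewrite g0 ?sqmod0 ?mulr0//; left.
Qed.

Lemma normc_sqrt (z : R[i]) : ComplexField.Normc.normc z = Num.sqrt (sqmod z).
Proof. by rewrite sqmodE; case: z. Qed.

Lemma box_function_L1 g : box_function g -> in_L1 g.
Proof.
move=> bg; have [mg [A [A0 gA g0]]] := box_functionP bg; split => //.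
have mn : measurable_fun setT (fun z => ComplexField.Normc.normc (g z)).
  under eq_fun do rewrite normc_sqrt.
  apply: measurableT_comp; last exact: measurable_sqmod.
  by apply: continuous_measurable_fun; exact: sqrt_continuous.
apply: (@le_lt_trans _ _ (\int[m2]_z (A * \1_(box A) z)%:E)%E); last first.
  exact: integrable_lty (integrable_box _ _).
apply: ge0_le_integral => //.
- by move=> z _; rewrite normc_sqrt lee_fin sqrtr_ge0.
- exact/measurable_EFinP.
- by have := measurable_int _ (integrable_box A A).
move=> z _; rewrite lee_fin normc_sqrt indicE boxE.
have [z1|z1] := leP `|z.1| A; have [z2|z2] := leP `|z.2| A; rewrite /= ?mulr1//.
- by rewrite -[leRHS]ger0_norm// -sqrtr_sqr ler_wsqrtr.
- by rewrite g0 ?sqmod0 ?sqrtr0 ?mulr0//; right.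
- by rewrite g0 ?sqmod0 ?sqrtr0 ?mulr0//; left.
- by rewrite g0 ?sqmod0 ?sqrtr0 ?mulr0//; left.
Qed.

Lemma box_slice_sqint g y : box_function g -> sqint mu (fun x : RT => g (x, y)).
Proof.
move=> /box_functionP[mg [A [A0 gA g0]]]; have ms := cmeas_slice y mg; split => //.
have mI : measurable (`[- A, A] : set RT) by exact: measurable_itv.
apply: (@le_lt_trans _ _ (\int[mu]_x ((A ^+ 2)%:E * (\1_(`[- A, A] : set RT) x)%:E))%E); last first.
  rewrite ge0_integralZl//; last 2 first.
  - by apply/measurable_EFinP; exact: measurable_indic.
  - by rewrite lee_fin sqr_ge0.
  rewrite integral_indic//= setIT; apply: lte_mul_pinfty => //; last exact: finite_segment.
  by rewrite lee_fin sqr_ge0.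
apply: ge0_le_integral => //.
- by move=> x _; rewrite lee_fin sqmod_ge0.
- exact: measurable_sqmodE.
- by apply: measurable_funeM; apply/measurable_EFinP; exact: measurable_indic.
move=> x _; rewrite -EFinM lee_fin indicE mem_setE in_itv /= -ler_norml.
have [x1|x1] := leP `|x| A; rewrite /= ?mulr1//.
by rewrite g0 ?sqmod0 ?mulr0//; left.
Qed.

Lemma box_slice_integrable g y s : box_function g ->
  cintegrable mu (fun x : RT => g (x, y) * expi (2 * pi * s * x)).
Proof.
move=> bg; have [mg [A [A0 gA g0]]] := box_functionP bg.
have [ms soo] := box_slice_sqint y bg.
apply: (@sqint_bounded_support _ A).
  split; first exact: cmeasM ms (cmeas_expi_linear s).
  by rewrite (@eq_nrm _ _ _ mu _ (fun x : RT => g (x, y)))// => x; rewrite sqmodM sqmod_expi mulr1.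
by move=> x Ax; rewrite g0 ?mul0r//; left.
Qed.

Lemma nrm_weyl_coordinates lam g : cmeas g ->
  nrm m2 (kernel_integral lam g) = ((2^-1)%:E * nrm m2 (partial_fourier lam g))%E.
Proof.
move=> mg; rewrite -(nrm_jacobian jacobian_weyl); last exact: cmeas_partial_fourier.
by apply: eq_nrm => z; rewrite kernel_integralE.
Qed.

(** Plancherel's identity on every horizontal slice; the factors 1/2 of the
    rotation and 2 / |lam| of the frequency combine. *)
Lemma nrm_kernel_integral_box lam g : lam != 0 -> box_function g ->
  nrm m2 (kernel_integral lam g) = (`|lam|^-1%:E * nrm m2 g)%E.
Proof.
move=> lam0 bg; have [mg [A [A0 gA g0]]] := box_functionP bg.
rewrite nrm_weyl_coordinates// nrm_slices_fst; last exact: cmeas_partial_fourier.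
rewrite (eq_integral (fun y => (2 / `|lam|)%:E * nrm mu (fun x : RT => g (x, y)))%E); last first.
  move=> y _; rewrite /partial_fourier /= nrm_fourier_scaled//; last exact: cmeas_slice.
  rewrite (@plancherel_line _ A)//; first exact: box_slice_sqint.
  by move=> x Ax; apply: g0; left.
rewrite ge0_integralZl//; last 2 first.
- exact: measurable_nrm_slices.
- by move=> y _; exact: nrm_ge0.
rewrite -nrm_slices_snd// muleA -EFinM; congr (_%:E * _)%E.
by rewrite mulrA mulVf// mul1r.
Qed.

End weyl_kernels.

(** * Weyl kernels of square integrable functions *)

Section truncation.
Context {R : realType} d (T : measurableType d) (mu : {measure set T -> \bar R}).
Implicit Types (f : T -> R[i]) (D : set T).

Definition cut D f (x : T) : R[i] := (\1_D x)%:C * f x.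

Lemma cutT D f x : D x -> cut D f x = f x.
Proof. by move=> Dx; rewrite /cut indicE mem_set// mul1r. Qed.

Lemma cutF D f x : ~ D x -> cut D f x = 0.
Proof. by move=> Dx; rewrite /cut indicE memNset// mul0r. Qed.

Lemma sqmod_cut D f x : sqmod (cut D f x) <= sqmod (f x).
Proof.
have [Dx|Dx] := pselect (D x); first by rewrite cutT.
by rewrite cutF// sqmod0 sqmod_ge0.
Qed.

Lemma cmeas_cut D f : measurable D -> cmeas f -> cmeas (cut D f).
Proof.
move=> mD mf; apply: cmeasM mf; split => /=; last exact: measurable_cst.
exact: measurable_indic.
Qed.

Lemma sqint_le f g : cmeas f -> (forall x, sqmod (f x) <= sqmod (g x)) ->
  sqint mu g -> sqint mu f /\ (nrm mu f <= nrm mu g)%E.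
Proof.
move=> mf fg [mg goo].
have h : (nrm mu f <= nrm mu g)%E.
  apply: ge0_le_integral => //.
  - by move=> x _; rewrite lee_fin sqmod_ge0.
  - exact: measurable_sqmodE.
  - exact: measurable_sqmodE.
  - by move=> x _; rewrite lee_fin.
by split => //; split => //; exact: le_lt_trans h goo.
Qed.

Lemma cvg2_cut (D : nat -> set T) f : (forall n, measurable (D n)) ->
  (forall x, \forall n \near \oo, D n x) -> sqint mu f ->
  cvg2 mu (fun n => cut (D n) f) f.
Proof.
move=> mD cD Lf; have [mf foo] := Lf.
have mc n := cmeas_cut (mD n) mf.
have [|||||_ _] := @dominated_convergence _ _ _ mu setT measurableT
  (fun n x => (sqmod (cut (D n) f x - f x))%:E) (cst 0%E) (fun x => (sqmod (f x))%:E).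
- by move=> n; apply: measurable_sqmodE; exact: cmeasB.
- exact: measurable_cst.
- apply: aeW => x _; apply: cvg_near_cst; have := cD x; apply: filterS => n Dx.
  by rewrite cutT// subrr sqmod0.
- exact: sqint_integrable.
- apply: aeW => x n _; rewrite abse_EFin lee_fin ger0_norm ?sqmod_ge0//.
  have [Dx|Dx] := pselect (D n x); first by rewrite cutT// subrr sqmod0 sqmod_ge0.
  by rewrite cutF// sub0r sqmodN.
by rewrite integral0.
Qed.

(** Dominated convergence for truncations, which are eventually constant. *)
Lemma cvg_Cintegral_cut (D : nat -> set T) f : (forall n, measurable (D n)) ->
  (forall x, \forall n \near \oo, D n x) -> cintegrable mu f ->
  (complex.Re (Cintegral mu (cut (D n) f)) @[n --> \oo] --> complex.Re (Cintegral mu f)) /\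
  (complex.Im (Cintegral mu (cut (D n) f)) @[n --> \oo] --> complex.Im (Cintegral mu f)).
Proof.
move=> mD cD [i1 i2].
have key (p : R[i] -> R) (r : T -> R) :
    (forall n x, p (cut (D n) f x) = \1_(D n) x * r x) ->
    mu.-integrable setT (fun x => (r x)%:E) ->
    (\int[mu]_x p (cut (D n) f x) @[n --> \oo] --> \int[mu]_x r x).
  move=> pr ir.
  have /measurable_EFinP mr := measurable_int _ ir.
  have [|||||_ _ c] := @dominated_convergence _ _ _ mu setT measurableT
    (fun n x => (p (cut (D n) f x))%:E) (fun x => (r x)%:E) (fun x => `|(r x)%:E|%E).
  - move=> n; under eq_fun do rewrite pr; apply/measurable_EFinP.
    by apply: measurable_funM => //; exact: measurable_indic.
  - exact/measurable_EFinP.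
  - apply: aeW => x _; apply: cvg_near_cst; have := cD x; apply: filterS => n Dx.
    by rewrite pr indicE mem_set// mul1r.
  - exact: integrable_abse.
  - apply: aeW => x n _; rewrite !abse_EFin lee_fin pr normrM indicE.
    by apply: ler_piMl => //; case: (_ \in _); rewrite ?normr1 ?normr0.
  by apply: fine_cvg; rewrite fineK//; exact: integrable_fin_num.
split.
  apply: (key _ (fun x => complex.Re (f x))) => // n x.
  by rewrite /cut ReM /= mul0r subr0.
apply: (key _ (fun x => complex.Im (f x))) => // n x.
by rewrite /cut ImM /= mul0r addr0.
Qed.

End truncation.

Section weyl_kernel_existence.
Context {R : realType}.
Notation mu := (@lebesgue_measure R).
Notation RT := (measurableTypeR R).
Notation m2 := (mu \x mu)%E.
Implicit Types (f g h K : RT * RT -> R[i]).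

Lemma nat_ge_near (x : R) : \forall n \near \oo, x <= n%:R.
Proof. exact: nbhs_infty_ger. Qed.

Lemma cintegrable_expi (f : RT -> R[i]) s : cintegrable mu f ->
  cintegrable mu (fun x => f x * expi (2 * pi * s * x)).
Proof.
move=> if_; under eq_fun do rewrite mulrC.
apply: cintegrable_mulexpi if_.
by apply: measurable_funM; [exact: measurable_cst|exact: measurable_id].
Qed.

(** Truncation reduces this to Plancherel's identity for bounded supports, and
    Fatou's lemma passes to the limit.  The inequality is enough for the kernel to
    be a contraction, hence continuous. *)
Lemma fourier_le (f : RT -> R[i]) : sqint mu f -> cintegrable mu f ->
  (nrm mu (fourier f) <= nrm mu f)%E.
Proof.
move=> Lf if_; have [mf _] := Lf.
pose D (n : nat) : set RT := `[- (n%:R : R), n%:R]%classic.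
have mD n : measurable (D n) by exact: measurable_itv.
have DE n x : D n x = (`|x| <= n%:R) :> Prop by rewrite /D /= in_itv /= ler_norml.
have cD x : \forall n \near \oo, D n x.
  by have := nat_ge_near `|x|; apply: filterS => n; rewrite DE.
have ifs s := cintegrable_expi s if_.
have mc n := cmeas_cut (mD n) mf.
have fcut s : (sqmod (fourier (cut (D n) f) s))%:E @[n --> \oo] --> (sqmod (fourier f s))%:E.
  have [c1 c2] := cvg_Cintegral_cut mD cD (ifs s).
  have e n : fourier (cut (D n) f) s =
      Cintegral mu (cut (D n) (fun x => f x * expi (2 * pi * s * x))).
    by congr Cintegral; apply/funext => x; rewrite /cut mulrA.
  apply: cvg_EFin; first exact: nearW.
  suff : sqmod (fourier (cut (D n) f) s) @[n --> \oo] --> sqmod (fourier f s) by [].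
  under eq_fun do rewrite e sqmodE.
  by rewrite sqmodE; exact: cvgD (cvgM c1 c1) (cvgM c2 c2).
rewrite {1}/nrm (eq_integral (fun s : RT => limn_einf (fun n =>
    (sqmod (fourier (cut (D n) f) s))%:E))); last first.
  by move=> s _; apply/esym; exact: (fst (cvg_limn_einf_sup (fcut s))).
apply: le_trans (fatou _ measurableT _ _) _ => //.
- by move=> n; apply: measurable_sqmodE; exact: cmeas_fourier.
- by move=> n s _; rewrite lee_fin sqmod_ge0.
rewrite limn_einf_lim; apply: lime_le; first exact: is_cvg_einfs.
apply: nearW => n.
apply: ge_ereal_inf; exists (nrm mu (fourier (cut (D n) f))).
  by exists n => //=.
have [Lc lec] := sqint_le (mc n) (sqmod_cut (D n) f) Lf.
rewrite (plancherel_line (A := n%:R))// => x nx.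
by apply: cutF; rewrite DE; apply/negP; rewrite -ltNge.
Qed.

Lemma L1_cintegrable g : in_L1 g -> cintegrable m2 g.
Proof.
move=> [mg goo].
have mn : measurable_fun setT (fun z : RT * RT => ComplexField.Normc.normc (g z)).
  under eq_fun do rewrite normc_sqrt.
  apply: measurableT_comp; last exact: measurable_sqmod.
  by apply: continuous_measurable_fun; exact: sqrt_continuous.
apply: (@le_cintegrable _ _ _ m2 _ (fun z : RT * RT => ComplexField.Normc.normc (g z))) => //.
apply/integrableP; split; first exact/measurable_EFinP.
under eq_integral do rewrite abse_EFin ger0_norm ?normc_sqrt ?sqrtr_ge0// -normc_sqrt.
exact: goo.
Qed.

Lemma ae_slice_cintegrable g : cintegrable m2 g ->
  {ae mu, forall y, cintegrable mu (fun x : RT => g (x, y))}.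
Proof.
move=> [i1 i2].
have a1 := ae_integrable2 i1; have a2 := ae_integrable2 i2.
by apply: filterS2 a1 a2 => y h1 h2; split.
Qed.

Lemma ae_slice_sqint g : sqint m2 g ->
  {ae mu, forall y, sqint mu (fun x : RT => g (x, y))}.
Proof.
move=> [mg goo].
have ig : mu.-integrable setT (fun y => nrm mu (fun x : RT => g (x, y))).
  apply/integrableP; split; first exact: measurable_nrm_slices.
  under eq_integral do rewrite gee0_abs ?nrm_ge0//.
  by rewrite -nrm_slices_snd.
have := integrable_ae measurableT ig; apply: filterS => y /(_ I) fy.
by split; [exact: cmeas_slice|rewrite -ge0_fin_numE ?nrm_ge0].
Qed.

(** Integrability and square integrability only hold for almost every slice, so
    that the slices are compared almost everywhere. *)
Lemma kernel_integral_contraction lam g h : lam != 0 ->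
  in_L1 g -> in_L1 h -> sqint m2 g -> sqint m2 h ->
  (nrm m2 (fun z => (kernel_integral lam g z - kernel_integral lam h z)%R) <=
   `|lam|^-1%:E * nrm m2 (fun z => (g z - h z)%R))%E.
Proof.
move=> lam0 Ig Ih Lg Lh.
have [mg _] := Lg; have [mh _] := Lh.
have mP : cmeas (fun z => partial_fourier lam g z - partial_fourier lam h z).
  by apply: cmeasB; exact: cmeas_partial_fourier.
have -> : nrm m2 (fun z => kernel_integral lam g z - kernel_integral lam h z) =
    ((2^-1)%:E * nrm m2 (fun z => partial_fourier lam g z - partial_fourier lam h z)%R)%E.
  rewrite -(nrm_jacobian jacobian_weyl mP).
  by apply: eq_nrm => z; rewrite !kernel_integralE.
rewrite nrm_slices_fst// nrm_slices_snd; last exact: cmeasB.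
have -> : (`|lam|^-1%:E = 2^-1%:E * (2 / `|lam|)%:E :> \bar R)%E.
  by rewrite -EFinM mulrA mulVf// mul1r.
rewrite -muleA; apply: lee_wpmul2l => //.
have mslices := measurable_nrm_slices (cmeasB mg mh).
rewrite -ge0_integralZl//; last first.
  by move=> y _; exact: nrm_ge0.
apply: ae_ge0_le_integral => //.
- by move=> y _; exact: nrm_ge0.
- have := measurable_nrm_slices (cmeas_swap mP); exact.
- by move=> y _; rewrite mule_ge0 ?nrm_ge0// lee_fin divr_ge0.
- exact: measurable_funeM.
have := ae_slice_cintegrable (L1_cintegrable Ig).
have := ae_slice_cintegrable (L1_cintegrable Ih).
have := ae_slice_sqint Lg; have := ae_slice_sqint Lh.
move=> Ah Ag Bh Bg.
near=> y => _.
have Lhy : sqint mu (fun x : RT => h (x, y)) by near: y.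
have Lgy : sqint mu (fun x : RT => g (x, y)) by near: y.
have Ihy : cintegrable mu (fun x : RT => h (x, y)) by near: y.
have Igy : cintegrable mu (fun x : RT => g (x, y)) by near: y.
have Lgh := sqintB Lgy Lhy.
have Igh : cintegrable mu (fun x : RT => g (x, y) - h (x, y)).
  have := cintegrableD Igy (cintegrableZ (-1) Ihy).
  by rewrite (_ : (fun x => _) = (fun x : RT => g (x, y) - h (x, y)))//;
    apply/funext => x; rewrite mulN1r.
apply: (@le_trans _ _ (nrm mu (fun s : RT =>
    fourier (fun x => g (x, y) - h (x, y)) (lam / 2 * s + 0)))).
  rewrite le_eqVlt; apply/orP; left; apply/eqP; apply: eq_nrm => s.
  rewrite /partial_fourier /fourier /= -CintegralB; [|exact: cintegrable_expi..].
  by congr (sqmod (Cintegral _ _)); apply/funext => x; rewrite mulrBl.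
rewrite nrm_fourier_scaled//; last by have [] := Lgh.
by apply: lee_wpmul2l; [rewrite lee_fin divr_ge0|exact: fourier_le].
Unshelve. all: by end_near. Qed.


Lemma box_kernel_sqint lam g : lam != 0 -> box_function g ->
  sqint m2 (kernel_integral lam g).
Proof.
move=> lam0 bg; have [mg goo] := box_function_sqint bg.
split; first exact: cmeas_kernel_integral.
by rewrite nrm_kernel_integral_box//; exact: lte_mul_pinfty.
Qed.

(** Restricting f to this set bounds both its support and its values. *)
Definition level_box f (n : nat) : set (RT * RT) :=
  [set z | (`|z.1| <= n%:R) && (`|z.2| <= n%:R) && (sqmod (f z) <= n%:R ^+ 2)].

Lemma measurable_level_box f n : cmeas f -> measurable (level_box f n).
Proof.
move=> mf; rewrite (_ : level_box f n = box n%:R `&`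
    (setT `&` (fun z => sqmod (f z)) @^-1` `]-oo, n%:R ^+ 2])).
  apply: measurableI; first exact: measurable_box.
  by apply: (measurable_sqmod mf) => //; exact: measurable_itv.
apply/seteqP; split => z; rewrite /level_box /=.
  by move=> /andP[h1 h2]; split; [rewrite -inE boxE|rewrite in_itv].
by move=> [h1 [_ h2]]; move: h1 h2; rewrite -inE boxE in_itv /= => -> ->.
Qed.

Lemma level_box_near f z : \forall n \near \oo, level_box f n z.
Proof.
near=> n.
rewrite /level_box /=; apply/andP; split; first (apply/andP; split).
- by near: n; exact: nat_ge_near.
- by near: n; exact: nat_ge_near.
apply: (@le_trans _ _ (n%:R)); first by near: n; exact: nat_ge_near.
rewrite -natrX ler_nat -[leqLHS]expn1.
have n0 : (0 < n)%N by near: n; exists 1%N.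
by rewrite leq_pexp2l.
Unshelve. all: by end_near. Qed.

Definition truncate f n := cut (level_box f n) f.

Lemma truncate_box f n : cmeas f -> box_function (truncate f n).
Proof.
move=> mf; split; first exact: cmeas_cut (measurable_level_box n mf) mf.
exists n%:R; split=> z.
  have [Dz|Dz] := pselect (level_box f n z).
    by rewrite /truncate cutT//; move: Dz => /andP[].
  by rewrite /truncate cutF// sqmod0 sqr_ge0.
move=> zn; apply: cutF => /andP[/andP[z1 z2] _].
by case: zn; rewrite ltNge ?z1 ?z2.
Qed.

Lemma truncate_cvg2 f : sqint m2 f -> cvg2 m2 (truncate f) f.
Proof.
move=> Lf; have [mf _] := Lf; apply: cvg2_cut => //.
- by move=> n; exact: measurable_level_box.
- by move=> z; exact: level_box_near.
Qed.

(** The kernels of the truncations of f form a Cauchy sequence; by contraction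
    every other approximating sequence has the same limit. *)
Lemma weyl_kernel_exists lam f : lam != 0 -> in_L2 f ->
  is_weyl_kernel lam f (weyl_kernel lam f).
Proof.
move=> lam0 Lf; rewrite /weyl_kernel; apply: xgetPex.
have Lf' : sqint m2 f by exact: Lf.
have [mf _] := Lf'.
pose u n := truncate f n; pose Ku n := kernel_integral lam (u n).
have bu n : box_function (u n) by exact: truncate_box.
have Lu n := box_function_sqint (bu n).
have Iu n := box_function_L1 (bu n).
have cu : cvg2 m2 u f by exact: truncate_cvg2.
have c0 : 0 < `|lam|^-1 by rewrite invr_gt0 normr_gt0.
have LKu n : sqint m2 (Ku n) by exact: box_kernel_sqint.
have close (a b : RT * RT -> R[i]) (e : R) : cmeas a -> cmeas b ->
    (nrm m2 (fun z => (a z - f z)%R) <= (e * `|lam| / 8)%:E)%E ->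
    (nrm m2 (fun z => (b z - f z)%R) <= (e * `|lam| / 8)%:E)%E ->
    (`|lam|^-1%:E * nrm m2 (fun z => (a z - b z)%R) <= (e / 2)%:E)%E.
  move=> ma mb ha hb.
  rewrite (_ : (fun z => _) = (fun z => (a z - f z) - (b z - f z))); last first.
    by apply/funext => z; ring.
  apply: (@le_trans _ _ (`|lam|^-1%:E * (e * `|lam| / 2)%:E)%E); last first.
    rewrite -EFinM lee_fin le_eqVlt; apply/orP; left; apply/eqP; field.
    by rewrite normr_eq0.
  apply: lee_wpmul2l; first by rewrite lee_fin ltW.
  apply: le_trans (nrmB_le _ (cmeasB ma mf) (cmeasB mb mf)) _.
  apply: le_trans (leeD (lee_wpmul2l _ ha) (lee_wpmul2l _ hb)) _ => //.
  by rewrite -!EFinM -EFinD lee_fin le_eqVlt; apply/orP; left; apply/eqP; field.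
have [e e0|K LK cK] := riesz_fischer LKu.
  have e8 : 0 < e * `|lam| / 8 by rewrite divr_gt0// mulr_gt0// normr_gt0.
  have /cvg2P/(_ _ e8) [M _ MP] := cu.
  exists M => m n Mm Mn.
  apply: le_trans (kernel_integral_contraction lam0 (Iu m) (Iu n) (Lu m) (Lu n)) _.
  apply: le_trans (close _ _ e _ _ (MP m Mm) (MP n Mn)) _.
  - by have [] := Lu m.
  - by have [] := Lu n.
  - by rewrite lee_fin; lra.
exists K; split; first exact: LK.
move=> g Lg cg.
have cg' : cvg2 m2 g f by exact: cg.
suff : cvg2 m2 (fun n => kernel_integral lam (g n)) K by [].
apply/cvg2P => e e0.
have e8 : 0 < e / 4 * `|lam| / 8.
  by rewrite divr_gt0// mulr_gt0 ?normr_gt0// divr_gt0.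
have e4 : 0 < e / 4 by rewrite divr_gt0.
have /cvg2P/(_ _ e8) hu := cu.
have /cvg2P/(_ _ e8) hg := cg'.
have /cvg2P/(_ _ e4) hK := cK.
near=> n.
have [In Ln] := Lg n; have Ln' : sqint m2 (g n) by exact: Ln.
have mKg : cmeas (kernel_integral lam (g n) : RT * RT -> R[i]).
  by apply: cmeas_kernel_integral; have [] := Ln'.
have [mKu _] := LKu n; have [mK _] := LK.
rewrite (_ : (fun z => _) = (fun z =>
    (kernel_integral lam (g n) z - Ku n z) + (Ku n z - K z))); last first.
  by apply/funext => z; ring.
apply: le_trans (nrmD_le _ (cmeasB mKg mKu) (cmeasB mKu mK)) _.
have h1 : (nrm m2 (fun z => (kernel_integral lam (g n) z - Ku n z)%R) <= (e / 4 / 2)%:E)%E.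
  apply: le_trans (kernel_integral_contraction lam0 In (Iu n) Ln' (Lu n)) _.
  apply: close; [by have [] := Ln'|by have [] := Lu n| |]; by near: n.
have h2 : (nrm m2 (fun z => (Ku n z - K z)%R) <= (e / 4)%:E)%E by near: n.
apply: le_trans (leeD (lee_wpmul2l _ h1) (lee_wpmul2l _ h2)) _ => //.
by rewrite -!EFinM -EFinD lee_fin; lra.
Unshelve. all: by end_near. Qed.

(** K is the L2 limit of the kernels of box functions tending to f.  This is all
    that the computations below need to know about kernels; being a relation
    between functions rather than classes, it is stable under the explicit
    formulas for translates and dilates. *)
Definition weyl_limit (lam : R) f K := [/\ sqint m2 f, sqint m2 K &
  exists g : nat -> RT * RT -> R[i], [/\ forall n, box_function (g n),
    cvg2 m2 g f & cvg2 m2 (fun n => kernel_integral lam (g n)) K]].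

(** Since the kernel is only specified through approximating sequences, the
    truncations of f are used as one. *)
Lemma weyl_kernel_limit lam f : lam != 0 -> in_L2 f ->
  weyl_limit lam f (weyl_kernel lam f).
Proof.
move=> lam0 Lf; have Lf' : sqint m2 f by exact: Lf.
have [LK HK] := weyl_kernel_exists lam0 Lf.
have [mf _] := Lf'.
split => //; exists (truncate f); split.
- by move=> n; exact: truncate_box.
- exact: truncate_cvg2.
apply: HK; last exact: truncate_cvg2.
move=> n; have bn := truncate_box n mf.
by split; [exact: box_function_L1|exact: box_function_sqint].
Qed.

Lemma weyl_limit_nrm lam f K : lam != 0 -> weyl_limit lam f K ->
  fine (nrm m2 K) = `|lam|^-1 * fine (nrm m2 f).
Proof.
move=> lam0 [Lf LK [g [bg cg cK]]].
have Lg n := box_function_sqint (bg n).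
have c1 := cvg_nrm (fun n => box_kernel_sqint lam0 (bg n)) LK cK.
rewrite -(cvg_lim (@Rhausdorff R) c1); apply: (cvg_lim (@Rhausdorff R)).
have e n : fine (nrm m2 (kernel_integral lam (g n))) = `|lam|^-1 * fine (nrm m2 (g n)).
  by rewrite nrm_kernel_integral_box// fineM//; exact: nrm_fin.
under eq_fun do rewrite e.
by apply: cvgM; [exact: cvg_cst|exact: cvg_nrm].
Qed.

End weyl_kernel_existence.

(** * Isometry and covariance of the Weyl kernel *)

Section weyl_limit_algebra.
Context {R : realType}.
Notation mu := (@lebesgue_measure R).
Notation RT := (measurableTypeR R).
Notation m2 := (mu \x mu)%E.
Implicit Types (f g K L : RT * RT -> R[i]).

Lemma box_slice_kernel_integrable lam g (z : R * R) : box_function g ->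
  cintegrable mu (fun x : RT => g (x, z.2 - z.1) * expi (pi * lam * x * (z.1 + z.2))).
Proof.
move=> bg; have := box_slice_integrable (z.2 - z.1) (lam * (z.1 + z.2) / 2) bg.
rewrite (_ : (fun x : RT => _ * expi (2 * _ * _ * x)) =
  (fun x : RT => g (x, z.2 - z.1) * expi (pi * lam * x * (z.1 + z.2))))//.
by apply/funext => x; congr (_ * expi _); field.
Qed.

Lemma box_functionD f g : box_function f -> box_function g ->
  box_function (fun z => f z + g z).
Proof.
move=> /box_functionP[mf [A [A0 fA f0]]] /box_functionP[mg [B [B0 gB g0]]].
split; first exact: cmeasD.
exists (2 * (A + B)); split => z.
  apply: le_trans (sqmodD_le _ _) _.
  by have := fA z; have := gB z; nra.
move=> [zA|zA].
  by rewrite f0 ?g0 ?addr0//; left; lra.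
by rewrite f0 ?g0 ?addr0//; right; lra.
Qed.

Lemma box_functionZ (c : R[i]) f : box_function f -> box_function (fun z => c * f z).
Proof.
move=> /box_functionP[mf [A [A0 fA f0]]]; split; first exact: cmeasM (cmeas_cst _ c) mf.
have c0 := sqmod_ge0 c.
exists ((1 + sqmod c) * A); split => z.
  by rewrite sqmodM; have := fA z; have := sqmod_ge0 (f z); nra.
by move=> [zA|zA]; rewrite f0 ?mulr0//; [left|right]; nra.
Qed.

Lemma weyl_limitDZ (c : R[i]) f g K L : weyl_limit 1 f K -> weyl_limit 1 g L ->
  weyl_limit 1 (fun z => f z + c * g z) (fun z => K z + c * L z).
Proof.
move=> [Lf LK [fn [bf cf cK]]] [Lg LL [gn [bg cg cL]]]; split.
- by apply: sqintD => //; exact: sqintZ.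
- by apply: sqintD => //; exact: sqintZ.
exists (fun n z => fn n z + c * gn n z); split.
- by move=> n; apply: box_functionD => //; exact: box_functionZ.
- have mfn n : cmeas (fn n) by have [] := bf n.
  have mgn n : cmeas (gn n) by have [] := bg n.
  have [mf _] := Lf; have [mg _] := Lg.
  apply: cvg2D => //.
  + by move=> n; exact: cmeasM (cmeas_cst _ c) (mgn n).
  + exact: cmeasM (cmeas_cst _ c) mg.
  + exact: cvg2Z.
have mfn n : cmeas (kernel_integral 1 (fn n) : RT * RT -> R[i]).
  by apply: cmeas_kernel_integral; have [] := bf n.
have mgn n : cmeas (kernel_integral 1 (gn n) : RT * RT -> R[i]).
  by apply: cmeas_kernel_integral; have [] := bg n.
have [mK _] := LK; have [mL _] := LL.
have e : (fun n => kernel_integral 1 (fun z => fn n z + c * gn n z)) =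
    (fun n (z : RT * RT) => kernel_integral 1 (fn n) z + c * kernel_integral 1 (gn n) z).
  apply/funext => n; apply/funext => z; rewrite /kernel_integral.
  have If := box_slice_kernel_integrable 1 z (bf n).
  have Ig := box_slice_kernel_integrable 1 z (bg n).
  rewrite -CintegralZ// -CintegralD//; last exact: cintegrableZ.
  by congr Cintegral; apply/funext => x; rewrite mulrDl mulrA.
rewrite e; apply: cvg2D => //.
- by move=> n; exact: cmeasM (cmeas_cst _ c) (mgn n).
- exact: cmeasM (cmeas_cst _ c) mL.
- exact: cvg2Z.
Qed.

(** Linearity and preservation of norms give preservation of inner products, by
    polarization. *)
Lemma weyl_limit_inner f g K L : weyl_limit 1 f K -> weyl_limit 1 g L ->
  inner m2 f g = inner m2 K L.
Proof.
move=> WK WL; have [Lf LK _] := WK; have [Lg LL _] := WL.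
have key c : fine (nrm m2 (fun z => f z + c * g z)) =
    fine (nrm m2 (fun z => K z + c * L z)).
  by rewrite (weyl_limit_nrm (oner_neq0 _) (weyl_limitDZ c WK WL)) normr1 invr1 mul1r.
rewrite !polarization//; have := key 1; have := key (-1).
have := key 'i%C; have := key (- 'i%C).
have e1 (a b : RT * RT -> R[i]) : (fun z => a z + 1 * b z) = (fun z => a z + b z).
  by apply/funext => z; rewrite mul1r.
have e2 (a b : RT * RT -> R[i]) : (fun z => a z + -1 * b z) = (fun z => a z - b z).
  by apply/funext => z; rewrite mulN1r.
have e3 (a b : RT * RT -> R[i]) :
    (fun z => a z + - 'i%C * b z) = (fun z => a z - 'i%C * b z).
  by apply/funext => z; rewrite mulNr.
by rewrite !e1 !e2 !e3 => -> -> -> ->.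
Qed.

Lemma nrm_jacobian_phase d1 d2 (X : measurableType d1) (Y : measurableType d2)
    (m : {measure set X -> \bar R}) (m' : {measure set Y -> \bar R})
    (h : X -> Y) (c : R) (p : X -> R[i]) (b : R) (v : Y -> R[i]) :
  jacobian m m' h c -> 0 <= b -> (forall x, sqmod (p x) = b) -> cmeas v ->
  nrm m (fun x => p x * v (h x)) = ((b * c)%:E * nrm m' v)%E.
Proof.
move=> jh b0 pb mv; rewrite EFinM -muleA -(nrm_jacobian jh)// /nrm.
rewrite -ge0_integralZl//.
- by apply: eq_integral => x _; rewrite sqmodM pb EFinM.
- by apply: measurable_sqmodE; exact: (cmeas_jacobian jh).
- by move=> x _; rewrite lee_fin sqmod_ge0.
Qed.

Lemma sqint_jacobian_phase d1 d2 (X : measurableType d1) (Y : measurableType d2)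
    (m : {measure set X -> \bar R}) (m' : {measure set Y -> \bar R})
    (h : X -> Y) (c : R) (p : X -> R[i]) (b : R) (v : Y -> R[i]) :
  jacobian m m' h c -> 0 <= b -> cmeas p -> (forall x, sqmod (p x) = b) ->
  sqint m' v -> sqint m (fun x => p x * v (h x)).
Proof.
move=> jh b0 mp pb [mv voo]; split.
  by apply: cmeasM mp (cmeas_jacobian jh mv).
rewrite (nrm_jacobian_phase jh b0 pb mv); apply: lte_mul_pinfty => //.
by have [_ c0 _] := jh; rewrite lee_fin mulr_ge0.
Qed.

Lemma cvg2_jacobian_phase d1 d2 (X : measurableType d1) (Y : measurableType d2)
    (m : {measure set X -> \bar R}) (m' : {measure set Y -> \bar R})
    (h : X -> Y) (c : R) (p : X -> R[i]) (b : R) (u : nat -> Y -> R[i]) (v : Y -> R[i]) :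
  jacobian m m' h c -> 0 <= b -> (forall x, sqmod (p x) = b) ->
  (forall n, cmeas (u n)) -> cmeas v -> cvg2 m' u v ->
  cvg2 m (fun n x => p x * u n (h x)) (fun x => p x * v (h x)).
Proof.
move=> jh b0 pb mu_ mv /cvg2P cu; apply/cvg2P => e e0.
have [_ c0 _] := jh; have bc0 : 0 <= b * c by rewrite mulr_ge0.
have e4 : 0 < e / (b * c + 1) by rewrite divr_gt0//; lra.
have := cu _ e4; apply: filterS => n hu.
rewrite (_ : (fun x => _) = (fun x => p x * (fun y => u n y - v y) (h x))); last first.
  by apply/funext => x; rewrite mulrBr.
rewrite (nrm_jacobian_phase jh b0 pb (cmeasB (mu_ n) mv)).
apply: le_trans (lee_wpmul2l _ hu) _; first by rewrite lee_fin.
by rewrite -EFinM lee_fin mulrA ler_pdivrMr; [nra|lra].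
Qed.

Lemma jacobian_homothety (s k l : R) : 0 < s ->
  jacobian m2 m2 (fun z : RT * RT => (s * z.1 + k, s * z.2 + l) : RT * RT) (s^-1 * s^-1).
Proof.
move=> s0; have := @jacobian_triangular R s 0 k s l (lt0r_neq0 s0) (lt0r_neq0 s0).
rewrite gtr0_norm// (_ : (fun z : RT * RT => _) =
  (fun z : RT * RT => (s * z.1 + k, s * z.2 + l)))//.
by apply/funext => z; rewrite mul0r addr0.
Qed.

Lemma measurable_linear2 (a b c : R) :
  measurable_fun setT (fun z : RT * RT => pi * (a * z.1 + b * z.2 + c)).
Proof.
apply: measurable_funM; first exact: measurable_cst.
apply: measurable_funD; last exact: measurable_cst.
apply: measurable_funD; apply: measurable_funM; try exact: measurable_cst.
  exact: measurable_fst.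
exact: measurable_snd.
Qed.

(** The substitution s x - k in the defining integral turns the shift k into a
    frequency.  The frequency l / s in the first variable is the one that the
    shift of the first kernel variable by l absorbs, and be is free because y
    does not take part in the integration. *)
Lemma weyl_limit_affine (s k l be ga : R) u M : 0 < s ->
  weyl_limit (s ^- 2) u M ->
  weyl_limit 1
    (fun z => s%:C * expi (pi * (l / s * z.1 + be * z.2 + ga)) *
              u (s * z.1 - k, s * z.2 - l))
    (fun z => expi (pi * ((k / s - be) * z.1 + (k / s + be) * z.2 +
                          (ga + k * l / s ^+ 2))) *
              M (s * z.1 + l, s * z.2 + 0)).
Proof.
move=> s0 [Lu LM [g [bg cg cM]]].
have sn0 : s != 0 by rewrite gt_eqF.
pose p (z : RT * RT) : R[i] := s%:C * expi (pi * (l / s * z.1 + be * z.2 + ga)).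
pose q (z : RT * RT) : R[i] := expi (pi * ((k / s - be) * z.1 + (k / s + be) * z.2 +
  (ga + k * l / s ^+ 2))).
have mp : cmeas p.
  by apply: cmeasM (cmeas_cst _ _) _; apply: cmeas_expi; exact: measurable_linear2.
have mq : cmeas q by apply: cmeas_expi; exact: measurable_linear2.
have pb z : sqmod (p z) = s ^+ 2.
  by rewrite sqmodM sqmod_expi mulr1 sqmodE /= expr0n addr0.
have qb z : sqmod (q z) = 1 by rewrite sqmod_expi.
have s20 : 0 <= s ^+ 2 by rewrite sqr_ge0.
have j1 := @jacobian_homothety s (- k) (- l) s0.
have j2 := @jacobian_homothety s l 0 s0.
split.
- exact: (sqint_jacobian_phase j1 s20 mp pb Lu).
- exact: (sqint_jacobian_phase j2 ler01 mq qb LM).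
have mg n : cmeas (g n) by have [] := bg n.
exists (fun n z => p z * g n (s * z.1 - k, s * z.2 - l)); split.
- move=> n; have [_ [A [A0 gA g0]]] := box_functionP (bg n).
  split; first by apply: cmeasM mp (cmeas_jacobian j1 (mg n)).
  exists ((s + s^-1) * (A + `|k| + `|l|)); split.
    move=> z; rewrite sqmodM pb.
    have si0 : 0 < s^-1 by rewrite invr_gt0.
    have := gA (s * z.1 - k, s * z.2 - l).
    have k0 := normr_ge0 k; have l0 := normr_ge0 l.
    move: (sqmod _) => r rA.
    apply: (@le_trans _ _ (s ^+ 2 * A ^+ 2)); first exact: ler_wpM2l.
    rewrite -exprMn ler_sqr ?nnegrE; [|by rewrite mulr_ge0// ltW|]; last first.
      by rewrite mulr_ge0// ?addr_ge0// ltW.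
    by apply: ler_pM => //; [exact: ltW|rewrite lerDl ltW|lra].
  have far (x t : R) : `|t| <= `|k| + `|l| ->
      (s + s^-1) * (A + `|k| + `|l|) < `|x| -> A < `|s * x - t|.
    move=> tkl xA.
    have si0 : 0 < s^-1 by rewrite invr_gt0.
    have sx : (A + `|k| + `|l|) < s * `|x|.
      rewrite -ltr_pdivrMl//; apply: le_lt_trans xA.
      by apply: ler_wpM2r; [rewrite !addr_ge0|rewrite lerDr ltW].
    have : s * `|x| <= `|s * x - t| + `|t|.
      by rewrite -{1}(gtr0_norm s0) -normrM -{1}(subrK t (s * x)) ler_normD.
    by lra.
  move=> z [zA|zA]; rewrite g0 ?mulr0//; [left|right]; apply: far => //.
    by rewrite lerDl.
  by rewrite lerDr.
- exact: (cvg2_jacobian_phase j1 s20 pb mg (proj1 Lu) cg).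
have mKg n : cmeas (kernel_integral (s ^- 2) (g n) : RT * RT -> R[i]).
  exact: cmeas_kernel_integral.
have := cvg2_jacobian_phase j2 ler01 qb mKg (proj1 LM) cM.
have -> : (fun n (x : RT * RT) => q x * kernel_integral (s ^- 2) (g n) (s * x.1 + l, s * x.2 + 0)) =
    (fun n => kernel_integral 1 (fun z => p z * g n (s * z.1 - k, s * z.2 - l))); last by [].
apply/funext => n; apply/funext => z.
have jx := @jacobian_affine R s (- k) sn0.
have Ig := @box_slice_kernel_integrable (s ^- 2) (g n) (s * z.1 + l, s * z.2 + 0) (bg n).
have -> : q z * kernel_integral (s ^- 2) (g n) (s * z.1 + l, s * z.2 + 0) =
    (s^-1)%:C * (s%:C * q z * kernel_integral (s ^- 2) (g n) (s * z.1 + l, s * z.2 + 0)).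
  by rewrite !mulrA -(rmorphM (real_complex R)) mulVf// mul1r.
rewrite /kernel_integral -CintegralZ//.
have := Cintegral_jacobian jx (cintegrableZ (s%:C * q z) Ig).
rewrite gtr0_norm// => <-; congr Cintegral; apply/funext => x /=.
rewrite /p /q -!mulrA; congr (_ * _).
rewrite mulrCA [in RHS]mulrCA; congr (_ * _).
  by congr (g n (_, _)); ring.
rewrite -!expiD /=; congr expi; field.
exact: sn0.
Qed.

End weyl_limit_algebra.

(** * Fourier coefficients of a periodization *)

Section complex_periodization.
Context {R : realType}.
Notation mu := (@lebesgue_measure R).
Notation RT := (measurableTypeR R).
Notation m2 := (mu \x mu)%E.
Notation nu := (@unit_measure R).

Lemma unit_aeS (p q r : RT -> Prop) : (forall x, p x -> q x -> r x) ->
  {ae nu, forall x, p x} -> {ae nu, forall x, q x} -> {ae nu, forall x, r x}.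
Proof. by move=> pqr hp hq; apply: filterS2 hp hq. Qed.

(** The formulation with the measure [unit_measure], for which Fourier
    coefficients are integrals over the whole line. *)
Lemma ae01P (p : R -> Prop) : ae01 p <-> {ae nu, forall x, p x}.
Proof.
have mI : measurable (`[0, 1] : set RT) by exact: measurable_itv.
rewrite /ae01 /almost_everywhere; split.
  move=> [N [mN N0 sub]].
  exists (N `|` ~` `[0, 1]); split.
  - by apply: measurableU => //; exact: measurableC.
  - rewrite unit_measureE setIUl setICl setU0.
    by apply: (subset_measure0 _ mN _ N0); [exact: measurableI|move=> x []].
  - move=> x /= px; have [xI|xI] := pselect (`[0, 1]%classic x); last by right.
    by left; apply: sub => /= h; apply: px; apply: h.
move=> [N [mN N0 sub]]; exists (N `&` `[0, 1]); split => //; first exact: measurableI.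
by move=> x /= /not_implyP[xI px]; split => //; apply: sub.
Qed.

Section real_function.
Variable r : RT -> R.
Hypothesis ir : mu.-integrable setT (fun x => (r x)%:E).

Let mr : measurable_fun setT r.
Proof. by have /measurable_EFinP := measurable_int _ ir. Qed.

Let Ep u := (\esum_(m in [set: int]) (Num.max (r (u + m%:~R)) 0)%:E)%E.
Let En u := (\esum_(m in [set: int]) (Num.max (- r (u + m%:~R)) 0)%:E)%E.

Definition periodize (u : R) := sumZr (fun m => r (u + m%:~R)).

(** The series is finite almost everywhere because it is integrable on the unit
    interval; the periodic weight w is a common factor of its terms. *)
Let esum_translates (q : RT -> R) (w : RT -> R) (W : R) : measurable_fun setT q ->
  (forall x, 0 <= q x) -> measurable_fun setT w -> (forall x, 0 <= w x <= W) ->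
  (forall x (m : int), w (x + m%:~R) = w x) ->
  mu.-integrable setT (fun x => (q x)%:E) ->
  [/\ nu.-integrable setT (fun u => (fine (\esum_(m in [set: int]) (q (u + m%:~R))%:E))%:E),
      mu.-integrable setT (fun x => (w x * q x)%:E) &
   (\int[mu]_x (w x * q x)%:E =
    \int[nu]_u (w u * fine (\esum_(m in [set: int]) (q (u + m%:~R)%R)%:E))%:E)%E].
Proof.
move=> mq q0 mw w0 wper iq.
pose E (u : RT) := (\esum_(m in [set: int]) (q (u + m%:~R)%R)%:E)%E.
have E0 u : (0 <= E u)%E by apply: esum_ge0 => *; rewrite lee_fin.
have mtr (m : int) : measurable_fun setT (fun u : RT => u + m%:~R : RT).
  by have := measurable_affine 1 (m%:~R : R); under eq_fun do rewrite mul1r.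
have mE : measurable_fun setT E.
  rewrite (_ : E = fun u => (\sum_(0 <= n <oo) (q (u + (int_of_nat n)%:~R))%:E)%E); last first.
    by apply/funext => u; rewrite /E esum_int// => m; rewrite lee_fin.
  apply: ge0_emeasurable_sum => [n x _ _|n _]; first by rewrite lee_fin.
  by apply/measurable_EFinP; apply: measurableT_comp (mtr _).
have IE : nu.-integrable setT E.
  apply/integrableP; split => //.
  under eq_integral do rewrite gee0_abs//.
  rewrite -(@integral_translates _ (fun x => (q x)%:E)).
  - exact: integrable_lty.
  - exact/measurable_EFinP.
  - by move=> x; rewrite lee_fin.
have finE := integrable_ae measurableT IE.
have IfE : nu.-integrable setT (fun u => (fine (E u))%:E).
  have mf : measurable_fun setT (fun u => (fine (E u))%:E).
    by apply/measurable_EFinP; apply: measurableT_comp mE; exact: fine_measurable.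
  apply/integrableP; split => //.
  move/integrableP : IE => [_]; apply: le_lt_trans.
  apply: ge0_le_integral => //.
  - exact: measurableT_comp.
  - exact: measurableT_comp.
  - move=> x _; have := E0 x; case: (E x) => [z| |] //= z0.
    by rewrite normr0 leey.
split => //.
  apply: (integrable_mull (M := W)) => // x; have /andP[wx0 wxW] := w0 x.
  by rewrite ger0_norm.
rewrite integral_translates; last first.
- by move=> x; rewrite lee_fin mulr_ge0//; have /andP[] := w0 x.
- by apply/measurable_EFinP; exact: measurable_funM.
apply: ge0_ae_eq_integral => //.
- rewrite (_ : (fun u => _) = (fun u => (\sum_(0 <= n <oo)
    (w (u + (int_of_nat n)%:~R) * q (u + (int_of_nat n)%:~R))%:E)%E)); last first.
    apply/funext => u; rewrite (esum_int (a := fun m => (w (u + m%:~R) * q (u + m%:~R))%:E))//.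
    by move=> m; rewrite lee_fin mulr_ge0//; have /andP[] := w0 (u + m%:~R).
  apply: ge0_emeasurable_sum => [n x _ _|n _].
    by rewrite lee_fin mulr_ge0//; have /andP[] := w0 (x + (int_of_nat n)%:~R).
  apply/measurable_EFinP; apply: measurable_funM.
    exact: measurableT_comp mw (mtr _).
  exact: measurableT_comp mq (mtr _).
- apply/measurable_EFinP; apply: measurable_funM => //.
  by apply: measurableT_comp mE; exact: fine_measurable.
- move=> u _; apply: esum_ge0 => m _.
  by rewrite lee_fin mulr_ge0//; have /andP[] := w0 (u + m%:~R).
- move=> u _; rewrite lee_fin mulr_ge0//; first by have /andP[] := w0 u.
  exact: fine_ge0 (E0 u).
apply: filterS finE => u /(_ I) fu _.
rewrite EFinM fineK//.
rewrite (esum_int (a := fun m => (w (u + m%:~R) * q (u + m%:~R))%:E)); last first.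
  by move=> m; rewrite lee_fin mulr_ge0//; have /andP[] := w0 (u + m%:~R).
rewrite /E esum_int; last by move=> m; rewrite lee_fin.
rewrite -nneseriesZl; last by move=> n _; rewrite lee_fin.
by apply: eq_eseriesr => n _; rewrite wper EFinM.
Qed.

Let mpos : measurable_fun setT (fun x => Num.max (r x) 0).
Proof. by apply: measurable_maxr => //; exact: measurable_cst. Qed.

Let mneg : measurable_fun setT (fun x => Num.max (- r x) 0).
Proof.
by apply: measurable_maxr; [exact: measurableT_comp|exact: measurable_cst].
Qed.

Let ipos : mu.-integrable setT (fun x => (Num.max (r x) 0)%:E).
Proof.
apply: le_integrable ir => //; first exact/measurable_EFinP.
move=> x _; rewrite /= lee_fin ger0_norm ?le_max ?lexx ?orbT//.
by rewrite ge_max ler_norm normr_ge0.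
Qed.

Let ineg : mu.-integrable setT (fun x => (Num.max (- r x) 0)%:E).
Proof.
apply: le_integrable ir => //; first exact/measurable_EFinP.
move=> x _; rewrite /= lee_fin ger0_norm ?le_max ?lexx ?orbT//.
by rewrite ge_max normr_ge0 andbT -normrN ler_norm.
Qed.

Let pos0 x : 0 <= Num.max (r x) 0. Proof. by rewrite le_max lexx orbT. Qed.
Let neg0 x : 0 <= Num.max (- r x) 0. Proof. by rewrite le_max lexx orbT. Qed.

Let max_split (t : R) : Num.max t 0 - Num.max (- t) 0 = t.
Proof.
have [t0|t0] := leP t 0; first by rewrite max_l ?oppr_ge0// sub0r opprK.
by rewrite max_r ?subr0// oppr_le0 ltW.
Qed.

(** The positive and negative parts are treated separately, as in the definition
    of [sumZr]. *)
Let ge0_integral_periodize (w : RT -> R) (W : R) : measurable_fun setT w ->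
  (forall x, 0 <= w x <= W) -> (forall x (m : int), w (x + m%:~R) = w x) ->
  \int[mu]_x (w x * r x) = \int[nu]_u (w u * periodize u).
Proof.
move=> mw w0 wper.
have [Ip ip ep] := esum_translates mpos pos0 mw w0 wper ipos.
have [In in_ en] := esum_translates mneg neg0 mw w0 wper ineg.
have wW x : `|w x| <= W by have /andP[wx0 wxW] := w0 x; rewrite ger0_norm.
transitivity (\int[mu]_x (w x * Num.max (r x) 0 - w x * Num.max (- r x) 0)).
  by apply: eq_Rintegral => x _; rewrite -mulrBr max_split.
rewrite RintegralB// /Rintegral ep en.
transitivity (\int[nu]_x (w x * fine (Ep x) - w x * fine (En x))).
  by rewrite RintegralB//; exact: (integrable_mull mw wW).
by apply: eq_Rintegral => u _; rewrite -mulrBr.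
Qed.

Lemma integrable_periodize : nu.-integrable setT (fun u => (periodize u)%:E).
Proof.
have m1 : measurable_fun setT ((fun=> 1) : RT -> R) by exact: measurable_cst.
have b1 : forall x : RT, 0 <= (1 : R) <= 1 by rewrite ler01 lexx.
have [Ip _ _] := @esum_translates _ (fun=> 1) 1 mpos pos0 m1 b1 (fun=> fun=> erefl) ipos.
have [In _ _] := @esum_translates _ (fun=> 1) 1 mneg neg0 m1 b1 (fun=> fun=> erefl) ineg.
rewrite (_ : (fun u => _) = (fun u => (fine (Ep u))%:E - (fine (En u))%:E)%E)//.
exact: integrableB.
Qed.

(** A weight bounded by 1 is the difference of the nonnegative weights 1 + w and
    1. *)
Lemma integral_periodize (w : RT -> R) : measurable_fun setT w ->
  (forall x, `|w x| <= 1) -> (forall x (m : int), w (x + m%:~R) = w x) ->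
  \int[mu]_x (w x * r x) = \int[nu]_u (w u * periodize u).
Proof.
move=> mw w1 wper.
have IP := integrable_periodize.
have m1 : measurable_fun setT ((fun=> 1) : RT -> R) by exact: measurable_cst.
have b1 : forall x : RT, 0 <= (1 : R) <= 1 by rewrite ler01 lexx.
have e1 := @ge0_integral_periodize (fun=> 1) 1 m1 b1 (fun=> fun=> erefl).
have mw1 : measurable_fun setT (fun x => 1 + w x) by exact: measurable_funD.
have bw : forall x : RT, 0 <= 1 + w x <= 2.
  move=> x; have := w1 x; move: (w x) => t; rewrite ler_norml => /andP[h1 h2].
  by rewrite -lerBlDl sub0r h1 -lerBrDl -[leRHS]/((1 + 1) - 1) addrK h2.
have e2 := @ge0_integral_periodize (fun x => 1 + w x) 2 mw1 bw
  (fun x m => congr1 (+%R 1) (wper x m)).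
have i1 := integrable_mull mw w1 ir.
have i2 := integrable_mull mw w1 IP.
transitivity (\int[mu]_x ((1 + w x) * r x) - \int[mu]_x (1 * r x)).
  rewrite -RintegralB//.
  - by apply: eq_Rintegral => x _; ring.
  - by apply: (integrable_mull (M := 2)) => // x; have /andP[h1 h2] := bw x; rewrite ger0_norm.
  - by apply: (integrable_mull (M := 1)) => // x; rewrite normr1.
rewrite e1 e2 -RintegralB//.
- by apply: eq_Rintegral => x _; ring.
- by apply: (integrable_mull (M := 2)) => // x; have /andP[h1 h2] := bw x; rewrite ger0_norm.
- by apply: (integrable_mull (M := 1)) => // x; rewrite normr1.
Qed.

End real_function.

Lemma fourier_mode_periodic n (x : R) (m : int) : fourier_mode n (x + m%:~R) = fourier_mode n x.
Proof.
rewrite /fourier_mode mulrDr expiD.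
have -> : 2 * pi * n%:~R * m%:~R = 2 * pi * (n * m)%:~R :> R by rewrite intrM mulrA.
by rewrite expi_int mulr1.
Qed.

Lemma Cintegral_periodize (q : RT -> R[i]) n : cintegrable mu q ->
  Cintegral mu (fun x => fourier_mode n x * q x) =
  Cintegral nu (fun u => fourier_mode n u * sumZ (fun m => q (u + m%:~R))).
Proof.
move=> [i1 i2].
have [mc ms] := @fourier_mode_cmeas R n.
have bc (x : RT) : `|complex.Re (fourier_mode n x)| <= 1 by rewrite ler_norml cos_geN1 cos_le1.
have bs (x : RT) : `|complex.Im (fourier_mode n x)| <= 1 by rewrite ler_norml sin_geN1 sin_le1.
have pc (x : RT) (m : int) :
    complex.Re (fourier_mode n (x + m%:~R)) = complex.Re (fourier_mode n x).
  by rewrite fourier_mode_periodic.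
have ps (x : RT) (m : int) :
    complex.Im (fourier_mode n (x + m%:~R)) = complex.Im (fourier_mode n x).
  by rewrite fourier_mode_periodic.
have I1 := integrable_periodize i1; have I2 := integrable_periodize i2.
apply: complexP => /=.
  under eq_Rintegral do rewrite ReM.
  rewrite RintegralB//; [|exact: (integrable_mull _ bc)|exact: (integrable_mull _ bs)].
  rewrite !integral_periodize// -RintegralB//.
    exact: (integrable_mull _ bc).
  exact: (integrable_mull _ bs).
under eq_Rintegral do rewrite ImM.
rewrite RintegralD//; [|exact: (integrable_mull _ bc)|exact: (integrable_mull _ bs)].
rewrite !integral_periodize// -RintegralD//.
  exact: (integrable_mull _ bc).
exact: (integrable_mull _ bs).
Qed.

(** Passing from extended to real values by [fine] only decreases the absolute
    value of the inner integral. *)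
Lemma cintegrable_slices (H : RT * RT -> R[i]) : cintegrable m2 H ->
  cintegrable mu (fun u => Cintegral mu (fun y => H (u, y))).
Proof.
move=> [i1 i2].
have key (h : RT * RT -> R) : m2.-integrable setT (fun z => (h z)%:E) ->
    mu.-integrable setT (fun u => (\int[mu]_y h (u, y))%:E).
  move=> ih; have iF := integrable_fubini_F ih.
  have mF := measurable_int _ iF.
  apply: (le_integrable _ _ _ iF) => //.
    by apply/measurable_EFinP; apply: measurableT_comp mF; exact: fine_measurable.
  move=> u _; rewrite /Rintegral /fubini_F.
  by case: integral => [a| |] /=; rewrite ?normr0 ?leey.
by split; [exact: (key _ i1)|exact: (key _ i2)].
Qed.

Lemma Cintegral_iterated (H : RT * RT -> R[i]) : cintegrable m2 H ->
  Cintegral m2 H = Cintegral mu (fun u => Cintegral mu (fun y => H (u, y))).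
Proof.
move=> [i1 i2].
have key (h : RT * RT -> R) : m2.-integrable setT (fun z => (h z)%:E) ->
    \int[m2]_z h z = \int[mu]_u \int[mu]_y h (u, y).
  move=> ih; have iF := integrable_fubini_F ih.
  have mF := measurable_int _ iF.
  rewrite /Rintegral -integral12_prod_meas1//; congr fine.
  have fF := integrable_ae measurableT iF.
  apply: ae_eq_integral => //.
    by apply/measurable_EFinP; apply: measurableT_comp mF; exact: fine_measurable.
  by apply: filterS fF => u /(_ I) fu _; rewrite fineK.
by apply: complexP => /=; exact: key.
Qed.

Lemma ae_eq_Cintegral d (T : measurableType d) (m : {measure set T -> \bar R})
    (f g : T -> R[i]) : cintegrable m f -> cintegrable m g ->
  {ae m, forall x, f x = g x} -> Cintegral m f = Cintegral m g.
Proof.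
move=> [f1 f2] [g1 g2] fg.
have key (a b : T -> R) : m.-integrable setT (fun z => (a z)%:E) ->
    m.-integrable setT (fun z => (b z)%:E) ->
    {ae m, forall x, a x = b x} -> \int[m]_x a x = \int[m]_x b x.
  move=> ia ib ab; congr fine; apply: ae_eq_integral => //.
  - exact: measurable_int ia.
  - exact: measurable_int ib.
  - by apply: filterS ab => x -> _.
by apply: complexP => /=; apply: key => //; apply: filterS fg => x ->.
Qed.

Lemma measurable_mode (n : int) :
  measurable_fun setT (fun z : RT => 2 * pi * n%:~R * z : RT).
Proof. by apply: measurable_funM; [exact: measurable_cst|exact: measurable_id]. Qed.

Lemma measurable_mode_fst (n : int) :
  measurable_fun setT (fun z : RT * RT => 2 * pi * n%:~R * z.1 : RT).
Proof. by apply: measurable_funM; [exact: measurable_cst|exact: measurable_fst]. Qed.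

(** The modulation only depends on the first coordinate, so that it leaves the
    integral over the second one. *)
Lemma Cintegral_mode_slices (H : RT * RT -> R[i]) n : cintegrable m2 H ->
  Cintegral m2 (fun z => fourier_mode n z.1 * H z) =
  Cintegral mu (fun u => fourier_mode n u * Cintegral mu (fun y => H (u, y))).
Proof.
move=> iH; have iq := cintegrable_slices iH.
have ieH : cintegrable m2 (fun z => fourier_mode n z.1 * H z).
  exact: (cintegrable_mulexpi (measurable_mode_fst n)).
rewrite Cintegral_iterated//; apply: ae_eq_Cintegral.
- exact: (cintegrable_slices ieH).
- exact: (cintegrable_mulexpi (measurable_mode n)).
have [i1 i2] := iH.
have a1 := ae_integrable1 i1; have a2 := ae_integrable1 i2.
apply: filterS2 a1 a2 => u h1 h2 /=.
by rewrite CintegralZ.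
Qed.

(** The Fourier coefficients of the periodization of an integrable function are
    samples of its Fourier transform; by uniqueness they decide whether the
    periodization is a given constant. *)
Theorem periodization_constP (H : RT * RT -> R[i]) (c : R[i]) : cintegrable m2 H ->
  (forall n : int, Cintegral m2 (fun z => fourier_mode n z.1 * H z) = c * (n == 0)%:R) <->
  ae01 (fun u => sumZ (fun m => Cintegral mu (fun y => H (u + m%:~R, y))) = c).
Proof.
move=> iH; set q := fun u => Cintegral mu (fun y => H (u, y)).
have iq : cintegrable mu q by exact: cintegrable_slices.
set P := fun u => sumZ (fun m => q (u + m%:~R)).
have iP : cintegrable nu P.
  by have [i1 i2] := iq; split; [exact: (integrable_periodize i1)|exact: (integrable_periodize i2)].
have coef n : Cintegral m2 (fun z => fourier_mode n z.1 * H z) =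
    Cintegral nu (fun u => fourier_mode n u * P u).
  by rewrite Cintegral_mode_slices// Cintegral_periodize.
have ic : cintegrable nu (fun=> c).
  by split; exact: unit_integrable_cst.
have ico (n : int) : Cintegral nu (fun u => fourier_mode n u * c) = c * (n == 0)%:R.
  have e0 : fourier_mode 0 = (fun=> 1) :> (RT -> R[i]).
    by apply/funext => x; rewrite /fourier_mode mulr0 mul0r expi0.
  rewrite -fourier_mode_orthonormal /inner e0 -CintegralZ.
    by congr Cintegral; apply/funext => x; rewrite mulrC conjc1 mulr1.
  have := sqint_mulJ (fourier_mode_sqint (R := R) n) (fourier_mode_sqint 0).
  by rewrite e0.
have iPc : cintegrable nu (fun u => P u + (- 1) * c).
  by apply: cintegrableD => //; exact: cintegrableZ.
split => [h|/ae01P h n].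
  apply/ae01P; have : {ae nu, forall u, P u + (- 1) * c = 0}.
    apply: fourier_uniqueness iPc _ => n.
    under eq_fun do rewrite mulrDr (mulrCA _ (- 1)).
    rewrite CintegralD ?CintegralZ ?ico -?coef ?h ?mulN1r ?subrr//.
    - exact: (cintegrable_mulexpi (measurable_mode n)).
    - exact: (cintegrable_mulexpi (measurable_mode n)).
    - by apply: cintegrableZ; exact: (cintegrable_mulexpi (measurable_mode n)).
  move=> Pc; apply: (unit_aeS _ Pc Pc) => u _.
  by rewrite mulN1r => /eqP; rewrite subr_eq0 => /eqP.
rewrite coef -ico; apply: ae_eq_Cintegral.
- exact: (cintegrable_mulexpi (measurable_mode n)).
- exact: (cintegrable_mulexpi (measurable_mode n)).
by apply: (unit_aeS _ h h) => u _; rewrite -/(P u) => ->.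
Qed.

(** For H = G G^* the periodization is a sum of nonnegative terms, and it is finite
    almost everywhere, where the two kinds of sums agree. *)
Theorem periodization_normP (G : RT * RT -> R[i]) (c : R) : sqint m2 G ->
  (forall n : int, Cintegral m2 (fun z => fourier_mode n z.1 * (G z * (G z)^*)) =
    c%:C * (n == 0)%:R) <->
  ae01 (fun u => (\esum_(m in [set: int])
    \int[mu]_y (sqmod (G (u + m%:~R, y)))%:E)%E = c%:E).
Proof.
move=> LG; pose F u := (\esum_(m in [set: int]) \int[mu]_y (sqmod (G (u + m%:~R, y)))%:E)%E.
have iG := sqint_mulJ LG LG.
rewrite (periodization_constP c%:C iG) !ae01P.
have [mG fG] := LG.
have mN : measurable_fun setT (fun u : RT => \int[mu]_y (sqmod (G (u, y)))%:E)%E.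
  apply: (measurable_integral_snd mu (f := fun z => (sqmod (G z))%:E)).
  exact: measurable_sqmodE.
have N0 (u : RT) : (0 <= \int[mu]_y (sqmod (G (u, y)))%:E)%E.
  by apply: integral_ge0 => y _; rewrite lee_fin sqmod_ge0.
have mF : measurable_fun setT F.
  rewrite (_ : F = fun u => (\sum_(0 <= n <oo)
     \int[mu]_y (sqmod (G (u + (int_of_nat n)%:~R, y)))%:E)%E); last first.
    by apply/funext => u; rewrite /F esum_int.
  apply: ge0_emeasurable_sum => [n x _ _|n _] //.
  apply: measurableT_comp mN _.
  by have := measurable_affine 1 ((int_of_nat n)%:~R : R); under eq_fun do rewrite mul1r.
have F0 u : (0 <= F u)%E by apply: esum_ge0.
have finF : {ae nu, forall u, F u \is a fin_num}.
  have : nu.-integrable setT F.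
    apply/integrableP; split => //; under eq_integral do rewrite gee0_abs//.
    have <- : nrm m2 G = (\int[nu]_u F u)%E by rewrite nrm_slices_fst// integral_translates.
    exact: fG.
  by move=> /(integrable_ae measurableT) z; apply: filterS z => u; apply.
have eqF u : F u \is a fin_num ->
    sumZ (fun m => Cintegral mu (fun y => G (u + m%:~R, y) * (G (u + m%:~R, y))^*)) =
    (fine (F u))%:C.
  move=> fu.
  have fN (m : int) : (\int[mu]_y (sqmod (G (u + m%:~R, y)))%:E)%E \is a fin_num.
    rewrite ge0_fin_numE//; apply: le_lt_trans (_ : (F u < +oo)%E); last first.
      by rewrite -ge0_fin_numE.
    by apply: esum_ge; exists [set m] => //; rewrite fsbig_set1.
  have eI (m : int) : Cintegral mu (fun y => G (u + m%:~R, y) * (G (u + m%:~R, y))^*) =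
      (fine (\int[mu]_y (sqmod (G (u + m%:~R, y)))%:E)%E)%:C.
    apply: complexP => /=.
      by apply: eq_Rintegral => y _; rewrite sqmodE !ReImE; ring.
    rewrite /Rintegral (_ : (fun x => _) = (fun=> 0%E)) ?integral0//.
    by apply/funext => x; rewrite !ReImE; congr EFin; ring.
  under eq_fun do rewrite eI.
  have z0 : (\esum_(m in [set: int]) (Num.max (- 0 : R) 0)%:E)%E = 0%E.
    by rewrite esum1// => m _; rewrite oppr0 maxxx.
  have z1 : (\esum_(m in [set: int]) (Num.max (0 : R) 0)%:E)%E = 0%E.
    by rewrite esum1// => m _; rewrite maxxx.
  apply: complexP; rewrite /= /sumZr ?z0 ?z1 ?subrr//.
  rewrite [X in _ - fine X]esum1 ?subr0; last first.
    by move=> m _; rewrite max_r// oppr_le0 fine_ge0.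
  congr fine; apply: eq_esum => m _.
  by rewrite max_l ?fine_ge0// fineK.
split => h; apply: unit_aeS h finF => u hu fu.
  by rewrite -/(F u) -(fineK fu); congr EFin; move: hu; rewrite eqF// => -[].
by rewrite eqF//; rewrite -/(F u) in hu; rewrite hu.
Qed.

End complex_periodization.

(** * Inner products of twisted wavelets *)

Section wavelet_inner_products.
Context {R : realType}.
Notation mu := (@lebesgue_measure R).
Notation RT := (measurableTypeR R).
Notation m2 := (mu \x mu)%E.

Lemma complex_conjM (z w : R[i]) : ((z * w)^*)%C = (z^*)%C * (w^*)%C.
Proof. by apply: complexP; rewrite !ReImE; ring. Qed.

Lemma real_scale_inv (c : R) (z w : R[i]) : c != 0 -> w = (c^-1)%:C * z -> z = c%:C * w.
Proof.
by move=> c0 ->; rewrite mulrA -(rmorphM (real_complex R)) mulfV// mul1r.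
Qed.

Lemma real_complex_eq0 (c : R) : (c%:C == 0 :> R[i]) = (c == 0).
Proof. by rewrite eq_complex /= eqxx andbT. Qed.

Lemma exp2_gt0 (j : int) : 0 < (2 : R) ^ j.
Proof. exact: exprz_gt0. Qed.

Lemma exp2_neq0 (j : int) : (2 : R) ^ j != 0.
Proof. exact: lt0r_neq0 (exp2_gt0 j). Qed.

Lemma exp2_even (j : int) : (2 : R) ^ (- (2 * j)) = (2 ^ j) ^- 2.
Proof. by rewrite -invr_expz mulrC -exprz_exp. Qed.

(** Passing from a coarse to a finer scale multiplies frequencies by an integer;
    this is where the order of the scales matters. *)
Lemma exp2_ratio (j1 j2 : int) : j1 < j2 -> exists n : int, (2 : R) ^ j2 = 2 ^ j1 * n%:~R.
Proof.
move=> j12; exists ((2 ^ `|(j2 - j1)%R|)%N : int).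
have e : j2 = j1 + `|(j2 - j1)%R|%N.
  by rewrite gez0_abs ?subr_ge0 ?ltW// addrCA subrr addr0.
by rewrite {1}e expfzDr// -exprnP -natrX.
Qed.

Section fixed_window.
Variable phi : RT * RT -> R[i].
Hypothesis phiL2 : sqint m2 phi.

Notation M j := (weyl_kernel (2 ^ (- (2 * j))) phi : RT * RT -> R[i]).

(** With lam = s^(-2), s = 2^j, the twist has exactly the frequency in x that the
    kernel absorbs, and its frequency in y cancels the contribution of the second
    kernel variable to the phase. *)
Lemma wavelet_limit (k l j : int) : weyl_limit 1 (twisted_wavelet phi (k, l, j))
  (fun z => expi (pi * (k%:~R * l%:~R / (2 ^ j) ^+ 2)) *
    (expi (2 * pi * (k%:~R / 2 ^ j) * z.1) *
     M j (2 ^ j * z.1 + l%:~R, 2 ^ j * z.2))).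
Proof.
have s0 := exp2_gt0 j; have sn0 := exp2_neq0 j.
have Mj := @weyl_kernel_limit R (2 ^ (- (2 * j))) phi (exp2_neq0 _) phiL2.
rewrite [X in weyl_limit X](exp2_even j) in Mj.
have := weyl_limit_affine k%:~R l%:~R (- (k%:~R / 2 ^ j)) 0 s0 Mj.
congr weyl_limit; apply/funext => z.
  rewrite /twisted_wavelet /dilation /twisted_translation -mulrA exp2_even /=.
  congr (_ * (expi _ * _)); field; exact: sn0.
rewrite addr0 mulrA -expiD; congr (expi _ * _); field; exact: sn0.
Qed.

Lemma wavelet_in_L2 i : in_L2 (twisted_wavelet phi i).
Proof. by case: i => -[k l] j; have [+ _ _] := wavelet_limit k l j; apply. Qed.

Lemma dot_sym i i' : dot (twisted_wavelet phi i) (twisted_wavelet phi i') =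
  (dot (twisted_wavelet phi i') (twisted_wavelet phi i))^*%C.
Proof.
have := @inner_conj _ _ _ m2 _ _ (wavelet_in_L2 i') (wavelet_in_L2 i).
by apply.
Qed.

Lemma sqint_scaled_kernel (j : int) (l : R) :
  sqint m2 (fun z => M j (2 ^ j * z.1 + l, 2 ^ j * z.2)).
Proof.
have [_ LM _] := @weyl_kernel_limit R (2 ^ (- (2 * j))) phi (exp2_neq0 _) phiL2.
have := sqint_jacobian (jacobian_homothety l 0 (exp2_gt0 j)) LM.
by congr (sqint m2); apply/funext => z; rewrite addr0.
Qed.

Lemma cintegrable_scaled_kernels (j1 j2 : int) (l1 l2 t : R) : cintegrable m2 (fun z =>
  expi (2 * pi * t * z.1) * (M j1 (2 ^ j1 * z.1 + l1, 2 ^ j1 * z.2) *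
     (M j2 (2 ^ j2 * z.1 + l2, 2 ^ j2 * z.2))^*)).
Proof.
apply: cintegrable_mulexpi.
  by apply: measurable_funM; [exact: measurable_cst|exact: measurable_fst].
exact: (sqint_mulJ (sqint_scaled_kernel j1 l1) (sqint_scaled_kernel j2 l2)).
Qed.

Lemma dot_wavelets (k1 l1 j1 k2 l2 j2 : int) :
  dot (twisted_wavelet phi (k1, l1, j1)) (twisted_wavelet phi (k2, l2, j2)) =
  expi (pi * (k1%:~R * l1%:~R / (2 ^ j1) ^+ 2 - k2%:~R * l2%:~R / (2 ^ j2) ^+ 2)) *
  Cintegral m2 (fun z => expi (2 * pi * (k1%:~R / 2 ^ j1 - k2%:~R / 2 ^ j2) * z.1) *
    (M j1 (2 ^ j1 * z.1 + l1%:~R, 2 ^ j1 * z.2) *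
     (M j2 (2 ^ j2 * z.1 + l2%:~R, 2 ^ j2 * z.2))^*)).
Proof.
rewrite -CintegralZ; last exact: cintegrable_scaled_kernels.
have -> : dot (twisted_wavelet phi (k1, l1, j1)) (twisted_wavelet phi (k2, l2, j2)) =
  inner m2 (twisted_wavelet phi (k1, l1, j1)) (twisted_wavelet phi (k2, l2, j2)) by [].
rewrite (weyl_limit_inner (wavelet_limit k1 l1 j1) (wavelet_limit k2 l2 j2)).
rewrite /inner; congr Cintegral; apply/funext => z.
rewrite !complex_conjM -!expiN mulrBr mulrBr mulrBl !expiD.
rewrite -!mulrA; congr (_ * _); rewrite [RHS]mulrCA; congr (_ * _).
ring.
Qed.

(** The substitution xi = 2^j2 u turns the frequency k1 / 2^j1 - k2 / 2^j2 into an
    integer. *)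
Lemma dot_wavelets_cross (k1 l1 j1 k2 l2 j2 n : int) : 2 ^ j2 = 2 ^ j1 * n%:~R :> R ->
  dot (twisted_wavelet phi (k1, l1, j1)) (twisted_wavelet phi (k2, l2, j2)) =
  expi (pi * (k1%:~R * l1%:~R / (2 ^ j1) ^+ 2 - k2%:~R * l2%:~R / (2 ^ j2) ^+ 2)) *
  ((2 ^ j2)%:C * Cintegral m2 (fun z => fourier_mode (k1 * n - k2) z.1 *
    (M j1 (2 ^ (j1 + j2) * z.1 + l1%:~R, 2 ^ j1 * z.2) *
     (M j2 (2 ^ (2 * j2) * z.1 + l2%:~R, 2 ^ j2 * z.2))^*))).
Proof.
move=> jn; rewrite dot_wavelets; congr (_ * _).
have s0 := exp2_gt0 j2; have sn0 := exp2_neq0 j2.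
have jh := @jacobian_triangular R (2 ^ j2) 0 0 1 0 sn0 (oner_neq0 _).
have := Cintegral_jacobian jh (cintegrable_scaled_kernels j1 j2 l1%:~R l2%:~R
  (k1%:~R / 2 ^ j1 - k2%:~R / 2 ^ j2)).
rewrite gtr0_norm// normr1 invr1 mulr1 => /(real_scale_inv sn0) ->.
congr (_ * _); congr Cintegral; apply/funext => z /=.
rewrite /fourier_mode mul0r !addr0 mul1r.
congr (expi _ * (M j1 (_, _) * (M j2 (_, _))^*)).
- rewrite jn intrB intrM; field.
  by have := sn0; rewrite jn mulf_eq0 negb_or => /andP[-> ->].
- by rewrite expfzDr// mulrA.
- by rewrite [2 * j2]mulrC -exprz_exp mulrA.
Qed.

(** Shifting xi by the integer l1 does not change the Fourier mode. *)
Lemma dot_wavelets_unit_scale (k1 l1 k2 l2 : int) :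
  dot (twisted_wavelet phi (k1, l1, 0)) (twisted_wavelet phi (k2, l2, 0)) =
  expi (pi * (k1%:~R * l1%:~R - k2%:~R * l2%:~R)) *
  Cintegral m2 (fun z => fourier_mode (k1 - k2) z.1 *
    (weyl_kernel 1 phi z * (weyl_kernel 1 phi (z.1 + (l2 - l1)%:~R, z.2))^*)).
Proof.
rewrite dot_wavelets !expr0z !expr1n !divr1; congr (_ * _).
have jh := @jacobian_triangular R 1 0 (- l1%:~R) 1 0 (oner_neq0 _) (oner_neq0 _).
have := Cintegral_jacobian jh (cintegrable_scaled_kernels 0 0 l1%:~R l2%:~R (k1%:~R - k2%:~R)).
rewrite !normr1 invr1 mulr1 mul1r !expr0z => <-.
congr Cintegral; apply/funext => z /=.
rewrite -(fourier_mode_periodic (k1 - k2) z.1 (- l1)) /fourier_mode.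
rewrite !mul1r mul0r !addr0 !intrB mulrNz.
rewrite subrK (surjective_pairing z) /=.
congr (_ * (_ * (weyl_kernel 1 phi (_, _))^*)); ring.
Qed.

(** At a common scale 2^j the dilation drops out.  The kernel of parameter 1
    absorbs the frequency l, the twist only has lam l; the modulated window u l
    makes up for the difference. *)
Section common_scale.
Variable j : int.
Let lam : R := 2 ^ (- (2 * j)).
Let u l : RT * RT -> R[i] := modulation ((lam - 1) / 2 * l%:~R) 0 phi.
Notation U l := (weyl_kernel 1 (u l) : RT * RT -> R[i]).

Let u_sqint l : sqint m2 (u l).
Proof.
have mp : cmeas (fun z : RT * RT => expi (2 * pi * ((lam - 1) / 2 * l%:~R * z.1 + 0 * z.2)) : R[i]).
  apply: cmeas_expi.
  have := measurable_linear2 (2 * ((lam - 1) / 2 * l%:~R)) 0 0.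
  congr (measurable_fun setT); apply/funext => z; ring.
have := sqint_jacobian_phase (jacobian_homothety 0 0 ltr01) ler01 mp
  (fun=> sqmod_expi _) phiL2.
congr (sqint m2); apply/funext => z.
by rewrite /u /modulation !mul1r !addr0 -surjective_pairing.
Qed.

Lemma twisted_translation_limit (k l : int) : weyl_limit 1 (twisted_translation lam k l phi)
  (fun z => expi (pi * (lam * k%:~R * l%:~R)) *
    (expi (pi * k%:~R * ((1 + lam) * z.1 + (1 - lam) * z.2)) * U l (z.1 + l%:~R, z.2))).
Proof.
have Ul := @weyl_kernel_limit R 1 (u l) (oner_neq0 _) (u_sqint l).
have e1 : 1 = (1 : R) ^- 2 by rewrite expr1n invr1.
rewrite [X in weyl_limit X _ _]e1 in Ul.
have := weyl_limit_affine k%:~R l%:~R (- (lam * k%:~R)) ((lam - 1) * l%:~R * k%:~R) ltr01 Ul.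
congr weyl_limit; apply/funext => z.
  rewrite /twisted_translation /u /modulation mul1r !mul1r mulrA -expiD.
  by congr (expi _ * _); rewrite /=; field.
by rewrite addr0 mulrA -expiD !mul1r; congr (expi _ * _); field.
Qed.

(** The square of the factor 2^j is the Jacobian determinant of the dilation. *)
Lemma dot_dilation f g : sqint m2 f -> sqint m2 g ->
  dot (dilation j f) (dilation j g) = dot f g.
Proof.
move=> Lf Lg; have s0 := exp2_neq0 j.
have jh := jacobian_homothety 0 0 (exp2_gt0 j).
have i1 := cintegrable_jacobian jh (sqint_mulJ Lf Lg).
have -> : dot f g = inner m2 f g by [].
have -> : dot (dilation j f) (dilation j g) = inner m2 (dilation j f) (dilation j g) by [].
rewrite /inner; transitivity (Cintegral m2 (fun z : RT * RT => (2 ^ j * 2 ^ j)%:C *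
    (f (2 ^ j * z.1 + 0, 2 ^ j * z.2 + 0) * (g (2 ^ j * z.1 + 0, 2 ^ j * z.2 + 0))^*%C))).
  congr Cintegral; apply/funext => z; rewrite /dilation complex_conjM conjc_real !addr0.
  by rewrite (rmorphM (real_complex R)) mulrACA.
rewrite CintegralZ//; symmetry; apply: real_scale_inv; first exact: mulf_neq0.
rewrite invfM; exact: (inner_jacobian jh Lf Lg).
Qed.

Hypothesis j0 : j != 0.

Let lam_gt0 : 0 < lam. Proof. exact: exp2_gt0. Qed.

Let lam_neq1 : 1 - lam != 0.
Proof.
rewrite subr_eq0 eq_sym -(expr0z (2 : R)) /lam.
have n21 : (2 : R) != 1 by rewrite gt_eqF// ltr1n.
apply: contra j0 => /eqP /(ieexprIz (ltr0Sn R 1) n21) /eqP.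
by rewrite oppr_eq0 mulf_eq0.
Qed.

Let lam_sqr : (1 + lam) * (1 - lam) = 1 - 2 ^ (- (4 * j)).
Proof.
have -> : (2 : R) ^ (- (4 * j)) = lam * lam by rewrite /lam -expfzDr//; congr (2 ^ _); ring.
ring.
Qed.

Let mode_linear (t : R) :
  measurable_fun setT (fun z : RT * RT => pi * t * ((1 + lam) * z.1 + (1 - lam) * z.2)).
Proof.
have := measurable_linear2 (t * (1 + lam)) (t * (1 - lam)) 0.
by congr (measurable_fun setT); apply/funext => z; ring.
Qed.

Let U_shift_sqint l : sqint m2 (fun z => U l (z.1 + l%:~R, z.2)).
Proof.
have [_ LU _] := @weyl_kernel_limit R 1 (u l) (oner_neq0 _) (u_sqint l).
have := sqint_jacobian (jacobian_homothety l%:~R 0 ltr01) LU.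
by congr (sqint m2); apply/funext => z; rewrite addr0 !mul1r.
Qed.

(** The substitution xi = 2 (u - y) / (1 + lam), eta = 2 y / (1 - lam) satisfies
    (1 + lam) xi + (1 - lam) eta = 2 u, so that k1 - k2 becomes the index of a
    Fourier mode in u; its Jacobian is 4 / |1 - lam^2|. *)
Lemma dot_wavelets_common_scale (k1 l1 k2 l2 : int) :
  dot (twisted_wavelet phi (k1, l1, j)) (twisted_wavelet phi (k2, l2, j)) =
  expi (pi * (lam * k1%:~R * l1%:~R - lam * k2%:~R * l2%:~R)) *
  ((`|1 - (2 : R) ^ (- (4 * j))| / 4)^-1%:C *
   Cintegral m2 (fun z => fourier_mode (k1 - k2) z.1 *
    (S_fun phi j l1 z.1 0 z.2 * (S_fun phi j l2 z.1 0 z.2)^*))).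
Proof.
have T1 := twisted_translation_limit k1 l1; have T2 := twisted_translation_limit k2 l2.
have -> : dot (twisted_wavelet phi (k1, l1, j)) (twisted_wavelet phi (k2, l2, j)) =
    dot (dilation j (twisted_translation lam k1 l1 phi))
        (dilation j (twisted_translation lam k2 l2 phi)) by [].
rewrite dot_dilation; [|by have [] := T1|by have [] := T2].
rewrite [LHS](weyl_limit_inner T1 T2) /inner.
pose F (z : RT * RT) := expi (pi * (k1%:~R - k2%:~R) * ((1 + lam) * z.1 + (1 - lam) * z.2)) *
  (U l1 (z.1 + l1%:~R, z.2) * (U l2 (z.1 + l2%:~R, z.2))^*%C).
have iF : cintegrable m2 F.
  exact: (cintegrable_mulexpi (mode_linear _) (sqint_mulJ (U_shift_sqint l1) (U_shift_sqint l2))).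
transitivity (expi (pi * (lam * k1%:~R * l1%:~R - lam * k2%:~R * l2%:~R)) * Cintegral m2 F).
  rewrite -CintegralZ//; congr Cintegral; apply/funext => z.
  rewrite /F !complex_conjM -!expiN mulrBr expiD.
  have -> (t : R) : pi * (k1%:~R - k2%:~R) * t = pi * k1%:~R * t + - (pi * k2%:~R * t) by ring.
  rewrite expiD; ring.
congr (_ * _).
have l1' : 1 + lam != 0 by rewrite lt0r_neq0// ltr_wpDr// ltW.
have a0 : 2 / (1 + lam) != 0 by rewrite mulf_neq0 ?invr_neq0.
have c0 : 2 / (1 - lam) != 0 by rewrite mulf_neq0 ?invr_neq0.
have jh := @jacobian_triangular R (2 / (1 + lam)) (- (2 / (1 + lam))) 0 (2 / (1 - lam)) 0 a0 c0.
have D : `|2 / (1 + lam)|^-1 * `|2 / (1 - lam)|^-1 = `|1 - (2 : R) ^ (- (4 * j))| / 4.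
  rewrite -!normfV -normrM -lam_sqr; transitivity (`|(1 + lam) * (1 - lam) / 4|).
    by congr (`|_|); field; apply/andP.
  by rewrite normrM normfV [`|4|]ger0_norm ?ler0n.
rewrite D in jh; have := Cintegral_jacobian jh iF.
have D0 : (`|1 - (2 : R) ^ (- (4 * j))| / 4)^-1 != 0.
  rewrite invr_neq0// mulf_neq0 ?invr_neq0// normr_eq0 -lam_sqr mulf_neq0//.
rewrite -{1}[_ / 4]invrK => /(real_scale_inv D0) ->; congr (_ * _).
congr Cintegral; apply/funext => z /=.
rewrite /F /S_fun /fourier_mode !addr0; congr (expi _ * (U l1 (_, _) * (U l2 (_, _))^*)).
- by rewrite intrB /=; field; exact/andP.
- by rewrite /= -/lam; congr (_ + _); field.
- by rewrite /= -/lam; field.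
- by rewrite /= -/lam; congr (_ + _); field.
- by rewrite /= -/lam; field.
Qed.

Lemma S_fun_sqint (l : int) : sqint m2 (fun z => S_fun phi j l z.1 0 z.2).
Proof.
have [_ LU _] := @weyl_kernel_limit R 1 (u l) (oner_neq0 _) (u_sqint l).
have a0 : 2 / (1 + lam) != 0 by rewrite mulf_neq0 ?invr_neq0// lt0r_neq0// ltr_wpDr// ltW.
have c0 : 2 / (1 - lam) != 0 by rewrite mulf_neq0 ?invr_neq0.
have jh := @jacobian_triangular R (2 / (1 + lam)) (- (2 / (1 + lam))) l%:~R (2 / (1 - lam)) 0 a0 c0.
have := sqint_jacobian jh LU; congr (sqint m2); apply/funext => z.
rewrite /S_fun -/lam !addr0; congr (U l (_ + _, _)).
  by rewrite mulrBr mulrBl mulNr ![_ / (1 + lam) * _]mulrAC.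
by rewrite mulrAC.
Qed.

Lemma S_fun_translate (l m : int) (x y : R) : S_fun phi j l (x + m%:~R) 0 y = S_fun phi j l x m y.
Proof. by rewrite /S_fun addr0. Qed.

Lemma Q_fun_eq0P (l1 l2 : int) : ae01 (fun xi : R => Q_fun phi j l1 l2 xi = 0) <->
  (forall n : int, Cintegral m2 (fun z => fourier_mode n z.1 *
    (S_fun phi j l1 z.1 0 z.2 * (S_fun phi j l2 z.1 0 z.2)^*)) = 0).
Proof.
have e (xi : R) : Q_fun phi j l1 l2 xi = sumZ (fun m : int => Cintegral mu (fun y =>
    S_fun phi j l1 (xi + m%:~R) 0 y * (S_fun phi j l2 (xi + m%:~R) 0 y)^*)).
  by congr sumZ; apply/funext => m; congr Cintegral; apply/funext => y; rewrite !S_fun_translate.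
under eq_fun do rewrite e.
apply: iff_trans (iff_sym (periodization_constP 0 (sqint_mulJ (S_fun_sqint l1) (S_fun_sqint l2)))) _.
by split=> h n; have := h n; rewrite mul0r.
Qed.

Lemma R_fun_constP (l : int) (c : R) : ae01 (fun xi : R => R_fun phi j l xi = c%:E) <->
  (forall n : int, Cintegral m2 (fun z => fourier_mode n z.1 *
    (S_fun phi j l z.1 0 z.2 * (S_fun phi j l z.1 0 z.2)^*)) = c%:C * (n == 0)%:R).
Proof.
apply: iff_trans (iff_sym (periodization_normP c (S_fun_sqint l))).
have e (xi : R) : R_fun phi j l xi = (\esum_(m in [set: int])
    \int[mu]_y (sqmod (S_fun phi j l (xi + m%:~R)%R 0 y))%:E)%E.
  by apply: eq_esum => m _; apply: eq_integral => y _; rewrite S_fun_translate.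
by under eq_fun do rewrite e.
Qed.

Lemma R_fun_target_neq0 : `|1 - (2 : R) ^ (- (4 * j))| / 4 != 0.
Proof.
have l1 : 1 + lam != 0 by rewrite lt0r_neq0// ltr_wpDr// ltW.
by rewrite mulf_neq0 ?invr_neq0// normr_eq0 -lam_sqr mulf_neq0.
Qed.

End common_scale.

Let K : RT * RT -> R[i] := weyl_kernel 1 phi.

Let K_sqint : sqint m2 K.
Proof. by have [_ LK _] := @weyl_kernel_limit R 1 phi (oner_neq0 _) phiL2. Qed.

Lemma kernel_norm_conditionP : ae01 (fun xi : R =>
    (\esum_(m in [set: int]) \int[mu]_eta (sqmod (K (xi + m%:~R, eta)))%:E)%E = 1%E) <->
  (forall n : int, Cintegral m2 (fun z => fourier_mode n z.1 * (K z * (K z)^*)) =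
    (n == 0)%:R).
Proof.
apply: iff_trans (iff_sym (periodization_normP 1 K_sqint)) _.
by split=> h n; have := h n; rewrite mul1r.
Qed.

Lemma kernel_shift_conditionP (l : int) : ae01 (fun xi : R =>
    sumZ (fun m : int => Cintegral mu (fun eta : R =>
      K (xi + m%:~R, eta) * (K (xi + m%:~R + l%:~R, eta))^*)) = 0) <->
  (forall n : int, Cintegral m2 (fun z => fourier_mode n z.1 *
    (K z * (K (z.1 + l%:~R, z.2))^*)) = 0).
Proof.
have LKl : sqint m2 (fun z => K (z.1 + l%:~R, z.2)).
  have := sqint_jacobian (jacobian_homothety l%:~R 0 ltr01) K_sqint.
  by congr (sqint m2); apply/funext => z; rewrite addr0 !mul1r.
apply: iff_trans (iff_sym (periodization_constP 0 (sqint_mulJ K_sqint LKl))) _.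
by split=> h n; have := h n; rewrite mul0r.
Qed.

Lemma P_fun_eq0P (j1 j2 l1 l2 : int) : ae01 (fun xi : R => P_fun phi j1 j2 l1 l2 xi = 0) <->
  (forall n : int, Cintegral m2 (fun z => fourier_mode n z.1 *
    (M j1 (2 ^ (j1 + j2) * z.1 + l1%:~R, 2 ^ j1 * z.2) *
     (M j2 (2 ^ (2 * j2) * z.1 + l2%:~R, 2 ^ j2 * z.2))^*)) = 0).
Proof.
have jh := @jacobian_triangular R (2 ^ j2) 0 0 1 0 (exp2_neq0 j2) (oner_neq0 _).
have L1 : sqint m2 (fun z => M j1 (2 ^ (j1 + j2) * z.1 + l1%:~R, 2 ^ j1 * z.2)).
  have := sqint_jacobian jh (sqint_scaled_kernel j1 l1%:~R).
  congr (sqint m2); apply/funext => z /=.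
  by rewrite mul0r !addr0 mul1r mulrA expfzDr.
have L2 : sqint m2 (fun z => M j2 (2 ^ (2 * j2) * z.1 + l2%:~R, 2 ^ j2 * z.2)).
  have := sqint_jacobian jh (sqint_scaled_kernel j2 l2%:~R).
  congr (sqint m2); apply/funext => z /=.
  by rewrite mul0r !addr0 mul1r mulrA [2 * j2]mulrC -exprz_exp.
apply: iff_trans (iff_sym (periodization_constP 0 (sqint_mulJ L1 L2))) _.
by split=> h n; have := h n; rewrite mul0r.
Qed.

End fixed_window.
End wavelet_inner_products.

Theorem theorem3p3 (R : realType) (phi : R * R -> R[i]) (phiL2 : in_L2 phi) :
  orthonormal_family (twisted_wavelet phi) <->
  [/\ ae01 (fun xi : R =>
        (\esum_(m in [set: int]) \int[@lebesgue_measure R]_eta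
           (sqmod (weyl_kernel 1 phi (xi + m%:~R, eta)))%:E)%E = 1%E),
      (forall l : int, l != 0 -> ae01 (fun xi : R =>
        sumZ (fun m : int => Cintegral (@lebesgue_measure R) (fun eta : R =>
          weyl_kernel 1 phi (xi + m%:~R, eta) *
          (weyl_kernel 1 phi (xi + m%:~R + l%:~R, eta))^*)) = 0)),
      (forall j1 j2 l1 l2 : int, j1 < j2 -> ae01 (fun xi : R =>
        P_fun phi j1 j2 l1 l2 xi = 0)),
      (forall j l1 l2 : int, j != 0 -> l1 != l2 -> ae01 (fun xi : R =>
        Q_fun phi j l1 l2 xi = 0)) &
      (forall j l : int, j != 0 -> ae01 (fun xi : R =>
        R_fun phi j l xi = (`|1 - (2 : R) ^ (- (4 * j))| / 4)%:E))].
Proof.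
split=> [[_ h]|[/(kernel_norm_conditionP phiL2) h1 h2 h3 h4 h5]].
- split.
  + apply/(kernel_norm_conditionP phiL2) => n.
    have := h (n, 0, 0) (0, 0, 0); rewrite dot_wavelets_unit_scale//.
    rewrite !mulr0 subrr mulr0 expi0 mul1r subr0 xpair_eqE xpair_eqE !eqxx !andbT => <-.
    by congr Cintegral; apply/funext => z; rewrite !subrr addr0 -surjective_pairing.
  + move=> l l0; apply/(kernel_shift_conditionP phiL2) => n.
    have := h (n, 0, 0) (0, l, 0); rewrite dot_wavelets_unit_scale//.
    rewrite !mulr0 mul0r subrr mulr0 expi0 mul1r !subr0 xpair_eqE xpair_eqE.
    by rewrite [0 == l]eq_sym (negPf l0) andbF.
  + move=> j1 j2 l1 l2 j12; apply/(P_fun_eq0P phiL2) => n.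
    have [N jN] := @exp2_ratio R _ _ j12.
    (* With k1 = 0 the frequency k1 N - k2 takes every integer value. *)
    have := h (0, l1, j1) (- n, l2, j2); rewrite (dot_wavelets_cross phiL2 _ _ _ _ jN).
    have -> : 0 * N - - n = n by rewrite mul0r sub0r opprK.
    rewrite xpair_eqE (lt_eqF j12) andbF => /eqP.
    by rewrite mulf_eq0 (negPf (expi_neq0 _)) mulf_eq0 real_complex_eq0 (negPf (exp2_neq0 _)) => /eqP.
  + move=> j l1 l2 j0 l12; apply/(Q_fun_eq0P phiL2) => // n.
    have := h (n, l1, j) (0, l2, j); rewrite (dot_wavelets_common_scale phiL2)//.
    rewrite !xpair_eqE (negPf l12) andbF subr0 => /eqP.
    rewrite mulf_eq0 (negPf (expi_neq0 _)) mulf_eq0 real_complex_eq0 invr_eq0.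
    by rewrite (negPf (R_fun_target_neq0 j0)) => /eqP.
  + move=> j l j0; apply/(R_fun_constP phiL2) => // n.
    have := h (n, l, j) (0, l, j); rewrite (dot_wavelets_common_scale phiL2)//.
    rewrite !xpair_eqE !eqxx !andbT subr0 mulrCA => /esym/(real_scale_inv _) e.
    rewrite -e ?R_fun_target_neq0//.
    (* The phase equals 1 for n = 0; for n <> 0 the integral vanishes. *)
    have [n0|n0] := eqVneq n 0.
      by rewrite n0 mulr0 !mul0r subrr mulr0 expi0 mul1r.
    have /eqP := e (R_fun_target_neq0 j0); rewrite (negPf n0) [_%:C * _]mulr0 mulf_eq0.
    by rewrite (negPf (expi_neq0 _)) => /eqP ->; rewrite mulr0.
split=> [i|]; first exact: wavelet_in_L2.
have lt (k1 l1 j1 k2 l2 j2 : int) : j1 < j2 ->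
    dot (twisted_wavelet phi (k1, l1, j1)) (twisted_wavelet phi (k2, l2, j2)) = 0.
  move=> j12; have [N jN] := @exp2_ratio R _ _ j12.
  rewrite (dot_wavelets_cross phiL2 _ _ _ _ jN).
  by have /(P_fun_eq0P phiL2) -> := h3 _ _ l1 l2 j12; rewrite !mulr0.
move=> [[k1 l1] j1] [[k2 l2] j2].
have [j12|j21|<-] := ltgtP j1 j2.
- by rewrite lt// !xpair_eqE (lt_eqF j12) andbF.
- by rewrite (dot_sym phiL2) lt// conjc0 !xpair_eqE (gt_eqF j21) andbF.
have [j0|j0] := eqVneq j1 0.
  rewrite j0 (dot_wavelets_unit_scale phiL2) !xpair_eqE eqxx andbT.
  have [<-|l12] := eqVneq l1 l2; last first.
    have d0 : l2 - l1 != 0 by rewrite subr_eq0 eq_sym.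
    have /(kernel_shift_conditionP phiL2) -> := h2 _ d0.
    by rewrite mulr0 andbF.
  rewrite subrr; under eq_fun do rewrite addr0 -surjective_pairing.
  rewrite h1 subr_eq0 andbT.
  by have [->|] := eqVneq k1 k2; rewrite ?mulr0// subrr mulr0 expi0 mulr1.
rewrite (dot_wavelets_common_scale phiL2)// !xpair_eqE eqxx andbT.
have [<-|l12] := eqVneq l1 l2; last first.
  by have /(Q_fun_eq0P phiL2 j0) -> := h4 _ _ _ j0 l12; rewrite !mulr0 andbF.
have /(R_fun_constP phiL2 j0) -> := h5 _ l1 j0.
rewrite subr_eq0 andbT (mulrA _%:C _%:C) -(rmorphM (real_complex R)) mulVf ?R_fun_target_neq0// mul1r.
by have [->|] := eqVneq k1 k2; rewrite ?mulr0// subrr mulr0 expi0 mulr1.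
Qed.
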